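(* There is an absolute constant $C_0>0$ such that the following holds. Assume: (a) $d\le n$ and $\eta_1 := C_0\sigma_x^2\sqrt{d/n}<\tfrac12$; (b) $r_d(\Sigma)/n\le C_1$ for a constant $C_1>0$; (c) for some constant $0<\delta_1<1$, $\dfrac{\Vert\theta^*_{(d+1):p}\Vert^2_{\Sigma_{(d+1):p}}}{\Vert\theta^*_{1:d}\Vert^2_{\Sigma_{1:d}^{-1}}}\le \dfrac{\delta_1}{4(1+\sigma_x^2)}\lambda_{d+1}^2$. Let $A_0$ be a constant with $A_0\ge1$ and $(1+A_0)^2<4\delta_1^{-1}$. Assume further that $\sigma^2\asymp1$ and $\Vert\theta^*_{1:d}\Vert^2_{\Sigma_{1:d}^{-1}}\lambda_d^2\asymp1$. (i) A sufficient condition for $\mathrm{MSE}_{\mathrm{out}}=O(\frac dn)$ with a probability approaching 1 as $n\to\infty$ is that $$\frac{\lambda_{d+1}}{\lambda_d}\lesssim\sqrt{\frac dn}\min\Big\{1,\sqrt{\frac{d}{r_d(\Sigma^2)}}\Big\}$$ and the ridge parameter $\tau$ is chosen in the range $A_0^{-1}\lambda_{d+1}\le\tau\le A_0\lambda_{d+1}$ if $r_d(\Sigma^2)\le d$, or in the range $$A_0^{-1}\lambda_{d+1}\max\Big\{\frac1c\sqrt{\frac{r_d(\Sigma^2)}{d}},1\Big\}\le\tau\le A_0\lambda_d\min\Big\{c\sqrt{\frac dn},1\Big\}$$ if $r_d(\Sigma^2)>d$, where $c\ge1$ is a constant satisfying $\frac{\lambda_{d+1}}{\lambda_d}\le c\sqrt{\frac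 dn}\min\{1,\sqrt{\frac{d}{r_d(\Sigma^2)}}\}$. (ii) Suppose that $n\gg d$ and $r_d(\Sigma^2)\gg d$. Then a necessary condition for $\mathrm{MSE}_{\mathrm{out}}=O(\frac dn)$ with a probability bounded away from $0$ is that $\frac{\lambda_{d+1}}{\lambda_d}\lesssim\sqrt{\frac dn}\sqrt{\frac{d}{r_d(\Sigma^2)}}$ and the ridge parameter $\tau$ is chosen in the range $\sqrt{\frac{r_d(\Sigma^2)}{d}}\,\lambda_{d+1}\lesssim\tau\lesssim\sqrt{\frac dn}\,\lambda_d$. In the case where $n\gg d$ and $r_d(\Sigma^2)\gg d$ in addition to the assumptions stated, the sufficient and necessary conditions on $\frac{\lambda_{d+1}}{\lambda_d}$ become matched: $\frac{\lambda_{d+1}}{\lambda_d}\lesssim\sqrt{\frac dn}\sqrt{\frac{d}{r_d(\Sigma^2)}}$.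
   Context: Model. Let $1\le d<p$ be integers. The data $(y_1,x_1),\dots,(y_n,x_n)$ are i.i.d. from $y_i=x_i^\top\theta^*+\epsilon_i$, where $\theta^*\in\mathbb R^p$, $x_i\in\mathbb R^p$ is random with $E(x_i)=0$, $\mathrm{Var}(x_i)=\Sigma$ non-singular, and $\epsilon_i\in\mathbb R$ is independent of $x_i$ with $E(\epsilon_i)=0$, $\mathrm{Var}(\epsilon_i)=\sigma^2$. Throughout, $\Sigma=\mathrm{Diag}(\lambda_1,\dots,\lambda_p)$ with $\lambda_1\ge\dots\ge\lambda_p>0$. The vector $\Sigma^{-1/2}x_i$ is sub-gaussian with sub-gaussian norm $\sigma_x$, where a real random variable $z$ has norm $\Vert z\Vert_{\psi_2}=\inf\{t>0: E\exp(z^2/t^2)\le 2\}$ and a random vector $Z$ has norm $\sup_{s\ne 0}\Vert\langle s,Z\rangle/\Vert s\Vert\,\Vert_{\psi_2}$. $Y=(y_1,\dots,y_n)^\top$, $X=(x_1,\dots,x_n)^\top$. For $\tau>0$ the ridge estimator is $\hat\theta(\tau)=X^\top(XX^\top+n\tau I_n)^{-1}Y$ (minimizer of $\frac1n\Vert Y-X\theta\Vert^2+\tau\Vert\theta\Vert^2$), and $\hat\theta(0)=\lim_{\tau\to0+}\hat\theta(\tau)$. $\Vert b\Vert_M=(b^\top Mb)^{1/2}$. $\mathrm{MSE}_{\mathrm{out}}=E[\Vert\hat\theta(\tau)-\theta^*\Vert_\Sigma^2\mid X]$. $\theta^*_{1:d}$, $\theta^*_{(d+1):p}$ are the first $d$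 and last $p-d$ entries of $\theta^*$; $\Sigma_{1:d}=\mathrm{Diag}(\lambda_1,\dots,\lambda_d)$, $\Sigma_{(d+1):p}=\mathrm{Diag}(\lambda_{d+1},\dots,\lambda_p)$; $r_d(\Sigma)=\frac{\sum_{j>d}\lambda_j}{\lambda_{d+1}}$, $r_d(\Sigma^2)=\frac{\sum_{j>d}\lambda_j^2}{\lambda_{d+1}^2}$. Asymptotics. One considers a sequence of such models indexed by $n\to\infty$; $p,d,\Sigma,\theta^*,\sigma^2$ and the (deterministic) $\tau\ge0$ may depend on $n$, while $\sigma_x,C_1,\delta_1,A_0$ are fixed. For positive sequences, $a_n\lesssim b_n$ (or $a_n=O(b_n)$) means $a_n\le c\,b_n$ for all large $n$ for some constant $c>0$; $a_n\asymp b_n$ means $a_n\lesssim b_n$ and $b_n\lesssim a_n$; $a_n\ll b_n$ (or $b_n\gg a_n$) means $a_n/b_n\to0$. ''$\mathrm{MSE}=O(d/n)$ with a probability approaching 1'' means that for some constant $C$, $P(\mathrm{MSE}\le C\,d/n)\to1$; ''with a probability bounded away from 0'' means that for some constants $C,\epsilon>0$, $P(\mathrm{MSE}\le C\,d/n)\ge\epsilon$ for all large $n$. *)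

(* Defs.v *)
From HB Require Import structures.
From mathcomp Require Import all_boot all_order all_algebra.
From mathcomp Require Import all_classical all_reals all_analysis.
From mathcomp Require Import measurable_realfun.

Set Implicit Arguments.
Unset Strict Implicit.
Unset Printing Implicit Defensive.

Import Order.TTheory GRing.Theory Num.Theory.
Import numFieldNormedType.Exports.

Local Open Scope classical_set_scope.
Local Open Scope ring_scope.

Definition mutually_independent d (T : measurableType d) (R : realType)
    (P : probability T R) d' (S : measurableType d') (I : finType)
    (Z : I -> T -> S) : Prop :=
  forall (J : {set I}) (B : I -> set S), (forall i, measurable (B i)) ->
    P (\bigcap_(i in [set i | i \in J]) Z i @^-1` B i) =
    (\prod_(i in J) P (Z i @^-1` B i))%E.

Definition identically_distributed d (T : measurableType d) (R : realType)
    (P : probability T R) d' (S : measurableType d') (I : finType)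
    (Z : I -> T -> S) : Prop :=
  forall (i j : I) (B : set S), measurable B ->
    P (Z i @^-1` B) = P (Z j @^-1` B).

Definition independent_RV d (T : measurableType d) (R : realType)
    (P : probability T R) d1 (S1 : measurableType d1)
    d2 (S2 : measurableType d2) (U : T -> S1) (V : T -> S2) : Prop :=
  forall (A : set S1) (B : set S2), measurable A -> measurable B ->
    P (U @^-1` A `&` V @^-1` B) = (P (U @^-1` A) * P (V @^-1` B))%E.

(* [M] is a version of the conditional expectation of the nonnegative function
   [f] given [V].  Values are in [0, +oo], so that no integrability of [f] is
   presupposed; two versions agree almost surely as soon as one of them is
   almost surely finite. *)
Definition is_cond_expectation d (T : measurableType d) (R : realType)
    (P : probability T R) d' (S : measurableType d') (V : T -> S)
    (f M : T -> \bar R) : Prop :=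
  [/\ forall w, (0 <= M w)%E,
      forall B : set (\bar R), measurable B ->
        g_sigma_algebra_preimage V (M @^-1` B)
    & forall A : set T, g_sigma_algebra_preimage V A ->
        (\int[P]_(w in A) M w = \int[P]_(w in A) f w)%E].

Definition normM (R : realType) (k : nat) (M : 'M[R]_k) (b : 'cV[R]_k) : R :=
  Num.sqrt ((b^T *m M *m b) 0 0).

(* The infimum of the empty set is +oo, the norm of a variable which is not
   sub-gaussian. *)
Definition psi2_norm d (T : measurableType d) (R : realType)
    (P : probability T R) (z : T -> R) : \bar R :=
  ereal_inf [set t%:E | t in
    [set t : R | 0 < t /\ ('E_P[fun w => expR (z w ^+ 2 / t ^+ 2)] <= 2%:E)%E]].

Definition psi2_norm_vec d (T : measurableType d) (R : realType)
    (P : probability T R) (k : nat) (Z : T -> 'cV[R]_k) : \bar R :=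
  ereal_sup [set psi2_norm P (fun w => (s^T *m Z w) 0 0 / normM 1%:M s) |
    s in [set s : 'cV[R]_k | s != 0]].

Definition ridge_pos (R : realType) (n p : nat) (X : 'M[R]_(n, p))
    (Y : 'cV[R]_n) (tau : R) : 'cV[R]_p :=
  X^T *m invmx (X *m X^T + (n%:R * tau)%:M) *m Y.

(* Used for [0 <= tau] only: the second branch is the ridgeless estimator. *)
Definition ridge (R : realType) (n p : nat) (X : 'M[R]_(n, p))
    (Y : 'cV[R]_n) (tau : R) : 'cV[R]_p :=
  if 0 < tau then ridge_pos X Y tau
  else lim (ridge_pos X Y t @[t --> (0 : R)^'+]).

(* The dimension is p = mhead + mtail, where mhead is the d of the statement;
   1 <= d < p thus reads 0 < mhead and 0 < mtail. *)
Record model (R : realType) (n : nat) := Model {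
  mdisp : measure_display;
  Omega : measurableType mdisp;
  prob : probability Omega R;
  mhead : nat;
  mtail : nat;
  lambda : (mhead + mtail).-tuple R;
  theta : 'cV[R]_(mhead + mtail);
  sigma : R;
  covar : 'I_n -> {RV prob >-> (mhead + mtail).-tuple R};
  noise : 'I_n -> {RV prob >-> R}
}.

Definition mdim (R : realType) (n : nat) (m : model R n) : nat :=
  (mhead m + mtail m)%N.

(* 1-based: [lam m j] is lambda_j. *)
Definition lam (R : realType) (n : nat) (m : model R n) (j : nat) : R :=
  (lambda m)`_j.-1.

Definition Sigma (R : realType) (n : nat) (m : model R n) : 'M[R]_(mdim m) :=
  diag_mx (\row_(j < mdim m) lam m j.+1).

Definition Sigma_head (R : realType) (n : nat) (m : model R n) :
    'M[R]_(mhead m) :=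
  diag_mx (\row_(j < mhead m) lam m j.+1).

Definition Sigma_tail (R : realType) (n : nat) (m : model R n) :
    'M[R]_(mtail m) :=
  diag_mx (\row_(j < mtail m) lam m (mhead m + j).+1).

Definition Sigma_isqrt (R : realType) (n : nat) (m : model R n) :
    'M[R]_(mdim m) :=
  diag_mx (\row_(j < mdim m) (Num.sqrt (lam m j.+1))^-1).

Definition theta_head (R : realType) (n : nat) (m : model R n) :
    'cV[R]_(mhead m) := usubmx (theta m).

Definition theta_tail (R : realType) (n : nat) (m : model R n) :
    'cV[R]_(mtail m) := dsubmx (theta m).

(* The effective rank r_d(Sigma ^ k), d = mhead m. *)
Definition eff_rank (R : realType) (n : nat) (m : model R n) (k : nat) : R :=
  (\sum_((mhead m).+1 <= j < (mdim m).+1) lam m j ^+ k) /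
  lam m (mhead m).+1 ^+ k.

Definition xcoord (R : realType) (n : nat) (m : model R n) (i : 'I_n)
    (j : 'I_(mdim m)) (w : Omega m) : R :=
  tnth (covar m i w) j.

Definition xvec (R : realType) (n : nat) (m : model R n) (i : 'I_n)
    (w : Omega m) : 'cV[R]_(mdim m) :=
  \col_j xcoord i j w.

Definition yobs (R : realType) (n : nat) (m : model R n) (i : 'I_n)
    (w : Omega m) : R :=
  ((xvec i w)^T *m theta m) 0 0 + noise m i w.

Definition Xmat (R : realType) (n : nat) (m : model R n) (w : Omega m) :
    'M[R]_(n, mdim m) :=
  \matrix_(i, j) xcoord i j w.

Definition Yvec (R : realType) (n : nat) (m : model R n) (w : Omega m) :
    'cV[R]_n :=
  \col_i yobs i w.

(* The rows of [Xmat] as an element of a measurable space (matrices carry no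
   sigma-algebra). *)
Definition Xtuple (R : realType) (n : nat) (m : model R n) (w : Omega m) :
    n.-tuple ((mhead m + mtail m).-tuple R) :=
  [tuple covar m i w | i < n].

Definition model_axioms (R : realType) (sigma_x : R) (n : nat) (m : model R n) :
    Prop :=
  (0 < mhead m)%N /\ (0 < mtail m)%N /\
  sorted >=%R (lambda m) /\ (forall j, 0 < tnth (lambda m) j) /\
  mutually_independent (prob m) (fun i w => (yobs i w, covar m i w)) /\
  identically_distributed (prob m) (fun i w => (yobs i w, covar m i w)) /\
  (forall i, independent_RV (prob m) (noise m i) (covar m i)) /\
  (forall i j, ('E_(prob m)[xcoord i j] = 0)%E) /\
  (forall i j k, covariance (prob m) (xcoord i j) (xcoord i k) =
     (Sigma m j k)%:E) /\
  (forall i, ('E_(prob m)[noise m i] = 0)%E) /\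
  (forall i, ('V_(prob m)[noise m i] = (sigma m ^+ 2)%:E)%E) /\
  (forall i, psi2_norm_vec (prob m) (fun w => Sigma_isqrt m *m xvec i w) =
     sigma_x%:E).

Definition out_loss (R : realType) (n : nat) (m : model R n) (tau : R)
    (w : Omega m) : R :=
  normM (Sigma m) (ridge (Xmat w) (Yvec w) tau - theta m) ^+ 2.

Definition is_MSE_out (R : realType) (n : nat) (m : model R n) (tau : R)
    (M : Omega m -> \bar R) : Prop :=
  is_cond_expectation (prob m) (@Xtuple R n m)
    (fun w => (out_loss tau w)%:E) M.

Definition lesssim (R : realType) (a b : nat -> R) : Prop :=
  exists2 c : R, 0 < c & \forall n \near \oo, a n <= c * b n.

Definition asymp_eq (R : realType) (a b : nat -> R) : Prop :=
  lesssim a b /\ lesssim b a.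

Definition much_less (R : realType) (a b : nat -> R) : Prop :=
  a n / b n @[n --> \oo] --> (0 : R).

Definition rate_prob_to_1 (R : realType) (m : forall n, model R n)
    (M : forall n, Omega (m n) -> \bar R) : Prop :=
  exists C : R,
    prob (m n) [set w | (M n w <= (C * ((mhead (m n))%:R / n%:R))%:E)%E]
      @[n --> \oo] --> (1 : \bar R)%E.
Arguments rate_prob_to_1 {R} m M.

Definition rate_prob_away_0 (R : realType) (m : forall n, model R n)
    (M : forall n, Omega (m n) -> \bar R) : Prop :=
  exists C eps : R, [/\ 0 < C, 0 < eps & \forall n \near \oo,
    (eps%:E <=
     prob (m n) [set w | (M n w <= (C * ((mhead (m n))%:R / n%:R))%:E)%E])%E].
Arguments rate_prob_away_0 {R} m M.

Definition eig_ratio (R : realType) (n : nat) (m : model R n) : R :=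
  lam m (mhead m).+1 / lam m (mhead m).

Definition suff_bound (R : realType) (n : nat) (m : model R n) : R :=
  Num.sqrt ((mhead m)%:R / n%:R) *
  Num.min 1 (Num.sqrt ((mhead m)%:R / eff_rank m 2)).

Definition nec_bound (R : realType) (n : nat) (m : model R n) : R :=
  Num.sqrt ((mhead m)%:R / n%:R) *
  Num.sqrt ((mhead m)%:R / eff_rank m 2).

Definition suff_tau_range (R : realType) (A0 c : R) (n : nat) (m : model R n)
    (tau : R) : Prop :=
  let d := mhead m in
  if eff_rank m 2 <= d%:R then
    A0^-1 * lam m d.+1 <= tau <= A0 * lam m d.+1
  else
    A0^-1 * lam m d.+1 * Num.max (c^-1 * Num.sqrt (eff_rank m 2 / d%:R)) 1
      <= tau <= A0 * lam m d * Num.min (c * Num.sqrt (d%:R / n%:R)) 1.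

(* Main.v *)
(* Write X = [X1 X2] for the head and tail coordinates.  On an event of high
   probability |X1 v|^2 is comparable to n |v|^2 in the Sigma_head norm,
   X2 X2^T <= O(n lambda_(d+1)), and the scalars |X2 theta_tail|^2 and
   T = sum_k lambda_k |X2 e_k|^2 have their expected order.  Given X the risk is
   bias + sigma^2 trace, and the normal equations turn these four facts into
     risk <~ tau^2 |theta_head|^2 + |theta_tail|^2 + d/n
             + r_d(Sigma^2) lambda_(d+1)^2 / (n tau^2)
   (norms in Sigma_head^-1 and Sigma_tail) and, conversely, into a lower bound
   by r_d(Sigma^2) lambda_(d+1)^2 / (n (tau + O(lambda_(d+1)))^2) and by
   tau^2 |theta_head|^2 up to the other terms.  Balancing these terms against
   d/n gives both ranges for tau, hence the condition on the eigenvalue ratio.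
   The bound on X2 must not depend on p: the tail is cut into blocks of n
   coordinates, and the net argument on the blocks is averaged with the leading
   eigenvalues of the blocks, whose sum is O(lambda_(d+1)), as weights. *)

Require Import Defs.
From HB Require Import structures.
From mathcomp Require Import all_boot all_order all_algebra.
From mathcomp Require Import all_classical all_reals all_analysis.
From mathcomp Require Import measurable_realfun.
From mathcomp Require Import ring lra zify.

Import Order.TTheory GRing.Theory Num.Theory.
Import numFieldNormedType.Exports.
Import HBNNSimple.

Set Implicit Arguments.
Unset Strict Implicit.
Unset Printing Implicit Defensive.

Local Open Scope classical_set_scope.
Local Open Scope ring_scope.

(** The Gram matrix is never diagonalised; its inverse enters only through the bound 1/(n tau) and
    through energy identities. The head part of the trace comes from the bias bound itself, applied
    to the signals e_i. For the lower bound on the trace the obstacle is that the columns of X2 may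
    lie close to the range of X1, where the inverse is small. This overlap is measured by
    [cross_energy], whose mean is of order n d times the sum of the squared tail eigenvalues;
    divided by n it competes with T, of order n times the same sum, and is negligible when n >> d.
    The risk given X is only a version of a conditional expectation, so it is compared with the
    explicit risk on events determined by X and never identified with it pointwise; each comparison
    costs a strict gap, absorbed in the constant of O(d/n). In part (ii) a single design in the good
    event with small risk is enough, since the resulting inequalities on tau are deterministic. At
    tau = 0 the variance bound is obtained by a limit along a sequence, and then rules this value
    out. *)

Lemma eq_ler d (T : porderType d) (x y : T) : x = y -> (x <= y)%O.
Proof. by move->. Qed.

(** * Ridge regression with a fixed design *)

Section dotp.
Variable R : realFieldType.

Definition dotp k (u v : 'cV[R]_k) : R := \sum_i u i 0 * v i 0.
Definition sqn k (u : 'cV[R]_k) : R := dotp u u.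

Lemma dotpE k (u v : 'cV[R]_k) : dotp u v = (u^T *m v) 0 0.
Proof. by rewrite mxE; apply: eq_bigr => i _; rewrite mxE. Qed.

Lemma dotpC k (u v : 'cV[R]_k) : dotp u v = dotp v u.
Proof. by apply: eq_bigr => i _; rewrite mulrC. Qed.

Lemma dotpDl k (u v w : 'cV[R]_k) : dotp (u + v) w = dotp u w + dotp v w.
Proof. by rewrite -big_split; apply: eq_bigr => i _; rewrite mxE mulrDl. Qed.

Lemma dotpDr k (u v w : 'cV[R]_k) : dotp w (u + v) = dotp w u + dotp w v.
Proof. by rewrite dotpC dotpDl !(dotpC w). Qed.

Lemma dotpNl k (u v : 'cV[R]_k) : dotp (- u) v = - dotp u v.
Proof. by rewrite -sumrN; apply: eq_bigr => i _; rewrite mxE mulNr. Qed.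

Lemma dotpNr k (u v : 'cV[R]_k) : dotp u (- v) = - dotp u v.
Proof. by rewrite dotpC dotpNl dotpC. Qed.

Lemma dotpZl k a (u v : 'cV[R]_k) : dotp (a *: u) v = a * dotp u v.
Proof. by rewrite mulr_sumr; apply: eq_bigr => i _; rewrite mxE mulrA. Qed.

Lemma dotpZr k a (u v : 'cV[R]_k) : dotp u (a *: v) = a * dotp u v.
Proof. by rewrite dotpC dotpZl dotpC. Qed.

Lemma dotp_mulmxr k l (A : 'M[R]_(k, l)) u v :
  dotp u (A *m v) = dotp (A^T *m u) v.
Proof. by rewrite !dotpE trmx_mul trmxK mulmxA. Qed.

Lemma dotp_mulmxl k l (A : 'M[R]_(k, l)) u v :
  dotp (A *m v) u = dotp v (A^T *m u).
Proof. by rewrite dotpC dotp_mulmxr dotpC. Qed.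

Lemma sqnE k (u : 'cV[R]_k) : sqn u = \sum_i u i 0 ^+ 2.
Proof. by apply: eq_bigr => i _; rewrite expr2. Qed.

Lemma sqn_ge0 k (u : 'cV[R]_k) : 0 <= sqn u.
Proof. by rewrite sqnE sumr_ge0// => i _; rewrite sqr_ge0. Qed.

Lemma sqn_eq0 k (u : 'cV[R]_k) : sqn u = 0 -> u = 0.
Proof.
rewrite sqnE => /psumr_eq0P u0; apply/matrixP => i j; rewrite ord1 mxE.
by apply/eqP; rewrite -sqrf_eq0; apply/eqP/u0 => // k' _; rewrite sqr_ge0.
Qed.

Lemma sqnN k (u : 'cV[R]_k) : sqn (- u) = sqn u.
Proof. by rewrite /sqn dotpNl dotpNr opprK. Qed.

Lemma sqnZ k a (u : 'cV[R]_k) : sqn (a *: u) = a ^+ 2 * sqn u.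
Proof. by rewrite /sqn dotpZl dotpZr mulrA expr2. Qed.

Lemma sqnD k (u v : 'cV[R]_k) : sqn (u + v) = sqn u + 2 * dotp u v + sqn v.
Proof. by rewrite /sqn dotpDl !dotpDr (dotpC v u); ring. Qed.

Lemma sqnD_le k (u v : 'cV[R]_k) : sqn (u + v) <= 2 * sqn u + 2 * sqn v.
Proof.
have := sqn_ge0 (u - v); rewrite !sqnD sqnN dotpNr; lra.
Qed.

Lemma sqn_col_mx k l (u : 'cV[R]_k) (v : 'cV[R]_l) :
  sqn (col_mx u v) = sqn u + sqn v.
Proof.
rewrite !sqnE big_split_ord /=; congr (_ + _); apply: eq_bigr => i _.
  by rewrite col_mxEu.
by rewrite col_mxEd.
Qed.

Lemma dotp0l k (v : 'cV[R]_k) : dotp 0 v = 0.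
Proof. by rewrite /dotp big1// => i _; rewrite mxE mul0r. Qed.

Lemma dotp0r k (v : 'cV[R]_k) : dotp v 0 = 0.
Proof. by rewrite dotpC dotp0l. Qed.

Lemma dotp_sqr_le k (u v : 'cV[R]_k) : dotp u v ^+ 2 <= sqn u * sqn v.
Proof.
have [u0|u0] := eqVneq (sqn u) 0.
  by rewrite u0 (sqn_eq0 u0) dotp0l expr0n mul0r.
have up : 0 < sqn u by rewrite lt_neqAle eq_sym u0 sqn_ge0.
have := sqn_ge0 (sqn u *: v - dotp u v *: u).
rewrite sqnD sqnN !sqnZ dotpNr dotpZl dotpZr (dotpC v u) => H.
have : 0 <= sqn u * (sqn u * sqn v - dotp u v ^+ 2) by move: H; congr (_ <= _); ring.
by rewrite pmulr_rge0// subr_ge0.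
Qed.

Lemma dotp_young k c (u v : 'cV[R]_k) : 0 < c ->
  2 * dotp u v <= c * sqn u + c^-1 * sqn v.
Proof.
move=> c0; have := sqn_ge0 (c *: u - v).
rewrite sqnD sqnN dotpNr dotpZl sqnZ => H.
rewrite -(ler_pM2l c0) mulrDr mulVKf ?gt_eqF//.
by move: H; lra.
Qed.

Lemma sqn_mulmx k l (A : 'M[R]_(k, l)) u : sqn (A *m u) = dotp u (A^T *m A *m u).
Proof. by rewrite /sqn dotp_mulmxl mulmxA. Qed.

Lemma sqn_delta k (j : 'I_k) : sqn (delta_mx j 0) = 1 :> R.
Proof.
rewrite sqnE (bigD1 j)//= mxE !eqxx expr1n big1 ?addr0// => i ij.
by rewrite mxE (negbTE ij) expr0n.
Qed.

(** With v = A^T u one has |v|^2 = <u, A v>, so Cauchy-Schwarz bounds |v|^4 by c |u|^2 |v|^2 and one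
    factor |v|^2 cancels. *)
Lemma sqn_mulmx_tr k l (A : 'M[R]_(k, l)) c : 0 <= c ->
  (forall v, sqn (A *m v) <= c * sqn v) ->
  forall u, sqn (A^T *m u) <= c * sqn u.
Proof.
move=> c0 Hc u; set v := A^T *m u.
have E : sqn v = dotp u (A *m v) by rewrite dotp_mulmxr.
have [v0|v0] := eqVneq (sqn v) 0; first by rewrite v0 mulr_ge0 ?sqn_ge0.
have vp : 0 < sqn v by rewrite lt_neqAle eq_sym v0 sqn_ge0.
have := dotp_sqr_le u (A *m v); rewrite -E => H.
rewrite -(ler_pM2r vp) -expr2 (le_trans H)//.
rewrite [leRHS]mulrAC mulrC ler_wpM2r ?sqn_ge0//.
Qed.

Definition gram_reg n p (X : 'M[R]_(n, p)) (s : R) : 'M[R]_n := X *m X^T + s%:M.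

Lemma gram_regE n p (X : 'M[R]_(n, p)) s (u : 'cV_n) :
  gram_reg X s *m u = X *m (X^T *m u) + s *: u.
Proof. by rewrite mulmxDl mulmxA mul_scalar_mx. Qed.

Lemma tr_gram_reg n p (X : 'M[R]_(n, p)) s : (gram_reg X s)^T = gram_reg X s.
Proof. by rewrite /gram_reg linearD /= trmx_mul trmxK tr_scalar_mx. Qed.

Lemma dotp_gram_reg n p (X : 'M[R]_(n, p)) s (u : 'cV_n) :
  dotp u (gram_reg X s *m u) = sqn (X^T *m u) + s * sqn u.
Proof. by rewrite gram_regE dotpDr dotp_mulmxr dotpZr. Qed.

Lemma gram_reg_unit n p (X : 'M[R]_(n, p)) s : 0 < s -> gram_reg X s \in unitmx.
Proof.
move=> s0; rewrite -unitmx_tr -row_free_unit; apply/inj_row_free => v.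
move=> /(congr1 trmx); rewrite trmx_mul trmxK trmx0 => H.
have := dotp_gram_reg X s v^T; rewrite H dotp0r => E.
have : sqn v^T = 0.
  by have := sqn_ge0 (X^T *m v^T); have := sqn_ge0 v^T; nra.
by move=> /sqn_eq0/(congr1 trmx); rewrite trmxK trmx0.
Qed.

(** In the expansion of |(X X^T + s) v|^2 the cross term 2 s |X^T v|^2 is nonnegative, which leaves
    at least s^2 |v|^2. *)
Lemma sqn_gram_reg_inv n p (X : 'M[R]_(n, p)) s (u : 'cV_n) : 0 < s ->
  s ^+ 2 * sqn (invmx (gram_reg X s) *m u) <= sqn u.
Proof.
move=> s0; set v := _ *m u.
have -> : u = gram_reg X s *m v by rewrite mulKVmx// gram_reg_unit.
have E : sqn (gram_reg X s *m v) = sqn (X *m (X^T *m v)) +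
    2 * s * sqn (X^T *m v) + s ^+ 2 * sqn v.
  by rewrite gram_regE sqnD dotpZr (dotpC _ v) dotp_mulmxr sqnZ /sqn; ring.
rewrite E; have := sqn_ge0 (X *m (X^T *m v)); have := sqn_ge0 (X^T *m v).
nra.
Qed.

Definition reg_inv n p (X : 'M[R]_(n, p)) (s : R) : 'M[R]_(p, n) :=
  X^T *m invmx (gram_reg X s).

(* [X X^T] is symmetric, so its kernel is that of its square. *)
Lemma gram_pinv n p (X : 'M[R]_(n, p)) :
  exists C : 'M[R]_n, X *m X^T = C *m (X *m X^T) *m (X *m X^T).
Proof.
set M := X *m X^T.
have MT : M^T = M by rewrite /M trmx_mul trmxK.
have kerM (v : 'rV_n) : v *m (M *m M) = 0 -> v *m M = 0.
  move=> H; have : sqn (v *m M)^T = 0.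
    by rewrite /sqn dotpE trmxK trmx_mul MT -mulmxA (mulmxA M) mulmxA H mul0mx mxE.
  by move/sqn_eq0/(congr1 trmx); rewrite trmxK trmx0.
have kerS : (kermx (M *m M) <= kermx M)%MS.
  apply/sub_kermxP/row_matrixP => i; rewrite row_mul row0; apply: kerM.
  by rewrite -row_mul mulmx_ker row0.
have : (M <= M *m M)%MS.
  have [rk <-] := mxrank_leqif_sup (submxMl M M).
  rewrite eqn_leq rk /=; have := mxrankS kerS; rewrite !mxrank_ker.
  have := rank_leq_row M; have := rank_leq_row (M *m M).
  by move: (\rank M) (\rank (M *m M)) => r1 r2; lia.
by move=> /submxP[C HC]; exists C; rewrite -mulmxA.
Qed.

(** The limit is X^T C^T with C from [gram_pinv]: every v splits as M a + b with M = X X^T, a = C^T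
    v and X^T b = 0. The explicit linear rate in s makes the limit independent of the way s tends to
    0. *)
Lemma ridge_mx_cvg n p (X : 'M[R]_(n, p)) :
  exists (W : 'M[R]_(p, n)), forall Y : 'cV[R]_n,
    exists2 K : R, 0 <= K & forall s j, 0 < s ->
      `|((X^T *m invmx (gram_reg X s)) *m Y) j 0 - (W *m Y) j 0| <= s * K.
Proof.
have [C HC] := gram_pinv X; exists (X^T *m C^T) => Y.
set M := X *m X^T in HC.
have MT : M^T = M by rewrite /M trmx_mul trmxK.
have HC' : M = M *m M *m C^T by rewrite -[LHS]MT -mulmxA -{2 3}MT -(trmx_mul C) -trmx_mul -HC.
have XC (v : 'cV[R]_n) : X^T *m v = X^T *m M *m C^T *m v.
  apply/eqP; rewrite -subr_eq0; apply/eqP/sqn_eq0.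
  rewrite -!mulmxA -mulmxBr sqn_mulmx trmxK -/M mulmxBr {1}HC'.
  by rewrite !mulmxA subrr dotp0r.
have [c c0 Xc] : exists2 c : R, 0 <= c & forall u, sqn (X^T *m u) <= c * sqn u.
  exists (\sum_j sqn (col j X)); first by rewrite sumr_ge0// => j _; exact: sqn_ge0.
  move=> u; rewrite sqnE mulr_suml; apply: ler_sum => j _.
  have -> : (X^T *m u) j 0 = dotp (col j X) u.
    by rewrite mxE; apply: eq_bigr => i _; rewrite !mxE.
  exact: dotp_sqr_le.
have ent k (x : 'cV[R]_k) j : `|x j 0| <= 1 + sqn x.
  have : x j 0 ^+ 2 <= sqn x.
    by rewrite sqnE (bigD1 j)//= lerDl sumr_ge0// => i _; rewrite sqr_ge0.
  have := sqr_ge0 (`|x j 0| - 1); rewrite -(real_normK (num_real (x j 0))).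
  have := normr_ge0 (x j 0); nra.
set a' := C^T *m (C^T *m Y).
exists (1 + sqn (X^T *m a') + (1 + c * sqn a')).
  by rewrite !addr_ge0 ?mulr_ge0 ?sqn_ge0.
move=> s j s0; set Ai := invmx (gram_reg X s).
have uA := gram_reg_unit X s0.
(* The part b is killed by X^T and is an eigenvector of the regularised Gram matrix with eigenvalue
   s, while M a differs from (M + s) a by s a. *)
have step (v : 'cV[R]_n) : X^T *m Ai *m v = X^T *m (C^T *m v) - s *: (X^T *m Ai *m (C^T *m v)).
  pose a := C^T *m v; pose b := v - M *m a.
  have Xb : X^T *m b = 0 by rewrite mulmxBr {1}XC /a !mulmxA subrr.
  have Aib : Ai *m b = s^-1 *: b.
    rewrite -[in LHS](scale1r b) -(@mulVf _ s) ?gt_eqF// -scalerA.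
    have -> : s *: b = gram_reg X s *m b by rewrite gram_regE Xb mulmx0 add0r.
    by rewrite -scalemxAr mulKmx.
  have vE : v = gram_reg X s *m a - s *: a + b.
    by rewrite gram_regE addrK mulmxA -/M addrC subrK.
  rewrite {1}vE mulmxDr -[X in _ + X]mulmxA Aib -scalemxAr Xb scaler0 addr0.
  by rewrite mulmxBr -[X in X - _]mulmxA mulKmx// -scalemxAr.
(* One use of [step] leaves a remainder s X^T Ai C^T Y in which Ai may be of size 1/s. A second use
   rewrites it so that Ai comes with its own factor s, and s Ai is a contraction. *)
have -> : X^T *m Ai *m Y = X^T *m C^T *m Y - s *: (X^T *m a' - s *: (X^T *m Ai *m a')).
  by rewrite step (step (C^T *m Y)) (mulmxA X^T C^T Y).
clearbody a'.
rewrite [X in `|X|](_ : _ = - (s * ((X^T *m a') j 0 - (X^T *m (s *: (Ai *m a'))) j 0)));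
  last first.
  rewrite -scalemxAr (mulmxA X^T Ai a').
  by move: (X^T *m C^T *m Y) (X^T *m a') (X^T *m Ai *m a') => u1 u2 u3; rewrite !mxE; ring.
rewrite normrN normrM (gtr0_norm s0) ler_pM2l// (le_trans (ler_normB _ _))//.
rewrite lerD// (le_trans (ent _ _ _))// lerD2l (le_trans (Xc _))// ler_wpM2l//.
by rewrite sqnZ sqn_gram_reg_inv.
Qed.

End dotp.

(** * Weighted norms and energy estimates for the ridge error *)

Section weighted.
Variable R : realFieldType.

Definition wsq k (l : 'I_k -> R) (v : 'cV[R]_k) : R := \sum_i l i * v i 0 ^+ 2.

Lemma wsq_ge0 k (l : 'I_k -> R) v : (forall i, 0 <= l i) -> 0 <= wsq l v.
Proof. by move=> l0; apply: sumr_ge0 => i _; rewrite mulr_ge0 ?sqr_ge0. Qed.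

Lemma wsqN k (l : 'I_k -> R) v : wsq l (- v) = wsq l v.
Proof. by apply: eq_bigr => i _; rewrite mxE sqrrN. Qed.

Lemma wsqZ k (l : 'I_k -> R) a v : wsq l (a *: v) = a ^+ 2 * wsq l v.
Proof. by rewrite mulr_sumr; apply: eq_bigr => i _; rewrite mxE; ring. Qed.

Lemma wsqD_le k (l : 'I_k -> R) u v : (forall i, 0 <= l i) ->
  wsq l (u + v) <= 2 * wsq l u + 2 * wsq l v.
Proof.
move=> l0; rewrite !mulr_sumr -big_split; apply: ler_sum => i _ /=.
rewrite mxE; have := mulr_ge0 (l0 i) (sqr_ge0 (u i 0 - v i 0)); lra.
Qed.

Lemma wsq_le_sqn k (l : 'I_k -> R) a v : (forall i, l i <= a) -> wsq l v <= a * sqn v.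
Proof.
move=> la; rewrite sqnE mulr_sumr; apply: ler_sum => i _.
by rewrite ler_wpM2r ?sqr_ge0.
Qed.

Lemma wsq_le_wsq k (l l' : 'I_k -> R) a v : (forall i, l i <= a * l' i) ->
  wsq l v <= a * wsq l' v.
Proof.
move=> la; rewrite mulr_sumr; apply: ler_sum => i _.
by rewrite mulrA ler_wpM2r ?sqr_ge0.
Qed.

Lemma dotp_young_weighted k (l : 'I_k -> R) c u v : (forall i, 0 < l i) -> 0 < c ->
  2 * dotp u v <= c * wsq l u + c^-1 * wsq (fun i => (l i)^-1) v.
Proof.
move=> l0 c0; rewrite !mulr_sumr -big_split; apply: ler_sum => i _ /=.
have cl : 0 < c * l i by rewrite mulr_gt0.
rewrite -(ler_pM2l cl) mulrDr.
have -> : c * l i * (c^-1 * ((l i)^-1 * v i 0 ^+ 2)) = v i 0 ^+ 2.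
  by field; rewrite !gt_eqF.
have := sqr_ge0 (c * l i * u i 0 - v i 0); lra.
Qed.

(** The vector v_i = (A^T r)_i / l_i has l-norm equal to the dual norm of A^T r; testing A on it and
    applying Cauchy-Schwarz gives the claim, as in [sqn_mulmx_tr]. *)
Lemma wsq_tr_le n k (l : 'I_k -> R) (A : 'M[R]_(n, k)) c : 0 <= c ->
  (forall i, 0 < l i) -> (forall v, sqn (A *m v) <= c * wsq l v) ->
  forall r, wsq (fun i => (l i)^-1) (A^T *m r) <= c * sqn r.
Proof.
move=> c0 l0 HA r; set y := A^T *m r.
pose v : 'cV[R]_k := \col_i ((l i)^-1 * y i 0).
have W1 : dotp r (A *m v) = wsq (fun i => (l i)^-1) y.
  by rewrite dotp_mulmxr -/y; apply: eq_bigr => i _; rewrite [v i 0]mxE; ring.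
have W2 : wsq l v = wsq (fun i => (l i)^-1) y.
  by apply: eq_bigr => i _; rewrite [v i 0]mxE; field; rewrite gt_eqF.
have W0 : 0 <= wsq (fun i => (l i)^-1) y.
  by apply: wsq_ge0 => i; rewrite invr_ge0 ltW.
have [->|Wn0] := eqVneq (wsq (fun i => (l i)^-1) y) 0.
  by rewrite mulr_ge0 ?sqn_ge0.
have Wp : 0 < wsq (fun i => (l i)^-1) y by rewrite lt_neqAle eq_sym Wn0.
have H := dotp_sqr_le r (A *m v); rewrite W1 in H.
rewrite -(ler_pM2r Wp) -expr2 (le_trans H)// [leRHS]mulrAC mulrC ler_wpM2r ?sqn_ge0//.
by rewrite -W2.
Qed.

Section core.
Variables (n d q : nat) (X1 : 'M[R]_(n, d)) (X2 : 'M[R]_(n, q)).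
Variables (lh : 'I_d -> R) (N tau : R).
Hypotheses (N0 : 0 < N) (tau0 : 0 < tau) (lh0 : forall i, 0 < lh i).
Let lh' i := (lh i)^-1.

Section upper.
Variables (c L l A0 : R).
Hypotheses (c0 : 0 < c) (L0 : 0 <= L) (l0 : 0 < l) (lA : l <= A0 * tau).
Hypothesis HA : forall v, c * N * wsq lh v <= sqn (X1 *m v).
Hypothesis HB : forall w, sqn (X2 *m w) <= N * L * l * sqn w.
Definition upper_cst := 2 / c * (1 + L * A0).

Lemma upper_cst_gt0 : 0 < upper_cst.
Proof.
have A00 : 0 <= A0 by rewrite -(pmulr_lge0 _ tau0) (le_trans (ltW l0)).
by rewrite mulr_gt0 ?divr_gt0// ltr_pwDl// mulr_ge0.
Qed.

Variables (D1 t1 : 'cV[R]_d) (D2 t2 : 'cV[R]_q).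
Let r := X1 *m D1 + X2 *m D2.
Hypothesis E1 : X1^T *m r + (N * tau) *: D1 = X1^T *m (X2 *m t2) - (N * tau) *: t1.
Hypothesis E2 : X2^T *m r + (N * tau) *: D2 = X2^T *m (X2 *m t2).
Let E := sqn r + N * tau * (sqn D1 + sqn D2).
Let K := upper_cst.

(** Since X1 D1 = r - X2 D2, the lower bound on X1 controls D1 by r and X2 D2. The latter is paid
    for by the penalty on D2, because l <= A0 tau; this is the origin of the factor 1 + L A0 in
    [upper_cst]. *)
Lemma core_head_le : N * wsq lh D1 <= K * E.
Proof.
have H1 := HA D1; have H2 := HB D2.
have H3 : sqn (X1 *m D1) <= 2 * sqn r + 2 * sqn (X2 *m D2).
  by have := sqnD_le r (- (X2 *m D2)); rewrite /r addrK sqnN.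
have A00 : 0 <= A0 by rewrite -(pmulr_lge0 _ tau0) (le_trans (ltW l0)).
have H4 : N * L * l * sqn D2 <= N * L * (A0 * tau) * sqn D2.
  by rewrite ler_wpM2r ?sqn_ge0// ler_wpM2l// mulr_ge0// ltW.
have : c * (N * wsq lh D1) <= 2 * (1 + L * A0) * E.
  have r0 := sqn_ge0 r; have D10 := sqn_ge0 D1; have D20 := sqn_ge0 D2.
  have LA0 : 0 <= L * A0 by rewrite mulr_ge0.
  have Nt : 0 < N * tau by rewrite mulr_gt0.
  have : 0 <= L * A0 * (sqn r + N * tau * sqn D1).
    by rewrite mulr_ge0// addr_ge0// mulr_ge0// ltW.
  have : 0 <= N * tau * (sqn D1 + sqn D2) by rewrite mulr_ge0 ?addr_ge0// ltW.
  rewrite /E; lra.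
move=> H; rewrite /K /upper_cst -(ler_pM2l c0); apply: (le_trans H).
by apply: eq_ler; field; rewrite gt_eqF.
Qed.

Lemma core_tail_le : N * tau * sqn D2 <= E.
Proof.
rewrite /E; have := sqn_ge0 r; have := sqn_ge0 D1; have : 0 < N * tau by rewrite mulr_gt0.
nra.
Qed.

(** Pairing [E1] with D1 and [E2] with D2 gives E = <r, X2 t2> - N tau <D1, t1>. In the weighted
    Young inequality the parameter 1/(2 K tau) is the one for which [core_head_le] turns the D1 term
    into a quarter of E; the other product costs a quarter of |r|^2. *)
Lemma core_energy_le :
  E <= 2 * sqn (X2 *m t2) + 2 * N * K * tau ^+ 2 * wsq lh' t1.
Proof.
have K0 : 0 < K := upper_cst_gt0.
have EE : E = dotp r (X2 *m t2) - N * tau * dotp D1 t1.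
  have e1 := congr1 (dotp D1) E1; have e2 := congr1 (dotp D2) E2.
  have a1 y : dotp D1 (X1^T *m y) = dotp (X1 *m D1) y by rewrite dotp_mulmxr trmxK.
  have a2 y : dotp D2 (X2^T *m y) = dotp (X2 *m D2) y by rewrite dotp_mulmxr trmxK.
  have a3 y : dotp r y = dotp (X1 *m D1) y + dotp (X2 *m D2) y by rewrite -dotpDl.
  move: e1 e2; rewrite !dotpDr !a1 !a2 dotpNr !dotpZr /E /sqn !(a3 _); lra.
have Y1 := @dotp_young _ _ 2^-1 r (X2 *m t2).
have Y2 := @dotp_young_weighted _ lh (2 * K * tau)^-1 (- D1) t1 lh0.
have h1 := Y1 ltac:(lra).
have kt : 0 < 2 * K * tau by apply: mulr_gt0 => //; apply: mulr_gt0.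
have h2 : - (N * tau * (2 * dotp D1 t1)) <=
    N * tau * ((2 * K * tau)^-1 * wsq lh D1) + N * tau * ((2 * K * tau) * wsq lh' t1).
  have := Y2 ltac:(by rewrite invr_gt0).
  rewrite dotpNl wsqN invrK => h.
  have Nt : 0 < N * tau by rewrite mulr_gt0.
  by have := ler_wpM2l (ltW Nt) h; lra.
have h3 : N * tau * ((2 * K * tau)^-1 * wsq lh D1) <= E / 2.
  have -> : N * tau * ((2 * K * tau)^-1 * wsq lh D1) = (N * wsq lh D1) / K / 2.
    by field; rewrite !gt_eqF.
  rewrite ler_pM2r ?invr_gt0// ler_pdivrMr// [leRHS]mulrC; exact: core_head_le.
have r0 := sqn_ge0 r; have D10 := sqn_ge0 D1; have D20 := sqn_ge0 D2.
have Nt : 0 < N * tau by rewrite mulr_gt0.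
have rE : sqn r <= E by rewrite /E lerDl mulr_ge0 ?addr_ge0// ltW.
move: h1 h2 h3; rewrite invrK; lra.
Qed.
End upper.
End core.
End weighted.

Section reg_inv.
Variables (R : realFieldType) (n p : nat) (X : 'M[R]_(n, p)) (s : R).
Hypothesis s0 : 0 < s.

Lemma reg_inv_normal (t : 'cV[R]_p) : let D := reg_inv X s *m X *m t - t in
  X^T *m (X *m D) + s *: (D + t) = 0.
Proof.
move=> D; pose v := invmx (gram_reg X s) *m (X *m t).
have DE : D = X^T *m v - t by rewrite /D /reg_inv /v !mulmxA.
have AE : gram_reg X s *m v = X *m t by rewrite mulKVmx// gram_reg_unit.
rewrite DE subrK mulmxBr -AE gram_regE opprD addrA subrr add0r.
by rewrite mulmxN -scalemxAr addNr.
Qed.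

Lemma reg_inv_row j :
  \sum_i reg_inv X s j i ^+ 2 = sqn (invmx (gram_reg X s) *m col j X).
Proof.
have -> : invmx (gram_reg X s) *m col j X = (row j (reg_inv X s))^T.
  by rewrite /reg_inv row_mul trmx_mul trmx_inv tr_gram_reg tr_row trmxK.
by rewrite sqnE; apply: eq_bigr => i _; rewrite !mxE.
Qed.

End reg_inv.

Section split.
Variables (R : realFieldType) (n d q : nat) (X : 'M[R]_(n, d + q)).
Variables (lam : 'I_(d + q) -> R) (N tau : R).
Hypotheses (N0 : 0 < N) (tau0 : 0 < tau) (lam0 : forall j, 0 < lam j).
Variables (t : 'cV[R]_(d + q)) (s2 : R).
Hypothesis s20 : 0 <= s2.
Let X1 := lsubmx X.
Let X2 := rsubmx X.
Let t1 := usubmx t.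
Let t2 := dsubmx t.
Let lh i := lam (lshift q i).
Let lh' i := (lh i)^-1.
Let lt k := lam (rshift d k).
Let s := N * tau.
Let D := reg_inv X s *m X *m t - t.
Let D1 := usubmx D.
Let D2 := dsubmx D.

Let s0 : 0 < s. Proof. by rewrite mulr_gt0. Qed.

Lemma mulmx_split (v : 'cV[R]_(d + q)) :
  X *m v = X1 *m usubmx v + X2 *m dsubmx v.
Proof. by rewrite -[in LHS](hsubmxK X) -[in LHS](vsubmxK v) mul_row_col. Qed.

Lemma trmx_split : X^T = col_mx X1^T X2^T.
Proof. by rewrite -[in LHS](hsubmxK X) tr_row_mx. Qed.

Lemma normal_head : X1^T *m (X *m D) + s *: (D1 + t1) = 0.
Proof.
have UD (a b : 'cV[R]_(d + q)) : usubmx (a + b) = usubmx a + usubmx b by rewrite linearD.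
have UZ (a : 'cV[R]_(d + q)) : usubmx (s *: a) = s *: usubmx a by rewrite linearZ.
have := congr1 usubmx (reg_inv_normal X s0 t); rewrite -/D UD UZ UD linear0 => <-.
by rewrite trmx_split mul_col_mx col_mxKu.
Qed.

Lemma normal_tail : X2^T *m (X *m D) + s *: (D2 + t2) = 0.
Proof.
have UD (a b : 'cV[R]_(d + q)) : dsubmx (a + b) = dsubmx a + dsubmx b by rewrite linearD.
have UZ (a : 'cV[R]_(d + q)) : dsubmx (s *: a) = s *: dsubmx a by rewrite linearZ.
have := congr1 dsubmx (reg_inv_normal X s0 t); rewrite -/D UD UZ UD linear0 => <-.
by rewrite trmx_split mul_col_mx col_mxKd.
Qed.

(** The risk given the design of the linear estimator sending Y to M Y, for noise of variance [s2]:
    squared bias plus variance, coordinate by coordinate. It is stated for an arbitrary operator M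
    so that the ridgeless one can be reached by continuity in M. *)
Definition risk_form (M : 'M[R]_(d + q, n)) : R :=
  \sum_j lam j * ((M *m X *m t - t) j 0 ^+ 2 + s2 * \sum_i M j i ^+ 2).

Definition tail_energy := \sum_k lt k * sqn (col k X2).

Lemma risk_formE : risk_form (reg_inv X s) = wsq lh D1 + wsq lt D2 +
  s2 * (\sum_i lh i * sqn (invmx (gram_reg X s) *m col i X1) +
        \sum_k lt k * sqn (invmx (gram_reg X s) *m col k X2)).
Proof.
rewrite /risk_form.
transitivity (\sum_j lam j * D j 0 ^+ 2 +
    s2 * \sum_j lam j * sqn (invmx (gram_reg X s) *m col j X)).
  rewrite mulr_sumr -big_split; apply: eq_bigr => j _ /=.
  by rewrite reg_inv_row -/D; ring.
rewrite !big_split_ord /=; congr (_ + _ * _).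
  congr (_ + _); apply: eq_bigr => i _; first by rewrite [D1 i 0]mxE.
  by rewrite [D2 i 0]mxE.
congr (_ + _); apply: eq_bigr => i _; congr (_ * sqn (_ *m _)).
  by apply/colP => k; rewrite !mxE.
by apply/colP => k; rewrite !mxE.
Qed.

End split.

Section upper.
Variables (R : realFieldType) (n d q : nat) (X : 'M[R]_(n, d + q)).
Variables (lam : 'I_(d + q) -> R) (N tau : R).
Hypotheses (N0 : 0 < N) (tau0 : 0 < tau) (lam0 : forall j, 0 < lam j).
Let X1 := lsubmx X.
Let X2 := rsubmx X.
Let lh i := lam (lshift q i).
Let lh' i := (lh i)^-1.
Let lt k := lam (rshift d k).
Let s := N * tau.
Let err (t : 'cV[R]_(d + q)) := reg_inv X s *m X *m t - t.
Let s0 : 0 < s. Proof. by rewrite mulr_gt0. Qed.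
Let lh0 i : 0 < lh i. Proof. exact: lam0. Qed.

Section core.
Variables (c L l A0 : R).
Hypotheses (c0 : 0 < c) (L0 : 0 <= L) (l0 : 0 < l) (lA : l <= A0 * tau).
Hypothesis HA : forall v, c * N * wsq lh v <= sqn (X1 *m v).
Hypothesis HB : forall w, sqn (X2 *m w) <= N * L * l * sqn w.
Let K := upper_cst c L A0.
Let energy (t : 'cV[R]_(d + q)) := sqn (X *m err t + X2 *m dsubmx t) +
  s * (sqn (usubmx (err t)) + sqn (dsubmx (err t) + dsubmx t)).

(** The core estimates are used with the head error but with the whole tail estimate, error plus
    [dsubmx t]. In these unknowns the normal equations carry the tail signal only through the vector
    X2 t2, so that its size is a question about one fixed direction. *)
Lemma err_bounds (t : 'cV[R]_(d + q)) :
  [/\ N * wsq lh (usubmx (err t)) <= K * energy t,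
      s * sqn (dsubmx (err t) + dsubmx t) <= energy t &
      energy t <= 2 * sqn (X2 *m dsubmx t) +
         2 * N * K * tau ^+ 2 * wsq lh' (usubmx t)].
Proof.
have rE : X1 *m usubmx (err t) + X2 *m (dsubmx (err t) + dsubmx t) =
    X *m err t + X2 *m dsubmx t by rewrite mulmxDr addrA -mulmx_split.
have nh := normal_head X N0 tau0 t; have nt := normal_tail X N0 tau0 t.
rewrite /energy -rE.
have E1 : X1^T *m (X1 *m usubmx (err t) + X2 *m (dsubmx (err t) + dsubmx t)) +
    (N * tau) *: usubmx (err t) = X1^T *m (X2 *m dsubmx t) - (N * tau) *: usubmx t.
  have h : X1^T *m (X *m err t) + (N * tau) *: usubmx (err t) = - ((N * tau) *: usubmx t).
    by apply/eqP; rewrite -subr_eq0 opprK -addrA -scalerDr nh.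
  by rewrite rE mulmxDr addrAC h addrC.
have E2 : X2^T *m (X1 *m usubmx (err t) + X2 *m (dsubmx (err t) + dsubmx t)) +
    (N * tau) *: (dsubmx (err t) + dsubmx t) = X2^T *m (X2 *m dsubmx t).
  by rewrite rE mulmxDr addrAC [X in X + _]nt add0r.
split.
- exact: (core_head_le N0 tau0 c0 L0 l0 lA HA HB).
- exact: (core_tail_le X1 X2 N0 tau0).
- exact: (core_energy_le N0 tau0 lh0 c0 L0 l0 lA HA HB E1 E2).
Qed.

(** A column of X1 is X e_i, and the noiseless error for the signal e_i satisfies X err(e_i) = - s
    u, where u is the regularised inverse applied to that column. The variance of a head coordinate
    is thus part of an energy bounded in [err_bounds]. *)
Lemma head_variance_upper i :
  lh i * sqn (invmx (gram_reg X s) *m col i X1) <= 2 * K / N.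
Proof.
pose e : 'cV[R]_(d + q) := delta_mx (lshift q i) 0.
have Xe : X *m e = col i X1.
  by rewrite -colE; apply/colP => k; rewrite !mxE.
have e2 : dsubmx e = 0.
  by apply/colP => k; rewrite !mxE eq_rlshift.
have e1 : wsq lh' (usubmx e) = (lh i)^-1.
  rewrite /wsq (bigD1 i)//= big1 ?addr0.
    by rewrite !mxE !eqxx expr1n mulr1.
  by move=> k ki; rewrite !mxE eq_lshift (negbTE ki) expr0n mulr0.
set u := _ *m _.
have uE : u = invmx (gram_reg X s) *m (X *m e) by rewrite Xe.
have XD : X *m err e = - (s *: u).
  have -> : err e = X^T *m u - e by rewrite /err /reg_inv uE !mulmxA.
  have Au : gram_reg X s *m u = X *m e by rewrite Xe /u mulKVmx// gram_reg_unit.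
  by rewrite mulmxBr -Au gram_regE opprD addrA subrr add0r.
have [_ _] := err_bounds e.
have sqn0 : sqn (0 : 'cV[R]_n) = 0 := dotp0l _.
rewrite /energy e2 e1 !mulmx0 !addr0 XD sqnN sqnZ sqn0 mulr0 add0r => H.
have : s ^+ 2 * sqn u <= 2 * N * K * tau ^+ 2 / lh i.
  apply: le_trans H; rewrite lerDl mulr_ge0 ?addr_ge0 ?sqn_ge0//; exact: ltW.
rewrite ler_pdivlMr// => H1.
rewrite ler_pdivlMr// -(@ler_pM2l _ (N * tau ^+ 2)) ?mulr_gt0 ?exprn_gt0//.
by move: H1; rewrite /s; congr (_ <= _); ring.
Qed.

Lemma tail_variance_upper k :
  lt k * sqn (invmx (gram_reg X s) *m col k X2) <= lt k * sqn (col k X2) / s ^+ 2.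
Proof.
rewrite -mulrA; apply: ler_wpM2l; first exact: ltW (lam0 _).
rewrite ler_pdivlMr ?exprn_gt0// mulrC.
exact: sqn_gram_reg_inv.
Qed.

Hypothesis ltl : forall k, lt k <= l.

Lemma risk_form_upper (t : 'cV[R]_(d + q)) (s2 : R) : 0 <= s2 ->
  risk_form X lam t s2 (reg_inv X s) <=
    (K + 2 * A0) * (2 * (sqn (X2 *m dsubmx t) / N) +
       2 * K * tau ^+ 2 * wsq lh' (usubmx t)) + 2 * wsq lt (dsubmx t) +
    s2 * (2 * K * d%:R / N + tail_energy X lam / s ^+ 2).
Proof.
move=> s20; rewrite risk_formE//.
have A00 : 0 <= A0 by rewrite -(pmulr_lge0 _ tau0) (le_trans (ltW l0)).
have [H1 H2 H3] := err_bounds t.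
apply: lerD; last first.
  apply: ler_wpM2l => //; apply: lerD.
    apply: (@le_trans _ _ (\sum_(i < d) 2 * K / N)).
      by apply: ler_sum => i _; exact: head_variance_upper.
    by rewrite sumr_const card_ord -mulr_natr; apply: eq_ler; ring.
  rewrite /tail_energy mulr_suml; apply: ler_sum => k _.
  exact: tail_variance_upper.
(* The tail error is the tail estimate minus the signal; the estimate has weights at most l <= A0
   tau, so the penalty part of the energy covers it. *)
have H4 : wsq lt (dsubmx (err t)) <=
    2 * wsq lt (dsubmx (err t) + dsubmx t) + 2 * wsq lt (dsubmx t).
  rewrite -(wsqN lt (dsubmx t)) -{1}(addrK (dsubmx t) (dsubmx (err t))).
  by apply: wsqD_le => k; exact: ltW (lam0 _).
have H5 : wsq lt (dsubmx (err t) + dsubmx t) <= l * sqn (dsubmx (err t) + dsubmx t).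
  exact: wsq_le_sqn.
have H6 : N * (l * sqn (dsubmx (err t) + dsubmx t)) <= A0 * energy t.
  apply: (@le_trans _ _ (A0 * (s * sqn (dsubmx (err t) + dsubmx t)))).
    rewrite [leRHS](_ : _ = N * (A0 * tau * sqn (dsubmx (err t) + dsubmx t)));
      last by rewrite /s; ring.
    apply: ler_wpM2l; first exact: ltW.
    by rewrite ler_wpM2r ?sqn_ge0.
  by rewrite ler_wpM2l.
have K0 : 0 < K := upper_cst_gt0 tau0 c0 L0 l0 lA.
have H7 : (K + 2 * A0) * energy t <= (K + 2 * A0) * (2 * sqn (X2 *m dsubmx t) +
         2 * N * K * tau ^+ 2 * wsq lh' (usubmx t)).
  by apply: ler_wpM2l => //; apply: addr_ge0; [exact: ltW|exact: mulr_ge0].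
rewrite -lerBlDr -(ler_pM2l N0).
rewrite [leRHS](_ : _ = (K + 2 * A0) * (2 * sqn (X2 *m dsubmx t) +
         2 * N * K * tau ^+ 2 * wsq lh' (usubmx t))); last first.
  by field; rewrite gt_eqF.
have := ler_wpM2l (ltW N0) H4; have := ler_wpM2l (ltW N0) H5.
rewrite -/(err t) -/lh -/lt; lra.
Qed.
End core.
End upper.

(** * Lower bounds for the risk with a fixed design *)

Section lower.
Variables (R : realFieldType) (n d q : nat) (X : 'M[R]_(n, d + q)).
Variables (lam : 'I_(d + q) -> R) (N tau : R).
Hypotheses (N0 : 0 < N) (tau0 : 0 < tau) (lam0 : forall j, 0 < lam j).
Let X1 := lsubmx X.
Let X2 := rsubmx X.
Let lh i := lam (lshift q i).
Let lh' i := (lh i)^-1.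
Let lt k := lam (rshift d k).
Let s := N * tau.
Let err (t : 'cV[R]_(d + q)) := reg_inv X s *m X *m t - t.
Let s0 : 0 < s. Proof. by rewrite mulr_gt0. Qed.
Let lh0 i : 0 < lh i. Proof. exact: lam0. Qed.

(** The overlap of the columns of X2 with the range of X1, in the dual head norm. In standardised
    coordinates it is the sum over j, k of lambda_k^2 times the squared inner product of columns j
    and k, so the head eigenvalues cancel. *)
Definition cross_energy := \sum_k lt k * wsq lh' (X1^T *m col k X2).

Section variance.
Variables (c B : R).
Hypotheses (c0 : 0 < c) (B0 : 0 <= B).
Hypothesis HA : forall v, c * N * wsq lh v <= sqn (X1 *m v).
Hypothesis HB : forall w, sqn (X2 *m w) <= N * B * sqn w.

(* With u = (X X^T + s)^-1 b, the vector b - X1 X1^T u = X2 X2^T u + s u has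
   norm at most (N B + s)|u|, while its distance from the range of X1 is bounded
   below by completing the square. *)
Lemma inverse_lower (b : 'cV[R]_n) :
  sqn b - wsq lh' (X1^T *m b) / (c * N) <=
  (N * (B + tau)) ^+ 2 * sqn (invmx (gram_reg X s) *m b).
Proof.
set u := invmx _ *m b; set v0 := X1^T *m u.
have cN : 0 < c * N by rewrite mulr_gt0.
have NB : 0 <= N * B by rewrite mulr_ge0// ltW.
have bE : b - X1 *m v0 = X2 *m (X2^T *m u) + s *: u.
  have bA : b = X1 *m v0 + (X2 *m (X2^T *m u) + s *: u).
    have {1}-> : b = gram_reg X s *m u by rewrite /u mulKVmx// gram_reg_unit.
    by rewrite gram_regE (trmx_split X) mulmx_split mul_col_mx col_mxKu col_mxKd addrA.
  by rewrite {1}bA addrC addKr.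
have HBt := sqn_mulmx_tr NB HB u.
have HBB := HB (X2^T *m u).
have up : sqn (b - X1 *m v0) <= (N * (B + tau)) ^+ 2 * sqn u.
  rewrite bE sqnD sqnZ dotpZr dotp_mulmxl -/(sqn _).
  have H1 := ler_wpM2l NB HBt; have H2 := ler_wpM2l (ltW s0) HBt.
  rewrite [leRHS](_ : _ = N * B * (N * B * sqn u) + 2 * (s * (N * B * sqn u)) + s ^+ 2 * sqn u);
    last first.
    by rewrite /s; ring.
  lra.
apply: le_trans up.
rewrite sqnD sqnN dotpNr dotp_mulmxr.
have Y := @dotp_young_weighted _ _ lh (c * N) v0 (X1^T *m b) lh0 cN.
have := HA v0; rewrite dotpC in Y; rewrite -/lh' in Y.
move: Y; rewrite [(c * N)^-1 * _]mulrC; lra.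
Qed.

Lemma risk_form_lower_variance (t : 'cV[R]_(d + q)) (s2 : R) : 0 <= s2 ->
  s2 * (tail_energy X lam - cross_energy / (c * N)) / (N * (B + tau)) ^+ 2 <=
  risk_form X lam t s2 (reg_inv X s).
Proof.
move=> s20; rewrite risk_formE//.
have NB : 0 < N * (B + tau) by rewrite mulr_gt0// ltr_wpDl.
rewrite -mulrA; apply: (@le_trans _ _ (s2 *
  \sum_k lt k * sqn (invmx (gram_reg X s) *m col k X2))).
  apply: ler_wpM2l => //; rewrite ler_pdivrMr ?exprn_gt0//.
  rewrite /tail_energy /cross_energy !mulr_suml -sumrB; apply: ler_sum => k _.
  rewrite -[lt k * wsq _ _ * _]mulrA -mulrBr -[leRHS]mulrA.
  rewrite ler_wpM2l ?(ltW (lam0 _))// [leRHS]mulrC; exact: inverse_lower.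
have h1 : 0 <= wsq lh (usubmx (err t)) by apply: wsq_ge0 => i; exact: ltW.
have h2 : 0 <= wsq lt (dsubmx (err t)) by apply: wsq_ge0 => i; exact: ltW (lam0 _).
have h3 : 0 <= s2 * \sum_i lh i * sqn (invmx (gram_reg X s) *m col i X1).
  rewrite mulr_ge0// sumr_ge0// => i _; rewrite mulr_ge0 ?sqn_ge0//; exact: ltW.
rewrite [s2 * (_ + _)]mulrDr; lra.
Qed.
End variance.

(** The head equation expresses s t1 as - X1^T r - s D1. The term D1 is bounded by the risk, at the
    price 1/ld^2 of passing to the dual norm, and X1^T r by the upper bound on X1. *)
Lemma risk_form_lower_bias (U ld : R) (t : 'cV[R]_(d + q)) (s2 : R) :
  0 <= U -> 0 < ld -> 0 <= s2 -> (forall i, ld <= lh i) ->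
  (forall v, sqn (X1 *m v) <= N * U * wsq lh v) ->
  tau ^+ 2 * wsq lh' (usubmx t) <=
   (2 * (tau / ld) ^+ 2 + 4 * U ^+ 2) * risk_form X lam t s2 (reg_inv X s) +
   4 * U * (sqn (X2 *m dsubmx t) / N).
Proof.
move=> U0 ld0 s20 ldl HU.
set D1 := usubmx (err t); set r := X *m err t.
have nh : X1^T *m r + s *: (D1 + usubmx t) = 0 := normal_head X N0 tau0 t.
have nt : X2^T *m r + s *: (dsubmx (err t) + dsubmx t) = 0 := normal_tail X N0 tau0 t.
have NU : 0 <= N * U by rewrite mulr_ge0// ltW.
have lh'0 i : 0 <= lh' i by rewrite invr_ge0 ltW.
have riskD : wsq lh D1 <= risk_form X lam t s2 (reg_inv X s).
  rewrite risk_formE//.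
  have h2 : 0 <= wsq lt (dsubmx (err t)) by apply: wsq_ge0 => i; exact: ltW (lam0 _).
  have h3 : 0 <= s2 * (\sum_i lh i * sqn (invmx (gram_reg X s) *m col i X1) +
     \sum_k lt k * sqn (invmx (gram_reg X s) *m col k X2)).
    by rewrite mulr_ge0// addr_ge0// sumr_ge0// => i _; rewrite mulr_ge0 ?sqn_ge0// ltW ?lam0.
  by rewrite -addrA lerDl addr_ge0.
have W1 : s ^+ 2 * wsq lh' (usubmx t) <= 2 * (s ^+ 2 * wsq lh' D1) + 2 * (N * U * sqn r).
  have sE : s *: usubmx t = - (X1^T *m r) + - (s *: D1).
    by apply/eqP; rewrite -subr_eq0 opprD !opprK addrCA -scalerDr [usubmx t + _]addrC nh.
  rewrite -wsqZ sE; apply: le_trans (wsqD_le _ _ lh'0) _.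
  rewrite !wsqN wsqZ addrC lerD2l ler_pM2l//.
  exact: (wsq_tr_le NU lh0 HU).
(* Pairing the tail equation with X2^T r shows that <r, X2 (tail error + t2)> is nonpositive, so the
   tail error may be replaced by - t2 in the expansion of |r|^2. No operator bound on X2 enters. *)
have rr : sqn r <= 2 * (N * U * wsq lh D1) + 2 * sqn (X2 *m dsubmx t).
  have rE : r = X1 *m D1 + X2 *m dsubmx (err t) by rewrite /r mulmx_split.
  have e2 := congr1 (dotp (X2^T *m r)) nt.
  rewrite dotp0r dotpDr dotpZr dotpDr -!dotp_mulmxr in e2.
  have e3 : dotp r r = dotp r (X1 *m D1) + dotp r (X2 *m dsubmx (err t)).
    by rewrite -dotpDr -rE.
  have rle : dotp r r <= dotp r (X1 *m D1 - X2 *m dsubmx t).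
    rewrite dotpDr dotpNr; have h := sqn_ge0 (X2^T *m r).
    have e4 : s * (dotp r (X2 *m dsubmx (err t)) + dotp r (X2 *m dsubmx t)) =
      - sqn (X2^T *m r).
      by rewrite /sqn dotp_mulmxl trmxK; rewrite dotp_mulmxr in e2 *; move: e2; lra.
    have : dotp r (X2 *m dsubmx (err t)) + dotp r (X2 *m dsubmx t) <= 0.
      by rewrite -(pmulr_rle0 _ s0) e4 oppr_le0.
    lra.
  have Y := @dotp_young _ _ 1 r (X1 *m D1 - X2 *m dsubmx t) ltr01.
  have Z := sqnD_le (X1 *m D1) (- (X2 *m dsubmx t)).
  have := HU D1; move: Y Z rle; rewrite invr1 sqnN -/(sqn r); lra.
have W' : wsq lh' D1 <= (ld ^+ 2)^-1 * wsq lh D1.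
  apply: wsq_le_wsq => i; rewrite /lh' -[leLHS]mul1r ler_pdivrMr//.
  rewrite -mulrA ler_pdivlMl ?exprn_gt0// mulr1 expr2.
  by apply: ler_pM => //; exact: ltW.
have key : N ^+ 2 * (tau ^+ 2 * wsq lh' (usubmx t)) <= N ^+ 2 *
   ((2 * (tau / ld) ^+ 2 + 4 * U ^+ 2) * wsq lh D1 + 4 * U * (sqn (X2 *m dsubmx t) / N)).
  have h1 := ler_wpM2l (sqr_ge0 s) W'.
  have h2 := ler_wpM2l NU rr.
  rewrite [leRHS](_ : _ = 2 * (s ^+ 2 * ((ld ^+ 2)^-1 * wsq lh D1)) +
    2 * (N * U * (2 * (N * U * wsq lh D1) + 2 * sqn (X2 *m dsubmx t)))); last first.
    by rewrite /s; field; rewrite !gt_eqF.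
  rewrite [leLHS](_ : _ = s ^+ 2 * wsq lh' (usubmx t)); last by rewrite /s; ring.
  lra.
rewrite ler_pM2l ?exprn_gt0// in key; apply: (le_trans key).
by rewrite lerD2r; apply: ler_wpM2l => //; apply: addr_ge0; apply: mulr_ge0 => //; exact: sqr_ge0.
Qed.
End lower.

(** * A finite net for quadratic forms on the unit ball *)

Section net.
Variables (R : realType) (k : nat).
Hypothesis k0 : (0 < k)%N.
Local Notation code := {ffun 'I_k -> bool * 'I_(4 * k).+1}.

(** Rounding costs at most one step per coordinate, hence k / (16 k) = 1/16 in squared norm, the
    accuracy of [net_approx]. Membership in the unit ball becomes the integer condition with bound
    16 k in [net_code]. *)
Definition mesh : R := (4 * Num.sqrt k%:R)^-1.

(* The lattice points of spacing [mesh] in the unit ball, coded by the signs and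
   the absolute values of their coordinates. *)
Definition net_point (f : code) : 'cV[R]_k :=
  \col_j (mesh * ((-1) ^+ (f j).1 * (f j).2%:R)).

Definition net_code (f : code) : bool := (\sum_j (f j).2 ^ 2 <= 16 * k)%N.

Let k1 : (1 : R) <= k%:R. Proof. by rewrite ler1n. Qed.

Lemma mesh_gt0 : 0 < mesh.
Proof. by rewrite invr_gt0 mulr_gt0// sqrtr_gt0 (lt_le_trans ltr01). Qed.

Lemma mesh_sqr : mesh ^+ 2 = (16 * k%:R)^-1.
Proof.
rewrite /mesh exprVn exprMn sqr_sqrtr ?ler0n//; congr (_^-1).
by congr (_ * _); ring.
Qed.

Lemma sqn_net_point f : sqn (net_point f) = mesh ^+ 2 * (\sum_j (f j).2 ^ 2)%N%:R.
Proof.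
rewrite sqnE natr_sum mulr_sumr; apply: eq_bigr => j _.
by rewrite mxE !exprMn natrX sqrr_sign mul1r.
Qed.

Lemma net_point_le1 f : net_code f -> sqn (net_point f) <= 1.
Proof.
rewrite /net_code -(ler_nat R) natrM => H; rewrite sqn_net_point mesh_sqr.
by rewrite mulrC ler_pdivrMr ?mul1r// mulr_gt0// (lt_le_trans ltr01).
Qed.

Lemma net_approx (v : 'cV[R]_k) : sqn v <= 1 ->
  exists2 f, net_code f & sqn (v - net_point f) <= 16^-1.
Proof.
move=> v1.
(* Absolute values are rounded down, which keeps the rounded point in the unit ball. *)
pose t j := Num.truncn (`|v j 0| / mesh).
have m0 := mesh_gt0.
have tle j : (t j)%:R * mesh <= `|v j 0|.
  have := truncn_le (`|v j 0| / mesh); rewrite divr_ge0 ?(ltW m0)// => h.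
  by rewrite -ler_pdivlMr.
have tgt j : `|v j 0| < (t j).+1%:R * mesh.
  by rewrite -ltr_pdivrMr//; exact: truncnS_gt.
have tsq j : ((t j)%:R * mesh) ^+ 2 <= v j 0 ^+ 2.
  by rewrite -[leRHS]real_normK ?num_real// ler_pXn2r// nnegrE ?mulr_ge0// ?ltW.
have tsum : (\sum_j t j ^ 2 <= 16 * k)%N.
  rewrite -(ler_nat R) natr_sum natrM -[leRHS]mulr1.
  have K0 : 0 < 16 * k%:R :> R by rewrite mulr_gt0// (lt_le_trans ltr01).
  rewrite -ler_pdivrMl// -mesh_sqr mulr_sumr.
  apply: le_trans v1; rewrite sqnE; apply: ler_sum => j _.
  by rewrite natrX mulrC -exprMn.
have tb j : (t j < (4 * k).+1)%N.
  rewrite ltnS -(leq_sqr _ (4 * k)).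
  have : (t j ^ 2 <= 16 * k)%N.
    by apply: leq_trans tsum; rewrite (bigD1 j)//= leq_addr.
  by move=> h; apply: (leq_trans h); move: k0; nia.
exists [ffun j => (v j 0 < 0, Ordinal (tb j))].
  by rewrite /net_code; under eq_bigr do rewrite ffunE /=.
apply: (@le_trans _ _ (\sum_(j < k) mesh ^+ 2)); last first.
  rewrite sumr_const card_ord -mulr_natr mesh_sqr.
  apply: eq_ler; field.
  by rewrite gt_eqF// (lt_le_trans ltr01).
rewrite sqnE; apply: ler_sum => j _; rewrite !mxE ffunE /=.
rewrite -real_normK ?num_real// ler_pXn2r ?nnegrE ?(ltW m0)//.
have vE : v j 0 = (-1) ^+ (v j 0 < 0)%R * `|v j 0| by exact: (realEsign (num_real _)).
rewrite {1}vE.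
rewrite [mesh * _]mulrCA -mulrBr normrM normr_sign mul1r.
have := tle j; have := tgt j; rewrite -natr1 mulrDl mul1r => h1 h2.
by rewrite ler_norml; apply/andP; split; lra.
Qed.

Lemma sum_half_pow m : \sum_(t < m) (2^-1 : R) ^+ t <= 2.
Proof.
have -> : \sum_(t < m) (2^-1 : R) ^+ t = 2 - 2 * 2^-1 ^+ m.
  elim: m => [|m IH]; first by rewrite big_ord0 expr0; ring.
  by rewrite big_ord_recr /= IH exprS; field.
by rewrite lerBlDr lerDl mulr_ge0// exprn_ge0 ?invr_ge0.
Qed.

(** Each code is weighted by 2 to the power minus the sum of its absolute values t_j. As t_j <=
    t_j^2, a code in the net has weight at least 2^(-16 k), while the total weight factorises over
    the coordinates into k factors at most 4, two signs times a geometric series. *)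
Lemma card_net_code : \sum_(f | net_code f) (1 : R) <= 2 ^+ (18 * k).
Proof.
have -> : (2 : R) ^+ (18 * k) = 2 ^+ (16 * k) * 4 ^+ k.
  rewrite (_ : 18 * k = 16 * k + 2 * k)%N; last by rewrite -mulnDl.
  by rewrite exprD [X in _ * X]exprM; congr (_ * _ ^+ _); ring.
apply: (@le_trans _ _ (2 ^+ (16 * k) * \sum_(f : code) \prod_j (2^-1 : R) ^+ (f j).2)).
  rewrite mulr_sumr; rewrite [leRHS](bigID net_code)/=.
  rewrite -[leLHS]addr0 lerD//; last first.
    by rewrite sumr_ge0// => f _; rewrite mulr_ge0 ?exprn_ge0// prodr_ge0// => j _;
      rewrite exprn_ge0 ?invr_ge0.
  apply: ler_sum => f Hf; rewrite prodrXr exprVn.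
  rewrite ler_pdivlMr ?exprn_gt0// mul1r ler_eXn2l ?ltr1n//.
  apply: leq_trans Hf; apply: leq_sum => j _; nia.
rewrite ler_wpM2l ?exprn_ge0//.
rewrite -(bigA_distr_bigA (fun (j : 'I_k) (z : bool * 'I_(4 * k).+1) => (2^-1 : R) ^+ z.2)).
rewrite prodr_const card_ord ler_pXn2r ?nnegrE//; last first.
  by rewrite sumr_ge0// => z _; rewrite exprn_ge0 ?invr_ge0.
rewrite -(pair_big xpredT xpredT (fun (b : bool) (t : 'I_(4 * k).+1) => (2^-1 : R) ^+ t)) /=.
by rewrite big_bool /=; have := sum_half_pow (4 * k).+1; lra.
Qed.

Section quadratic.
Variable S : 'M[R]_k.
Hypothesis symS : S^T = S.
Let Q v := dotp v (S *m v).

Lemma quad_bounded : exists2 M : R, 0 <= M & forall v, `|Q v| <= M * sqn v.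
Proof.
exists (\sum_i \sum_j `|S i j|).
  by rewrite sumr_ge0// => i _; rewrite sumr_ge0.
move=> v; have vi i : v i 0 ^+ 2 <= sqn v.
  by rewrite sqnE (bigD1 i)//= lerDl sumr_ge0// => j _; rewrite sqr_ge0.
rewrite /Q /dotp; under eq_bigr do rewrite mxE mulr_sumr.
apply: (le_trans (ler_norm_sum _ _ _)); rewrite mulr_suml; apply: ler_sum => i _.
apply: (le_trans (ler_norm_sum _ _ _)); rewrite mulr_suml; apply: ler_sum => j _.
rewrite mulrCA normrM ler_wpM2l// normrM.
have := vi i; have := vi j; have := sqr_ge0 (`|v i 0| - `|v j 0|).
rewrite -(real_normK (num_real (v i 0))) -(real_normK (num_real (v j 0))).
lra.
Qed.

Let polar u w : 4 * dotp u (S *m w) = Q (u + w) - Q (u - w).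
Proof.
rewrite /Q !mulmxDr !mulmxN !dotpDl !dotpDr !dotpNl !dotpNr.
have -> : dotp w (S *m u) = dotp u (S *m w) by rewrite dotp_mulmxr symS dotpC.
ring.
Qed.

(** With y the net point near v, Q v - Q y = <v - y, S (v + y)>, which is polarised after scaling v
    - y by 8. The scale balances the two lengths: 2 * 64 / 16 and 2 * 4 are both 8, so 32 times the
    product is at most 16 M. *)
Lemma quad_net_step (a M : R) : 0 <= M ->
  (forall f, net_code f -> `|Q (net_point f)| <= a) ->
  (forall v, `|Q v| <= M * sqn v) -> forall v, `|Q v| <= (a + M / 2) * sqn v.
Proof.
move=> M0 Ha HM.
have unit v : sqn v <= 1 -> `|Q v| <= a + M / 2.
  move=> v1; have [f Hf Hvf] := net_approx v1.
  set y := net_point f in Hvf *.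
  have y1 : sqn y <= 1 := net_point_le1 Hf.
  have E : Q v = Q y + dotp (v - y) (S *m (v + y)).
    rewrite /Q mulmxDr dotpDl !dotpDr !dotpNl.
    have -> : dotp y (S *m v) = dotp v (S *m y) by rewrite dotp_mulmxr symS dotpC.
    ring.
  have P := polar (8 *: (v - y)) (v + y).
  rewrite dotpZl in P.
  have h1 := HM (8 *: (v - y) + (v + y)); have h2 := HM (8 *: (v - y) - (v + y)).
  have h3 : sqn (8 *: (v - y) + (v + y)) + sqn (8 *: (v - y) - (v + y)) =
     2 * (64 * sqn (v - y)) + 2 * sqn (v + y).
    have para (a1 b1 : 'cV[R]_k) : sqn (a1 + b1) + sqn (a1 - b1) = 2 * sqn a1 + 2 * sqn b1.
      by rewrite !sqnD sqnN dotpNr; ring.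
    by rewrite para sqnZ; ring.
  have h4 := sqnD_le v y.
  have h5 : M * (sqn (8 *: (v - y) + (v + y)) + sqn (8 *: (v - y) - (v + y))) <= M * 16.
    by rewrite ler_wpM2l// h3; lra.
  have := ler_normD (Q y) (dotp (v - y) (S *m (v + y))); rewrite -E.
  have := Ha f Hf; rewrite -/y.
  have : `|dotp (v - y) (S *m (v + y))| <= M / 2.
    have h6 : 32 * dotp (v - y) (S *m (v + y)) =
      Q (8 *: (v - y) + (v + y)) - Q (8 *: (v - y) - (v + y)) by rewrite -P; ring.
    move: h1 h2; rewrite !ler_norml => /andP[? ?] /andP[? ?].
    by apply/andP; split; lra.
  lra.
move=> v; have [v0|v0] := eqVneq (sqn v) 0.
  by rewrite v0 (sqn_eq0 v0) /Q dotp0l normr0 mulr0.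
have vp : 0 < sqn v by rewrite lt_neqAle eq_sym v0 sqn_ge0.
have := unit ((Num.sqrt (sqn v))^-1 *: v).
rewrite sqnZ exprVn sqr_sqrtr ?(ltW vp)// mulVf// => /(_ (lexx _)).
rewrite /Q -scalemxAr dotpZl dotpZr mulrA -expr2 exprVn sqr_sqrtr ?(ltW vp)//.
by rewrite normrM ger0_norm ?invr_ge0 ?(ltW vp)// mulrC ler_pdivrMr.
Qed.

(** Iterating [quad_net_step] from a crude entrywise bound M gives 2 a + M / 2^i for every i. This
    replaces the usual argument at a maximiser of the form and needs no compactness. *)
Lemma quad_net (a : R) :
  (forall f, net_code f -> `|Q (net_point f)| <= a) ->
  forall v, `|Q v| <= 2 * a * sqn v.
Proof.
move=> Ha v; have [M M0 HM] := quad_bounded.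
have a0 : 0 <= a.
  have [f Hf _] := net_approx (v := 0) ltac:(by rewrite /sqn dotp0l).
  by apply: le_trans (Ha f Hf).
have it i : forall v, `|Q v| <= (2 * a + M / 2 ^+ i) * sqn v.
  elim: i => [|i IH] w.
    rewrite expr0 divr1; apply: le_trans (HM w) _.
    by rewrite ler_wpM2r ?sqn_ge0// lerDr mulr_ge0.
  have := quad_net_step _ Ha IH w.
  rewrite addr_ge0 ?mulr_ge0 ?invr_ge0 ?exprn_ge0// => /(_ isT) h.
  apply: (le_trans h); rewrite ler_wpM2r ?sqn_ge0// exprS.
  have p2 : (2 : R) ^+ i != 0 by rewrite expf_neq0// pnatr_eq0.
  by apply: eq_ler; field.
rewrite leNgt; apply/negP => H.
set g := `|Q v| - 2 * a * sqn v; have g0 : 0 < g by rewrite subr_gt0.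
pose i := (Num.truncn (M * sqn v / g)).+1; have := it i v.
have ti : M * sqn v / g < i%:R by exact: truncnS_gt.
have i2 : (i%:R : R) <= 2 ^+ i by rewrite -natrX ler_nat ltnW// ltn_expl.
have p2 : 0 < (2 : R) ^+ i by rewrite exprn_gt0.
clearbody i.
rewrite mulrDl; have : M / 2 ^+ i * sqn v < g.
  rewrite mulrAC ltr_pdivrMr// [ltRHS]mulrC -ltr_pdivrMr//; exact: (lt_le_trans ti i2).
rewrite /g; lra.
Qed.

End quadratic.
End net.

(** * Cutting the tail coordinates into blocks *)

Section blocks.
Variables (R : realFieldType) (n q : nat).
Hypothesis n0 : (0 < n)%N.

(** The inclusion of the block of coordinates b n, ..., b n + n - 1. Columns that would fall beyond
    q are zero, so the last block may be incomplete and larger b give the zero matrix. *)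
Definition window_mx (b : nat) : 'M[R]_(q, n) :=
  \matrix_(t, j) (t == b * n + j :> nat)%:R.

Lemma window_mx_tr_sqr b (c : 'cV[R]_q) j :
  ((window_mx b)^T *m c) j 0 ^+ 2 = \sum_(t < q) (t == b * n + j :> nat)%:R * c t 0 ^+ 2.
Proof.
rewrite mxE; under eq_bigr do rewrite !mxE.
have [tq|tq] := ltnP (b * n + j) q; last first.
  rewrite !big1 ?expr0n// => t _; rewrite (_ : (t == _ :> nat) = false) ?mul0r//.
    by apply/eqP => E; move: (ltn_ord t); rewrite E ltnNge tq.
  by apply/eqP => E; move: (ltn_ord t); rewrite E ltnNge tq.
rewrite (bigD1 (Ordinal tq))//= eqxx mul1r big1 ?addr0; last first.
  by move=> t /eqP tE; case: eqP => [E|_]; rewrite ?mul0r//; case: tE; exact: val_inj.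
rewrite (bigD1 (Ordinal tq))//= eqxx mul1r big1 ?addr0//.
by move=> t /eqP tE; case: eqP => [E|_]; rewrite ?mul0r//; case: tE; exact: val_inj.
Qed.

Lemma sqn_window_mx b (y : 'cV[R]_n) : sqn (window_mx b *m y) <= sqn y.
Proof.
have H (c : 'cV[R]_q) : sqn ((window_mx b)^T *m c) <= 1 * sqn c.
  rewrite sqnE; under eq_bigr do rewrite window_mx_tr_sqr.
  rewrite exchange_big mul1r sqnE /=; apply: ler_sum => t _.
  rewrite -mulr_suml -[leRHS]mul1r ler_wpM2r ?sqr_ge0//.
  have [[j jE]|H] : (exists j : 'I_n, t == b * n + j :> nat) \/ (forall j : 'I_n, t != b * n + j
    :> nat).
    have [/existsP ?|] := boolP [exists j : 'I_n, t == b * n + j :> nat]; first by left.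
    by rewrite negb_exists => /forallP ?; right.
    rewrite (bigD1 j)//= jE big1 ?addr0// => k kj.
    case: eqP => // tk; move/eqP: jE; rewrite tk => /addnI/val_inj E.
    by rewrite E eqxx in kj.
  by rewrite big1// => j _; rewrite (negbTE (H j)).
by rewrite -{1}(trmxK (window_mx b)) -[leRHS]mul1r; exact: sqn_mulmx_tr.
Qed.

(** Coordinate t lies in block t / n, where its weight is at most the first weight of the block.
    Letting b run up to q instead of the number of blocks only adds nonnegative terms. *)
Lemma weighted_block_bound (l : nat -> R) (Z : 'M[R]_(n, q)) (a : nat -> R) :
  (forall t, 0 <= l t) -> {homo l : s t / (s <= t)%N >-> t <= s} ->
  (forall b, (b < q)%N -> 0 <= a b) ->
  (forall b v, (b < q)%N -> sqn (Z *m window_mx b *m v) <= a b * sqn v) ->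
  forall u, \sum_(t < q) l t * (Z^T *m u) t 0 ^+ 2 <=
    (\sum_(b < q) l (b * n)%N * a b) * sqn u.
Proof.
move=> l0 lmono a0 Ha u; set c := Z^T *m u.
apply: (@le_trans _ _ (\sum_(b < q) l (b * n)%N * sqn ((window_mx b)^T *m c))); last first.
  rewrite mulr_suml; apply: ler_sum => b _; rewrite -mulrA ler_wpM2l//.
  rewrite /c mulmxA -trmx_mul; apply: sqn_mulmx_tr; first exact: a0.
  by move=> v; exact: Ha.
under [leRHS]eq_bigr do rewrite sqnE mulr_sumr.
under [leRHS]eq_bigr do under eq_bigr do rewrite window_mx_tr_sqr mulr_sumr.
under [leRHS]eq_bigr do rewrite exchange_big /=.
rewrite exchange_big /=; apply: ler_sum => t _.
have bq : (t %/ n < q)%N by apply: leq_ltn_trans (ltn_ord t); exact: leq_div.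
have jn : (t %% n < n)%N by rewrite ltn_mod.
have nn b j : 0 <= l (b * n)%N * ((t == (b * n + j)%N :> nat)%:R * c t 0 ^+ 2).
  by rewrite mulr_ge0// mulr_ge0 ?ler0n ?sqr_ge0.
pose F (b : 'I_q) (j : 'I_n) :=
  l (b * n)%N * ((t == (b * n + j)%N :> nat)%:R * c t 0 ^+ 2).
apply: (@le_trans _ _ (F (Ordinal bq) (Ordinal jn))).
  rewrite /F /= -divn_eq eqxx mul1r ler_wpM2r ?sqr_ge0//.
  by apply: lmono; exact: leq_trunc_div.
apply: (@le_trans _ _ (\sum_j F (Ordinal bq) j)).
  rewrite (bigD1 (Ordinal jn))//= lerDl sumr_ge0// => j _; exact: nn.
rewrite [leRHS](bigD1 (Ordinal bq))//= lerDl sumr_ge0// => b _.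
by rewrite sumr_ge0// => j _; exact: nn.
Qed.

(** The first weight of a block is at most the average over the preceding block, and only the very
    first one has no predecessor. Through this inequality the bound on r_d(Sigma) / n controls the
    sum of the block weights. *)
Lemma sum_block_heads (l : nat -> R) : (forall t, 0 <= l t) ->
  {homo l : s t / (s <= t)%N >-> t <= s} -> (forall t, (q <= t)%N -> l t = 0) ->
  n%:R * \sum_(b < q) l (b * n)%N <= n%:R * l 0%N + \sum_(t < q) l t.
Proof.
move=> l0 lmono lq.
have step k : n%:R * \sum_(b < k) l (b.+1 * n)%N <= \sum_(t < k * n) l t.
  elim: k => [|k IH]; first by rewrite !big_ord0 mulr0.
  rewrite big_ord_recr /= mulrDr mulSn addnC.
  rewrite -(big_mkord xpredT l) (@big_cat_nat _ _ _ (k * n)%N)//= ?leq_addr//.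
  rewrite big_mkord lerD//.
  have -> : \sum_(k * n <= i < k * n + n) l i = \sum_(j < n) l (j + k * n)%N.
    by rewrite -{1}[(k * n)%N]add0n big_addn addKn big_mkord.
  rewrite mulr_natl -[X in _ *+ X](card_ord n) -sumr_const.
  by apply: ler_sum => i _; apply: lmono; rewrite addnC leq_add2l ltnW.
have sum_le k : \sum_(t < k) l t <= \sum_(t < q) l t.
  rewrite -!(big_mkord xpredT l).
  have [kq|qk] := leqP k q.
    by rewrite [leRHS](@big_cat_nat _ _ _ k)//= lerDl sumr_ge0.
  rewrite (@big_cat_nat _ _ _ q)//= ?(ltnW qk)//.
  have -> : \sum_(q <= i < k) l i = 0.
    by rewrite big_nat big1// => t /andP[qt _]; exact: lq.
  by rewrite addr0.
case: q lq sum_le => [|q'] lq sum_le.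
  by rewrite !big_ord0 mulr0 addr0 mulr_ge0.
rewrite big_ord_recl mul0n mulrDr lerD2l.
exact: le_trans (step q') (sum_le _).
Qed.

End blocks.

(** * Scalar inequalities between tau, the eigenvalues and the rate *)

Section real_bounds.
Variable R : rcfType.

(** Both branches of the range are reduced to the same five inequalities without roots, minima or
    maxima. The last two are those that make the squared head bias and the tail variance of order d
    / N. *)
Lemma tuning_range_bounds (l L tau c A0 d N r : R) :
  0 < l -> 0 < L -> 0 < d -> 0 < N -> 0 < r -> 1 <= c -> 1 <= A0 ->
  l / L <= c * (Num.sqrt (d / N) * Num.min 1 (Num.sqrt (d / r))) ->
  (if r <= d then A0^-1 * l <= tau <= A0 * l
   else A0^-1 * l * Num.max (c^-1 * Num.sqrt (r / d)) 1 <= tau <=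
     A0 * L * Num.min (c * Num.sqrt (d / N)) 1) ->
  [/\ 0 < tau, l <= A0 * tau, l ^+ 2 <= c ^+ 2 * (d / N) * L ^+ 2,
      tau ^+ 2 <= (A0 * c) ^+ 2 * (d / N) * L ^+ 2 &
      r * l ^+ 2 <= (A0 * c) ^+ 2 * d * tau ^+ 2].
Proof.
move=> l0 L0 d0 N0 r0 c1 A1 Hl Ht.
have c0 : 0 < c by rewrite (lt_le_trans ltr01).
have A00 : 0 < A0 by rewrite (lt_le_trans ltr01).
set D := d / N in Hl Ht *.
have D0 : 0 < D by rewrite divr_gt0.
have sD0 : 0 < Num.sqrt D by rewrite sqrtr_gt0.
have sDD : Num.sqrt D ^+ 2 = D by rewrite sqr_sqrtr// ltW.
have lL : l <= c * Num.sqrt D * L.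
  rewrite -ler_pdivrMr//; apply: le_trans Hl _; rewrite ler_pM2l//.
  by rewrite ler_piMr ?(ltW sD0)// ge_min lexx.
have l2 : l ^+ 2 <= c ^+ 2 * D * L ^+ 2.
  by rewrite -sDD -!exprMn ler_sqr ?nnegrE ?(ltW l0)// ltW// !mulr_gt0.
have lA : A0^-1 * l <= tau.
  case: ifP Ht => _ /andP[h _] //; apply: le_trans h.
  by rewrite ler_peMr ?mulr_ge0 ?invr_ge0 ?(ltW l0) ?(ltW A00)// le_max lexx orbT.
have t0 : 0 < tau by apply: lt_le_trans lA; rewrite mulr_gt0// invr_gt0.
have lA' : l <= A0 * tau by rewrite mulrC -ler_pdivrMr// mulrC.
have sq (x y : R) : 0 <= x -> x <= y -> x ^+ 2 <= y ^+ 2.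
  by move=> x0 xy; rewrite ler_sqr// nnegrE// (le_trans x0).
split => //.
- case: ifP Ht => _ /andP[_ h].
    apply: le_trans (sq _ _ (ltW t0) h) _; rewrite !exprMn.
    by have := ler_wpM2l (sqr_ge0 A0) l2; rewrite !mulrA.
  have h2 : tau <= A0 * L * (c * Num.sqrt D).
    apply: le_trans h _; rewrite ler_pM2l ?mulr_gt0//.
    by rewrite ge_min lexx.
  apply: le_trans (sq _ _ (ltW t0) h2) _; rewrite !exprMn sDD; apply: eq_ler; ring.
- case: ifP Ht => [rd _|_ /andP[h _]].
    have c2 : 1 <= c ^+ 2 by rewrite exprn_ege1.
    apply: (@le_trans _ _ (d * (A0 * tau) ^+ 2)).
      apply: ler_pM => //; first exact: ltW.
        exact: sqr_ge0.
      exact: sq (ltW l0) lA'.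
    rewrite exprMn (_ : _ * _ = A0 ^+ 2 * d * tau ^+ 2); last by ring.
    rewrite ler_wpM2r ?sqr_ge0// ler_pM2r// exprMn ler_peMr// exprn_ge0// ltW//.
  have h2 : A0^-1 * l * (c^-1 * Num.sqrt (r / d)) <= tau.
    apply: le_trans h; rewrite ler_pM2l ?mulr_gt0 ?invr_gt0//.
    by rewrite le_max lexx.
  have h3 : Num.sqrt (r / d) * l <= A0 * c * tau.
    have := ler_wpM2l (ltW (mulr_gt0 A00 c0)) h2; apply: le_trans.
    by apply: eq_ler; field; rewrite !gt_eqF.
  have h4 := sq _ _ (mulr_ge0 (sqrtr_ge0 _) (ltW l0)) h3.
  have rd : 0 <= r / d by rewrite divr_ge0 ?ltW.
  rewrite [leLHS]exprMn sqr_sqrtr// in h4.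
  have := ler_wpM2l (ltW d0) h4.
  have -> : d * (r / d * l ^+ 2) = r * l ^+ 2 by field; rewrite gt_eqF.
  by rewrite !exprMn; lra.
Qed.

Lemma risk_rate_upper (K A0 sx2 e a a' c d N l L tau s2 V W mu r : R) :
  0 < K -> 0 < A0 -> 0 <= sx2 -> 0 <= e -> 0 <= a -> 0 <= a' -> 0 < d -> 0 < N ->
  0 < tau -> 0 < L -> 0 <= V -> 0 <= s2 ->
  s2 <= a -> V * L ^+ 2 <= a' -> W <= e * l ^+ 2 * V -> mu = r * l ^+ 2 ->
  l ^+ 2 <= c ^+ 2 * (d / N) * L ^+ 2 ->
  tau ^+ 2 <= (A0 * c) ^+ 2 * (d / N) * L ^+ 2 ->
  r * l ^+ 2 <= (A0 * c) ^+ 2 * d * tau ^+ 2 ->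
  (K + 2 * A0) * (2 * (8 * sx2 * W) + 2 * K * tau ^+ 2 * V) + 2 * W +
      s2 * (2 * K * d / N + 8 * sx2 * N * mu / (N * tau) ^+ 2) <=
  ((K + 2 * A0) * (16 * sx2 * e * c ^+ 2 * a' + 2 * K * (A0 * c) ^+ 2 * a') +
    2 * e * c ^+ 2 * a' + a * (2 * K + 8 * sx2 * (A0 * c) ^+ 2)) * (d / N).
Proof.
move=> K0 A00 sx0 e0 a0 a'0 d0 N0 t0 L0 V0 s20 sa Va We -> Hl Ht Hr.
set D := d / N in Hl Ht *; have D0 : 0 < D by rewrite divr_gt0.
have WD : W <= e * c ^+ 2 * a' * D.
  apply: le_trans We _.
  apply: (@le_trans _ _ (e * (c ^+ 2 * D * L ^+ 2) * V)).
    by rewrite ler_wpM2r// ler_wpM2l.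
  have : 0 <= e * c ^+ 2 * D by apply: mulr_ge0 (ltW D0); exact: mulr_ge0 e0 (sqr_ge0 c).
  by move=> /(@ler_wpM2l R)/(_ _ _ Va); lra.
have TD : tau ^+ 2 * V <= (A0 * c) ^+ 2 * a' * D.
  apply: (@le_trans _ _ ((A0 * c) ^+ 2 * D * L ^+ 2 * V)); first by rewrite ler_wpM2r.
  have : 0 <= (A0 * c) ^+ 2 * D by exact: mulr_ge0 (sqr_ge0 _) (ltW D0).
  by move=> /(@ler_wpM2l R)/(_ _ _ Va); lra.
have MD : N * (r * l ^+ 2) / (N * tau) ^+ 2 <= (A0 * c) ^+ 2 * D.
  rewrite ler_pdivrMr ?exprn_gt0 ?mulr_gt0//.
  apply: le_trans (ler_wpM2l (ltW N0) Hr) _; rewrite /D; apply: eq_ler.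
  by field; rewrite gt_eqF.
have vD : s2 * (2 * K * d / N + 8 * sx2 * N * (r * l ^+ 2) / (N * tau) ^+ 2) <=
    a * ((2 * K + 8 * sx2 * (A0 * c) ^+ 2) * D).
  have h : 2 * K * d / N + 8 * sx2 * N * (r * l ^+ 2) / (N * tau) ^+ 2 <=
     (2 * K + 8 * sx2 * (A0 * c) ^+ 2) * D.
    have s8 : 0 <= 8 * sx2 by rewrite mulr_ge0.
    have := ler_wpM2l s8 MD; rewrite /D; lra.
  apply: le_trans (ler_wpM2l s20 h) _; rewrite ler_wpM2r//.
  have p1 : 0 <= 8 * sx2 * (A0 * c) ^+ 2 by apply: mulr_ge0 (sqr_ge0 _); exact: mulr_ge0.
  by apply: mulr_ge0 (ltW D0); lra.
have bD : (K + 2 * A0) * (2 * (8 * sx2 * W) + 2 * K * tau ^+ 2 * V) <=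
    (K + 2 * A0) * ((16 * sx2 * e * c ^+ 2 * a' + 2 * K * (A0 * c) ^+ 2 * a') * D).
  apply: ler_wpM2l; first lra.
  have s16 : 0 <= 16 * sx2 by rewrite mulr_ge0.
  have K2 : 0 <= 2 * K by lra.
  have := ler_wpM2l s16 WD; have := ler_wpM2l K2 TD; lra.
lra.
Qed.

(** In (T l + tau)^2 <= 2 T^2 l^2 + 2 tau^2 the first term contributes at most half of r l^2,
    because r is large compared with d; what remains bounds tau from below. *)
Lemma tuning_lower_necessary (b C2 T l tau d r s2 : R) :
  0 < b -> 0 <= C2 -> 0 < d -> 0 < l -> 0 <= tau -> 0 <= T -> 0 < s2 ->
  1 <= b * s2 -> s2 * r * l ^+ 2 <= 4 * C2 * d * (T * l + tau) ^+ 2 ->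
  16 * b * C2 * T ^+ 2 * d <= r ->
  r * l ^+ 2 <= 16 * b * C2 * d * tau ^+ 2.
Proof.
move=> b0 C20 d0 l0 t0 T0 s20 bs H Hd.
have r0 : 0 <= r by apply: le_trans Hd; rewrite !mulr_ge0 ?sqr_ge0// ltW.
have h1 : r * l ^+ 2 <= b * (4 * C2 * d * (T * l + tau) ^+ 2).
  apply: le_trans (ler_wpM2l (ltW b0) H).
  have : 0 <= r * l ^+ 2 by rewrite mulr_ge0 ?sqr_ge0.
  by move=> /ler_wpM2r/(_ _ _ bs); lra.
have h2 : (T * l + tau) ^+ 2 <= 2 * T ^+ 2 * l ^+ 2 + 2 * tau ^+ 2.
  by have := sqr_ge0 (T * l - tau); lra.
have p : 0 <= b * (4 * C2 * d) by rewrite !mulr_ge0// ltW.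
have h3 := ler_wpM2l p h2.
have := ler_wpM2r (sqr_ge0 l) Hd; lra.
Qed.

(** The tail signal and the term with (tau / L)^2 are each absorbed in a quarter of tau^2 V, by the
    two smallness conditions with 192 and 8. Half of tau^2 V is then at most 9 C2 D. *)
Lemma tuning_upper_necessary (b' C2 e sx2 k D l L tau V W : R) :
  0 < b' -> 0 <= C2 -> 0 < D -> 0 < L -> 0 <= V -> 0 <= sx2 -> 0 <= e ->
  1 <= b' * (V * L ^+ 2) -> W <= e * l ^+ 2 * V ->
  l ^+ 2 <= k * tau ^+ 2 -> 192 * sx2 * e * k <= 1 -> 8 * C2 * D * b' <= 1 ->
  tau ^+ 2 * V <= (2 * (tau / L) ^+ 2 + 9) * (C2 * D) + 6 * (8 * sx2 * W) ->
  tau ^+ 2 <= 18 * b' * C2 * D * L ^+ 2.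
Proof.
move=> b0 C20 D0 L0 V0 sx0 e0 bV We Hl k1 D1 H.
have V1 : 0 < V * L ^+ 2 by rewrite -(pmulr_rgt0 _ b0) (lt_le_trans ltr01).
have h1 : 48 * sx2 * W <= tau ^+ 2 * V / 4.
  have : 0 <= 48 * sx2 by rewrite mulr_ge0.
  move=> /ler_wpM2l/(_ _ _ We) h; apply: le_trans h _.
  have : 0 <= 48 * sx2 * e * V by rewrite !mulr_ge0.
  move=> /ler_wpM2l/(_ _ _ Hl) h.
  have : 0 <= tau ^+ 2 * V / 4 by apply: mulr_ge0;
    [exact: mulr_ge0 (sqr_ge0 _) V0|rewrite invr_ge0].
  by move=> /ler_wpM2l/(_ _ _ k1); lra.
set x := (tau / L) ^+ 2 in H.
have tx : tau ^+ 2 = x * L ^+ 2 by rewrite /x expr_div_n divfK// gt_eqF// exprn_gt0.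
have x0 : 0 <= x by rewrite sqr_ge0.
have h2 : 2 * x * (C2 * D) <= tau ^+ 2 * V / 4.
  have p : 0 <= x / (4 * b') by rewrite divr_ge0// mulr_ge0// ltW.
  have := ler_wpM2l p D1; have := ler_wpM2l p bV; rewrite tx.
  have -> : x / (4 * b') * (b' * (V * L ^+ 2)) = x * L ^+ 2 * V / 4 by field; rewrite gt_eqF.
  have -> : x / (4 * b') * (8 * C2 * D * b') = 2 * x * (C2 * D) by field; rewrite gt_eqF.
  lra.
have h3 : tau ^+ 2 * V <= 18 * (C2 * D) by lra.
have h4 : x <= 18 * (C2 * D) * b'.
  have := ler_wpM2l x0 bV; have := ler_wpM2r (ltW b0) h3; rewrite tx; lra.
rewrite tx; have := ler_wpM2r (sqr_ge0 L) h4; lra.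
Qed.

Lemma ler_sqrt_mul (x k y : R) : 0 <= y -> 0 <= k -> x ^+ 2 <= k * y ^+ 2 -> x <= Num.sqrt k * y.
Proof.
move=> y0 k0 H; have [x0|/ltW x0] := leP 0 x; last by rewrite (le_trans x0)// mulr_ge0 ?sqrtr_ge0.
by rewrite -ler_sqr ?nnegrE ?mulr_ge0 ?sqrtr_ge0// exprMn sqr_sqrtr.
Qed.

(** Elimination of tau: its lower and upper bounds are compatible only for a small eigenvalue
    ratio. *)
Lemma eig_ratio_necessary (l L tau D d r k k' : R) : 0 < L -> 0 < d -> 0 < r ->
  0 <= k -> Num.sqrt (r / d) * l <= k * tau -> tau <= k' * (Num.sqrt D * L) ->
  l / L <= k * k' * (Num.sqrt D * Num.sqrt (d / r)).
Proof.
move=> L0 d0 r0 k0 H1 H2; rewrite ler_pdivrMr//.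
have rd : 0 < Num.sqrt (r / d) by rewrite sqrtr_gt0 divr_gt0.
rewrite -(ler_pM2l rd) (le_trans H1)// (le_trans (ler_wpM2l k0 H2))//.
have -> : Num.sqrt (d / r) = (Num.sqrt (r / d))^-1.
  by rewrite -invf_div sqrtrV// ltW// divr_gt0.
apply: eq_ler.
by field; rewrite gt_eqF.
Qed.

End real_bounds.

(** * Independence and the conditional risk *)

(** Two functions with equal integrals over all events determined by V are interchangeable against
    any nonnegative function of V: simple functions first, then monotone convergence. *)
Lemma ge0_integral_comp_mul_ext d (T : measurableType d) (R : realType)
    (mu : {measure set T -> \bar R}) d' (S : measurableType d') (V : T -> S)
    (G H : T -> R) (h : S -> R) :
  measurable_fun setT V -> measurable_fun setT G -> measurable_fun setT H ->
  (forall w, 0 <= G w) -> (forall w, 0 <= H w) ->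
  (forall B, measurable B ->
    (\int[mu]_(w in V @^-1` B) (G w)%:E = \int[mu]_(w in V @^-1` B) (H w)%:E)%E) ->
  measurable_fun setT h -> (forall s, 0 <= h s) ->
  (\int[mu]_w (h (V w) * G w)%:E = \int[mu]_w (h (V w) * H w)%:E)%E.
Proof.
move=> mV mG mH G0 H0 GH mh h0.
have meh : measurable_fun setT (EFin \o h) by exact/measurable_EFinP.
pose g := nnsfun_approx measurableT meh.
have mpre k y : measurable (V @^-1` (g k @^-1` [set y])).
  by rewrite -[_ @^-1` _]setTI; exact: mV.
have key (K : T -> R) : measurable_fun setT K -> (forall w, 0 <= K w) ->
  (\int[mu]_w (h (V w) * K w)%:E = limn (fun k => \sum_(y \in range (g k))
    (y%:E * \int[mu]_(w in V @^-1` (g k @^-1` [set y])) (K w)%:E)))%E.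
  move=> mK K0.
  have mEK : measurable_fun setT (EFin \o K) by exact/measurable_EFinP.
  transitivity (limn (fun k => \int[mu]_w ((g k (V w))%:E * (K w)%:E)))%E.
    rewrite -monotone_convergence//.
    - apply: eq_integral => w _; apply/esym/cvg_lim => //.
      rewrite EFinM; apply: cvgeZr => //.
      by apply: cvg_nnsfun_approx => // s _; rewrite lee_fin.
    - move=> k; apply: emeasurable_funM => //.
      by apply/measurable_EFinP; apply: measurableT_comp.
    - by move=> k w _; rewrite mule_ge0// lee_fin.
    - by move=> w _ a b ab; rewrite lee_wpmul2r ?lee_fin//; exact/lefP/nd_nnsfun_approx.
  apply: congr_lim; apply/funext => k.
  have indic_ge0 y w : (0 <= y%:E * ((\1_(V @^-1` (g k @^-1` [set y])) w)%:E * (K w)%:E))%E.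
    rewrite -!EFinM lee_fin mulrA mulr_ge0//.
    by have := @nnfun_muleindic_ge0 _ _ _ (g k) y (V w); rewrite -lee_fin.
  transitivity (\int[mu]_w (\sum_(y \in range (g k))
      (y%:E * ((\1_(V @^-1` (g k @^-1` [set y])) w)%:E * (K w)%:E))))%E.
    apply: eq_integral => w _.
    rewrite fimfunE -fsumEFin// ge0_mule_fsuml.
      by apply: eq_fsbigr => y _; rewrite EFinM -muleA.
    by move=> y; exact: nnfun_muleindic_ge0.
  have mi y : measurable_fun setT
      (fun w => ((\1_(V @^-1` (g k @^-1` [set y])) w)%:E * (K w)%:E)%E).
    by apply: emeasurable_funM => //; apply/measurable_EFinP; exact: measurable_indic.
  rewrite ge0_integral_fsum//; last by move=> y; exact: measurable_funeM.
  apply: eq_fsbigr => y; rewrite inE => -[s _ <-].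
  rewrite ge0_integralZl ?lee_fin//; last by move=> w _; rewrite mule_ge0 ?lee_fin.
  congr (_ * _)%E; rewrite [RHS]integral_mkcond; apply: eq_integral => w _.
  rewrite /patch indicE; case: ifPn => _; first by rewrite mul1e.
  by rewrite mul0e.
by rewrite !key//; apply: congr_lim; apply/funext => k;
  apply: eq_fsbigr => y _; congr (_ * _)%E; exact: GH.
Qed.

Lemma prod_indic (R : realType) (T : Type) (I : finType) (J : {pred I})
    (A : I -> set T) (w : T) :
  \prod_(i in J) \1_(A i) w = \1_(\bigcap_(i in [set i | i \in J]) A i) w :> R.
Proof.
rewrite indicE; have [wA|wA] := boolP (w \in _).
  rewrite big1// => i iJ; rewrite indicE.
  by move: wA; rewrite inE => /(_ i iJ); rewrite -inE => ->.
have [i iJ wAi] : exists2 i, i \in J & w \notin A i.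
  apply: contrapT => H; move/negP: wA; apply; rewrite inE => i /= iJ.
  by apply: contrapT => wi; apply: H; exists i => //; apply/negP; rewrite inE.
by rewrite (bigD1 i)//= indicE (negbTE wAi) mul0r.
Qed.

Lemma measurable_prod_cond d (T : measurableType d) (R : realType) (I : eqType)
    (s : seq I) (Q : pred I) (h : I -> T -> R) :
  (forall i, Q i -> measurable_fun setT (h i)) ->
  measurable_fun setT (fun w => \prod_(i <- s | Q i) h i w).
Proof.
move=> mh.
rewrite (_ : (fun w => _) = fun w => \prod_(i <- s) (if Q i then h i w else 1)); last first.
  by apply/funext => w; exact: big_mkcond.
by apply: measurable_prod => i _; have [/mh|] := boolP (Q i).
Qed.

Lemma mutually_independent_prod d (T : measurableType d) (R : realType)
    (P : probability T R) d' (S : measurableType d') (I : finType)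
    (Z : I -> T -> S) (f : I -> S -> R) :
  mutually_independent P Z -> (forall i, measurable_fun setT (Z i)) ->
  (forall i, measurable_fun setT (f i)) -> (forall i s, 0 <= f i s) ->
  (forall i, \int[P]_w (f i (Z i w))%:E < +oo)%E ->
  (\int[P]_w (\prod_i f i (Z i w))%:E = \prod_i \int[P]_w (f i (Z i w))%:E)%E.
Proof.
move=> indZ mZ mf f0 foo.
have Zpre i A : measurable A -> measurable (Z i @^-1` A).
  by move=> mA; rewrite -[_ @^-1` _]setTI; exact: mZ.
(* The induction is on the list of indices that carry a function, the other indices carrying
   indicators of arbitrary sets. To promote index k, the induction hypothesis is used with [B k]
   replaced by a test set A, and [ge0_integral_comp_mul_ext] extends the identity from A to
   [f k]. *)
suff H (r : seq I) (B : I -> set S) : uniq r -> (forall i, measurable (B i)) ->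
    (\int[P]_w ((\prod_(i <- r) f i (Z i w)) *
        (\prod_(i | i \notin r) \1_(B i) (Z i w)))%:E =
     (\prod_(i <- r) \int[P]_w (f i (Z i w))%:E) *
       \prod_(i | i \notin r) P (Z i @^-1` B i))%E.
  have := H (index_enum I) (fun=> setT) (index_enum_uniq I) (fun=> measurableT).
  rewrite [X in (_ = _ * X)%E]big1 ?mule1; last by move=> i; rewrite mem_index_enum.
  move=> <-; apply: eq_integral => w _; rewrite [X in _ * X]big1 ?mulr1// => i.
  by rewrite mem_index_enum.
elim: r B => [|k r IH] B.
  move=> _ mB; rewrite big_nil mul1e.
  under eq_integral => w _.
    rewrite big_nil mul1r.
    rewrite (eq_bigr (fun i => \1_(Z i @^-1` B i) w)); last first.
      by move=> i _; rewrite !indicE.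
    rewrite (eq_bigl (mem [set: I]%SET)); last by move=> i; rewrite !inE.
    rewrite prod_indic; over.
  rewrite integral_indic ?setIT//.
    have := indZ [set: I]%SET B mB; rewrite /= => ->.
    by apply: eq_bigl => i; rewrite inE.
  apply: fin_bigcap_measurable; first exact: finite_finset.
  by move=> i _; exact: Zpre.
move=> /= /andP[kr ur] mB.
have mG : measurable_fun setT (fun w => (\prod_(i <- r) f i (Z i w)) *
    (\prod_(i | i \notin k :: r) \1_(B i) (Z i w))).
  apply: measurable_funM.
    by apply: measurable_prod => i _; exact: measurableT_comp.
  apply: measurable_prod_cond => i _; exact: measurableT_comp.
have G0 w : 0 <= (\prod_(i <- r) f i (Z i w)) *
    (\prod_(i | i \notin k :: r) \1_(B i) (Z i w)).
  by rewrite mulr_ge0// prodr_ge0.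
have pfin (s : seq I) : ((\prod_(i <- s) \int[P]_w (f i (Z i w))%:E) \is a fin_num)%E.
  elim/big_ind: _ => //; first by move=> *; rewrite fin_numM.
  move=> i _; rewrite ge0_fin_numE//; apply: integral_ge0 => w _.
  by rewrite lee_fin.
have qfin (J : {pred I}) : ((\prod_(i in J) P (Z i @^-1` B i)) \is a fin_num)%E.
  elim/big_ind: _ => //; first by move=> *; rewrite fin_numM.
  by move=> i _; rewrite fin_num_measure//; exact: Zpre.
set c := ((\prod_(i <- r) \int[P]_w (f i (Z i w))%:E) *
       \prod_(i | i \notin k :: r) P (Z i @^-1` B i))%E.
have cfin : c \is a fin_num by rewrite fin_numM// qfin.
have c0 : (0 <= c)%E.
  rewrite mule_ge0// prode_ge0// => i _; apply: integral_ge0 => w _.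
  by rewrite lee_fin.
transitivity (\int[P]_w (f k (Z k w) * fine c)%:E)%E; last first.
  under eq_integral do rewrite EFinM fineK//.
  rewrite ge0_integralZr//; last 2 first.
    by apply/measurable_EFinP; exact: measurableT_comp.
    by move=> w _; rewrite lee_fin.
  by rewrite big_cons -muleA.
rewrite -(@ge0_integral_comp_mul_ext _ _ _ P _ _ (Z k) _ (fun=> fine c) (f k)
  (mZ k) mG)//; last 2 first.
  by move=> w; rewrite fine_ge0.
  move=> A mA; rewrite integral_cst; last exact: Zpre.
  pose B' i := if i == k then A else B i.
  have mB' i : measurable (B' i) by rewrite /B'; case: ifP.
  have spl i : (i \notin k :: r) = (i \notin r) && (i != k).
    by rewrite inE negb_or andbC.
  rewrite integral_mkcond /=.
  transitivity (\int[P]_w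
   ((\prod_(i <- r) f i (Z i w)) * \prod_(i | i \notin r) \1_(B' i) (Z i w))%:E)%E;
     last rewrite IH//.
    apply: eq_integral => w _; rewrite /patch.
    have -> : \prod_(i | i \notin r) \1_(B' i) (Z i w) =
        \1_A (Z k w) * \prod_(i | i \notin k :: r) \1_(B i) (Z i w) :> R.
      rewrite (bigD1 k)//= {1}/B' eqxx (eq_bigl _ _ spl); congr (_ * _).
      by apply: eq_bigr => i /andP[_ /negbTE ik]; rewrite /B' ik.
    rewrite indicE; have -> : (Z k w \in A) = (w \in Z k @^-1` A).
      by [].
    by case: ifP => _; rewrite /= ?mul1r// mul0r mulr0.
  have -> : (\prod_(i | i \notin r) P (Z i @^-1` B' i) =
      P (Z k @^-1` A) * \prod_(i | i \notin k :: r) P (Z i @^-1` B i))%E.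
    rewrite (bigD1 k)//= {1}/B' eqxx (eq_bigl _ _ spl); congr (_ * _)%E.
    by apply: eq_bigr => i /andP[_ /negbTE ik]; rewrite /B' ik.
  by rewrite fineK// muleCA muleC.
by apply: eq_integral => w _; rewrite big_cons mulrA.
Qed.

(** The product sigma-algebra is defined by conditions on one coordinate, which are not stable under
    intersection; rectangles are, as the Dynkin argument of [independent_tuple] requires. *)
Lemma measurable_tuple_rectangles d (S : measurableType d) n :
  @measurable _ (n.-tuple S) =
  <<s [set A | exists2 B : 'I_n -> set S, forall i, measurable (B i) &
         A = \bigcap_(i in setT) ((@tnth n S)^~ i @^-1` B i)] >>.
Proof.
rewrite eqEsubset; split.
  apply: smallest_sub; first exact: smallest_sigma_algebra.
  rewrite -bigcup_seq; apply: bigcup_sub => i _ A [B mB <-]; rewrite setTI.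
  apply: sub_sigma_algebra; exists (fun j => if j == i then B else setT).
    by move=> j; case: ifP.
  apply/seteqP; split=> t /=.
    by move=> Bt j _; case: eqP => // ->.
  by move=> /(_ i I); rewrite eqxx.
apply: smallest_sub; first exact: sigma_algebra_measurable.
move=> _ [B mB ->]; apply: fin_bigcap_measurable => // i _.
by rewrite -[_ @^-1` _]setTI; exact: measurable_tnth.
Qed.

Lemma independent_tuple d (T : measurableType d) (R : realType)
    (P : probability T R) d' (S : measurableType d') n
    (U : T -> n.-tuple S) (E : set T) :
  measurable_fun setT U -> measurable E ->
  (forall B : 'I_n -> set S, (forall i, measurable (B i)) ->
     P (E `&` \bigcap_(i in setT) [set w | B i (tnth (U w) i)]) =
     (P E * P (\bigcap_(i in setT) [set w | B i (tnth (U w) i)]))%E) ->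
  forall B, measurable B -> P (E `&` U @^-1` B) = (P E * P (U @^-1` B))%E.
Proof.
move=> mU mE ind B mB.
have mpre A : measurable A -> measurable (U @^-1` A).
  by move=> mA; rewrite -[_ @^-1` _]setTI; exact: mU.
have finE A : measurable A -> P A \is a fin_num by move=> mA; rewrite fin_num_measure.
pose Q (A : set (n.-tuple S)) := P (E `&` U @^-1` A) = (P E * P (U @^-1` A))%E.
move: (mB); rewrite measurable_tuple_rectangles => sB.
apply: (@dynkin_induction _ _ _ Q _ _ _ _ _ _ B sB).
- exact: measurable_tuple_rectangles.
- move=> _ _ [A mA ->] [C mC ->]; exists (fun i => A i `&` C i).
    by move=> i; exact: measurableI.
  apply/seteqP; split=> t /=; first by move=> [At Ct] i _; split; [exact: At|exact: Ct].
  by move=> H; split=> i _; have [] := H i I.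
- by rewrite /Q preimage_setT setIT probability_setT mule1.
- move=> _ [A mA ->]; rewrite /Q; have := ind A mA.
  by rewrite (_ : _ @^-1` _ = \bigcap_(i in setT) [set w | A i (tnth (U w) i)]).
- move=> A mA; rewrite /Q => QA.
  rewrite preimage_setC -setDE; rewrite measureD//=; last 2 first.
    exact: mpre.
    by rewrite ltey_eq finE.
  rewrite QA probability_setC; last exact: mpre.
  by rewrite muleBr ?mule1// ?finE// fin_num_adde_defr.
- move=> F mF tF QF; rewrite /Q preimage_bigcup setI_bigcupr.
  rewrite measure_bigcup//; last 2 first.
    by move=> i _; apply: measurableI => //; exact: mpre.
    apply/trivIsetP => i j _ _ ij.
    move/trivIsetP: tF => /(_ i j I I ij) tij.
    have tUij : U @^-1` F i `&` U @^-1` F j = set0.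
      by rewrite -preimage_setI tij preimage_set0.
    by rewrite setIACA tUij setI0.
  rewrite measure_bigcup//; last 2 first.
    by move=> i _; exact: mpre.
    apply/trivIsetP => i j _ _ ij.
    move/trivIsetP: tF => /(_ i j I I ij) tij.
    by rewrite -preimage_setI tij preimage_set0.
  rewrite -(fineK (finE _ mE)) -nneseriesZl//.
  by apply: eq_eseriesr => i _; rewrite fineK ?finE//; exact: QF.
Qed.

(** The joint law is the product of the marginals, so V may be averaged with U frozen. Conditioning
    on the design takes this form. *)
Lemma independent_tonelli d (T : measurableType d) (R : realType)
    (P : probability T R) d1 (S1 : measurableType d1) d2 (S2 : measurableType d2)
    (U : T -> S1) (V : T -> S2) (f : S1 * S2 -> \bar R) :
  measurable_fun setT U -> measurable_fun setT V ->
  (forall A B, measurable A -> measurable B ->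
     P (U @^-1` A `&` V @^-1` B) = (P (U @^-1` A) * P (V @^-1` B))%E) ->
  measurable_fun setT f -> (forall z, 0 <= f z)%E ->
  (\int[P]_w f (U w, V w) = \int[P]_w \int[P]_v f (U w, V v))%E.
Proof.
move=> mU mV ind mf f0.
have mUV : measurable_fun setT (fun w => (U w, V w)) by exact: measurable_fun_pair.
pose U' : {mfun T >-> S1} := HB.pack U (isMeasurableFun.Build _ _ _ _ _ mU).
pose V' : {mfun T >-> S2} := HB.pack V (isMeasurableFun.Build _ _ _ _ _ mV).
pose W' : {mfun T >-> (S1 * S2)%type} :=
  HB.pack (fun w => (U w, V w)) (isMeasurableFun.Build _ _ _ _ _ mUV).
have -> : (\int[P]_w f (U w, V w) = \int[distribution P W']_z f z)%E.
  by rewrite ge0_integral_distribution.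
transitivity (\int[distribution P U' \x distribution P V']_z f z)%E.
  apply: eq_measure_integral => A mA _.
  apply/esym/product_measure_unique => // B C mB mC.
rewrite fubini_tonelli1// ge0_integral_distribution//; last 2 first.
  exact: measurable_fun_fubini_tonelli_F.
  by move=> s; apply: integral_ge0.
apply: eq_integral => w _; rewrite /fubini_F /= ge0_integral_distribution//.
by apply: measurableT_comp => //; exact: measurable_pair1.
Qed.

Lemma mutually_independent_comp d (T : measurableType d) (R : realType)
    (P : probability T R) d' (S : measurableType d') d2 (S2 : measurableType d2)
    (I : finType) (Z : I -> T -> S) (g : I -> S -> S2) :
  mutually_independent P Z -> (forall i, measurable_fun setT (g i)) ->
  mutually_independent P (fun i => g i \o Z i).
Proof.
move=> ind mg J B mB.
apply: (ind J (fun i => g i @^-1` B i)).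
by move=> i; rewrite -[_ @^-1` _]setTI; exact: mg.
Qed.

Section uncorrelated.
Context d (T : measurableType d) (R : realType) (P : probability T R).
Variables (I : finType) (Z : I -> T -> R).
Hypothesis indZ : mutually_independent P Z.
Hypothesis iZ : forall i, P.-integrable setT (EFin \o Z i).

Let mZ i : measurable_fun setT (Z i).
Proof. by apply/measurable_EFinP; exact: measurable_int (iZ i). Qed.

Lemma mutually_independent_prod2 (i j : I) (f g : R -> R) : i != j ->
  measurable_fun setT f -> measurable_fun setT g ->
  (forall x, 0 <= f x) -> (forall x, 0 <= g x) ->
  (\int[P]_w (f (Z i w))%:E < +oo)%E -> (\int[P]_w (g (Z j w))%:E < +oo)%E ->
  (\int[P]_w (f (Z i w) * g (Z j w))%:E =
   \int[P]_w (f (Z i w))%:E * \int[P]_w (g (Z j w))%:E)%E.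
Proof.
move=> ij mf mg f0 g0 foo goo.
pose F k x := if k == i then f x else if k == j then g x else 1.
have E k : (\int[P]_w (F k (Z k w))%:E = if k == i then \int[P]_w (f (Z i w))%:E
   else if k == j then \int[P]_w (g (Z j w))%:E else 1)%E.
  rewrite /F; case: eqP => [->//|_]; case: eqP => [->//|_].
  by rewrite integral_cst//= mul1e; exact: probability_setT.
have ji : j == i = false by rewrite eq_sym; exact: negbTE.
transitivity (\int[P]_w (\prod_k F k (Z k w))%:E)%E.
  apply: eq_integral => w _; rewrite (bigD1 i)//= (bigD1 j) ?ji//=.
  rewrite /F !eqxx ji big1 ?mulr1// => k /andP[/negbTE -> /negbTE ->//].
rewrite (mutually_independent_prod indZ)//.
- rewrite (bigD1 i)//= (bigD1 j) ?ji//= !E !eqxx ji big1 ?mule1//.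
  by move=> k /andP[/negbTE ki /negbTE kj]; rewrite E ki kj.
- by move=> k; rewrite /F; case: eqP => // _; case: eqP.
- by move=> k x; rewrite /F; case: eqP => // _; case: eqP.
- by move=> k; rewrite E; case: eqP => // _; case: eqP => // _; rewrite ltry.
Qed.

(** The product formula is available for nonnegative functions only, so both variables are split
    into positive and negative parts. The two parts of the centred variable have equal means, and
    the four products cancel. *)
Lemma mutually_independent_uncorrelated (i j : I) : i != j ->
  (\int[P]_w (Z j w)%:E = 0)%E ->
  P.-integrable setT (fun w => (Z i w * Z j w)%:E) /\
  (\int[P]_w (Z i w * Z j w)%:E = 0)%E.
Proof.
move=> ij Zj0.
pose pp (b : bool) (x : R) := if b then Num.max x 0 else Num.max (- x) 0.
have mpp b : measurable_fun setT (pp b).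
  by rewrite /pp; case: b; apply: measurable_maxr => //; exact: measurable_cst.
have pp0 b x : 0 <= pp b x by rewrite /pp; case: b; rewrite le_max lexx orbT.
have ppE x : x = pp true x - pp false x.
  rewrite /pp /=; case: (lerP 0 x) => x0.
    by rewrite (max_idPr _) ?subr0// oppr_le0.
  by rewrite (max_idPl _) ?sub0r ?opprK// oppr_ge0 ltW.
have ppn b x : pp b x <= `|x|.
  rewrite /pp; case: b; rewrite ge_max normr_ge0 andbT ?ler_norm//.
  by rewrite -normrN ler_norm.
have ipp b k : P.-integrable setT (EFin \o (pp b \o Z k)).
  apply: le_integrable (iZ k) => //.
    by apply/measurable_EFinP; exact: measurableT_comp.
  by move=> w _ /=; rewrite lee_fin ger0_norm.
have fpp b k : (\int[P]_w (pp b (Z k w))%:E \is a fin_num)%E.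
  exact: (@integrable_fin_num _ _ _ _ _ _ _ (ipp b k)).
have opp b k : (\int[P]_w (pp b (Z k w))%:E < +oo)%E by rewrite ltey_eq fpp.
have Epp a b := mutually_independent_prod2 ij (mpp a) (mpp b) (pp0 a) (pp0 b)
  (opp a i) (opp b j).
have ippp a b : P.-integrable setT (EFin \o (fun w => pp a (Z i w) * pp b (Z j w))).
  apply/integrableP; split.
    by apply/measurable_EFinP; apply: measurable_funM; exact: measurableT_comp.
  under eq_integral do rewrite /= ger0_norm ?mulr_ge0//.
  by rewrite Epp ltey_eq fin_numM.
have ppj : (\int[P]_w (pp true (Z j w))%:E = \int[P]_w (pp false (Z j w))%:E)%E.
  have : (\int[P]_w (pp true (Z j w))%:E - \int[P]_w (pp false (Z j w))%:E = 0)%E.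
    rewrite -integralB_EFin; [|by []|exact: ipp|exact: ipp].
    by rewrite -Zj0; apply: eq_integral => w _; rewrite -EFinB -ppE.
  by move/eqP; rewrite sube_eq ?add0e ?fin_num_adde_defl// => /eqP.
have Zij w : Z i w * Z j w =
    (pp true (Z i w) * pp true (Z j w) + pp false (Z i w) * pp false (Z j w)) -
    (pp true (Z i w) * pp false (Z j w) + pp false (Z i w) * pp true (Z j w)).
  by rewrite {1}(ppE (Z i w)) {1}(ppE (Z j w)); ring.
have iD a b a' b' : P.-integrable setT (EFin \o (fun w =>
    pp a (Z i w) * pp b (Z j w) + pp a' (Z i w) * pp b' (Z j w))).
  have := integrableD measurableT (ippp a b) (ippp a' b').
  by apply: eq_integrable.
split.
  apply: eq_integrable (integrableB measurableT (iD true true false false)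
    (iD true false false true)) => //.
  by move=> w _ /=; rewrite Zij.
under eq_integral do rewrite Zij EFinB.
rewrite integralB_EFin//.
have DE a b a' b' : (\int[P]_w (pp a (Z i w) * pp b (Z j w) +
    pp a' (Z i w) * pp b' (Z j w))%:E = \int[P]_w (pp a (Z i w))%:E *
     \int[P]_w (pp b (Z j w))%:E + \int[P]_w (pp a' (Z i w))%:E *
     \int[P]_w (pp b' (Z j w))%:E)%E.
  rewrite -!Epp -(integralD_EFin measurableT (ippp a b) (ippp a' b')).
  by apply: eq_integral.
by rewrite !DE ppj subee// fin_numD !fin_numM.
Qed.
End uncorrelated.

Lemma integrable_mul_sqr d (T : measurableType d) (R : realType)
    (P : probability T R) (Y Z : T -> R) :
  measurable_fun setT Y -> measurable_fun setT Z ->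
  (\int[P]_w (Y w ^+ 2)%:E < +oo)%E -> (\int[P]_w (Z w ^+ 2)%:E < +oo)%E ->
  P.-integrable setT (fun w => (Y w * Z w)%:E).
Proof.
move=> mY mZ Y2 Z2; apply/integrableP; split.
  by apply/measurable_EFinP; exact: measurable_funM.
apply: (@le_lt_trans _ _ (\int[P]_w ((Y w ^+ 2)%:E + (Z w ^+ 2)%:E))%E).
  apply: ge0_le_integral => //.
  - by apply/measurable_EFinP; apply: measurableT_comp => //; exact: measurable_funM.
  - by apply: emeasurable_funD; apply/measurable_EFinP; exact: measurable_funX.
  - move=> w _; rewrite /= -EFinD lee_fin normrM.
    have := sqr_ge0 (`|Y w| - `|Z w|); have := sqr_ge0 (`|Y w| + `|Z w|).
    rewrite -(real_normK (num_real (Y w))) -(real_normK (num_real (Z w))).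
    lra.
rewrite ge0_integralD//; first by rewrite lte_add_pinfty.
- by move=> w _; rewrite lee_fin sqr_ge0.
- by apply/measurable_EFinP; exact: measurable_funX.
- by move=> w _; rewrite lee_fin sqr_ge0.
- by apply/measurable_EFinP; exact: measurable_funX.
Qed.

Lemma integrable_sqr d (T : measurableType d) (R : realType)
    (P : probability T R) (Z : T -> R) : measurable_fun setT Z ->
  (\int[P]_w (Z w ^+ 2)%:E < +oo)%E -> P.-integrable setT (EFin \o Z).
Proof.
move=> mZ Z2.
have := @integrable_mul_sqr _ _ _ P Z (fun=> 1) mZ (@measurable_cst _ _ _ _ _ _) Z2.
have -> : (\int[P]_w (1 ^+ 2)%:E < +oo)%E.
  by rewrite integral_cst//= expr1n mul1e probability_setT ltry.
move=> /(_ isT); apply: eq_integrable => // w _.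
by rewrite mulr1.
Qed.

(** The identity serves twice: for averaging the noise, where c is the bias, and with c = 0 and unit
    variance for the second moments of the standardised rows. *)
Lemma integral_affine_sqr d (T : measurableType d) (R : realType)
    (P : probability T R) (I : finType) (Z : I -> T -> R) (s2 c : R)
    (r : I -> R) :
  (forall i, measurable_fun setT (Z i)) ->
  (forall i, \int[P]_w (Z i w)%:E = 0)%E ->
  (forall i, \int[P]_w (Z i w ^+ 2)%:E = s2%:E)%E ->
  (forall i j, i != j -> \int[P]_w (Z i w * Z j w)%:E = 0)%E ->
  (\int[P]_w ((c + \sum_i r i * Z i w) ^+ 2)%:E =
   (c ^+ 2 + s2 * \sum_i r i ^+ 2)%:E)%E.
Proof.
move=> mZ Z0 Z2 Zij.
have Z2oo i : (\int[P]_w (Z i w ^+ 2)%:E < +oo)%E by rewrite Z2 ltry.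
have iZ i : P.-integrable setT (EFin \o Z i) by exact: integrable_sqr.
have iZZ i j : P.-integrable setT (fun w => (Z i w * Z j w)%:E).
  exact: integrable_mul_sqr.
have EZZ i j : (\int[P]_w (Z i w * Z j w)%:E = ((i == j)%:R * s2)%:E)%E.
  have [<-|ij] := eqVneq i j; last by rewrite mul0r Zij.
  by under eq_integral do rewrite -expr2; rewrite Z2 mul1r.
have E w : ((c + \sum_i r i * Z i w) ^+ 2)%:E = ((c ^+ 2)%:E +
    (\sum_i (2 * c * r i)%:E * (Z i w)%:E +
     \sum_i \sum_j (r i * r j)%:E * (Z i w * Z j w)%:E))%E.
  have -> : (\sum_i (2 * c * r i)%:E * (Z i w)%:E =
      (\sum_i 2 * c * r i * Z i w)%:E)%E by rewrite -sumEFin.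
  have -> : (\sum_i \sum_j (r i * r j)%:E * (Z i w * Z j w)%:E =
      (\sum_i \sum_j r i * r j * (Z i w * Z j w))%:E)%E.
    by rewrite -sumEFin; apply: eq_bigr => i _; rewrite -sumEFin.
  rewrite -!EFinD; congr EFin.
  rewrite sqrrD -addrA; congr (_ + (_ + _)).
    by rewrite mulr_sumr -sumrMnl; apply: eq_bigr => i _; ring.
  rewrite expr2 mulr_suml; apply: eq_bigr => i _.
  by rewrite mulr_sumr; apply: eq_bigr => j _; ring.
under eq_integral do rewrite E.
have ic : P.-integrable setT (fun=> (c ^+ 2)%:E) by exact: finite_measure_integrable_cst.
have i1 i : P.-integrable setT (fun w => (2 * c * r i)%:E * (Z i w)%:E)%E.
  exact: (integrableZl measurableT _ (iZ i)).
have i2 i j : P.-integrable setT (fun w => (r i * r j)%:E * (Z i w * Z j w)%:E)%E.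
  exact: (integrableZl measurableT _ (iZZ i j)).
have i2s i : P.-integrable setT (fun w => \sum_j (r i * r j)%:E * (Z i w * Z j w)%:E)%E.
  by apply: integrable_sum.
have i1s : P.-integrable setT (fun w => \sum_i (2 * c * r i)%:E * (Z i w)%:E)%E.
  by apply: integrable_sum.
have i2ss : P.-integrable setT (fun w => \sum_i \sum_j (r i * r j)%:E * (Z i w * Z j w)%:E)%E.
  by apply: integrable_sum.
rewrite integralD//; last exact: integrableD.
rewrite integralD// integral_cst// integral_sum// integral_sum//.
rewrite [X in (_ * X + _)%E]probability_setT mule1.
rewrite big1 ?add0e; last first.
  by move=> i _; rewrite (integralZl measurableT (iZ i)) [X in (_ * X)%E]Z0 mule0.
rewrite EFinD; congr (_ + _)%E.
transitivity (\sum_i (s2 * r i ^+ 2)%:E)%E; last by rewrite sumEFin mulr_sumr.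
apply: eq_bigr => i _; rewrite integral_sum//.
rewrite (bigD1 i)//= big1 ?adde0; last first.
  move=> j ji; rewrite (integralZl measurableT (iZZ i j)) EZZ.
  by rewrite eq_sym (negbTE ji) mul0r mule0.
by rewrite (integralZl measurableT (iZZ i i)) EZZ eqxx mul1r -EFinM; congr EFin; ring.
Qed.

Lemma measurable_invr (R : realType) : measurable_fun setT (fun x : R => x^-1).
Proof.
rewrite -(setvU [set (0 : R)]); apply/measurable_funU => //.
  exact: measurableC.
split; last exact: measurable_fun_set1.
apply: open_continuous_measurable_fun.
  by apply: closed_openC; exact: closed_eq.
by move=> x; rewrite inE => /eqP x0; exact: inv_continuous.
Qed.

(** * Entrywise measurability of matrix operations *)

Section measurable_matrix.
Context d (S : measurableType d) (R : realType).

Definition mx_measurable a b (F : S -> 'M[R]_(a, b)) :=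
  forall i j, measurable_fun setT (fun s => F s i j).

Lemma mx_measurable_cst a b (M : 'M[R]_(a, b)) : mx_measurable (fun=> M).
Proof. by move=> i j; exact: measurable_cst. Qed.

Lemma mx_measurableD a b (F G : S -> 'M[R]_(a, b)) :
  mx_measurable F -> mx_measurable G -> mx_measurable (fun s => F s + G s).
Proof.
by move=> mF mG i j; under eq_fun do rewrite mxE; exact: measurable_funD.
Qed.

Lemma mx_measurable_tr a b (F : S -> 'M[R]_(a, b)) :
  mx_measurable F -> mx_measurable (fun s => (F s)^T).
Proof. by move=> mF i j; under eq_fun do rewrite mxE; exact: mF. Qed.

Lemma mx_measurableM a b c (F : S -> 'M[R]_(a, b)) (G : S -> 'M[R]_(b, c)) :
  mx_measurable F -> mx_measurable G -> mx_measurable (fun s => F s *m G s).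
Proof.
move=> mF mG i j; under eq_fun do rewrite mxE.
by apply: measurable_sum => k; exact: measurable_funM.
Qed.

Lemma measurable_det a (F : S -> 'M[R]_a) :
  mx_measurable F -> measurable_fun setT (fun s => \det (F s)).
Proof.
move=> mF; apply: measurable_sum => s; apply: measurable_funM => //.
by apply: measurable_prod => i _; exact: mF.
Qed.

Lemma mx_measurable_inv a (F : S -> 'M[R]_a) : (forall s, F s \in unitmx) ->
  mx_measurable F -> mx_measurable (fun s => invmx (F s)).
Proof.
move=> uF mF i j; rewrite (_ : (fun s => _) =
    (fun s => (\det (F s))^-1 * cofactor (F s) j i)); last first.
  by apply/funext => s; rewrite /invmx uF !mxE.
apply: measurable_funM.
  apply: (measurableT_comp (@measurable_invr R)).
  exact: measurable_det.
rewrite /cofactor; apply: measurable_funM => //.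
apply: measurable_det => k l; under eq_fun do rewrite !mxE.
exact: mF.
Qed.
End measurable_matrix.

(** * Independence of design and noise, and the loss of linear estimators *)

Section model.
Context (R : realType) (sigma_x : R) (n : nat) (m : model R n).
Hypothesis Hm : model_axioms sigma_x m.
Local Notation p := (mhead m + mtail m)%N.
Local Notation S := (n.-tuple (p.-tuple R)).

Definition Xof (s : S) : 'M[R]_(n, mdim m) := \matrix_(i, j) tnth (tnth s i) j.

Definition noise_tuple (w : Omega m) : n.-tuple R := [tuple noise m i w | i < n].

Lemma XmatE w : Xmat w = Xof (Xtuple w).
Proof. by apply/matrixP => i j; rewrite !mxE /xcoord /Xtuple tnth_mktuple. Qed.

Lemma YvecE w : Yvec w = Xmat w *m theta m + \col_i tnth (noise_tuple w) i.
Proof.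
apply/matrixP => i k; rewrite !mxE /yobs tnth_mktuple; congr (_ + _).
by rewrite ord1 !mxE; apply: eq_bigr => j _; rewrite !mxE.
Qed.

Lemma measurable_Xtuple : measurable_fun setT (@Xtuple R n m).
Proof.
apply/measurable_fun_tnthP => i.
rewrite (_ : _ \o _ = covar m i); first exact: measurable_funP.
by apply/funext => w; rewrite /= tnth_mktuple.
Qed.

Lemma measurable_noise_tuple : measurable_fun setT noise_tuple.
Proof.
apply/measurable_fun_tnthP => i.
rewrite (_ : _ \o _ = noise m i); first exact: measurable_funP.
by apply/funext => w; rewrite /= tnth_mktuple.
Qed.

Lemma mx_measurable_Xof : mx_measurable Xof.
Proof.
move=> i j; under eq_fun do rewrite mxE.
apply: (measurableT_comp (@measurable_tnth _ R _ j)).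
exact: measurable_tnth.
Qed.

(** Independence across observations is given for the pairs (y_i, x_i). Recovering the noise as a
    measurable function of the pair transfers it to the pairs (noise, covariate). *)
Definition residual (z : R * p.-tuple R) : R :=
  z.1 - \sum_j tnth z.2 j * theta m j 0.

Lemma measurable_residual : measurable_fun setT residual.
Proof.
apply: measurable_funB; first exact: measurable_fst.
apply: measurable_sum => j; apply: measurable_funM => //.
by apply: (measurableT_comp (@measurable_tnth _ R _ j)); exact: measurable_snd.
Qed.

Lemma residualE i w : residual (yobs i w, covar m i w) = noise m i w.
Proof.
rewrite /residual /= /yobs mxE.
rewrite (eq_bigr (fun j => tnth (covar m i w) j * theta m j 0)).
  by rewrite addrAC subrr add0r.
by move=> j _; rewrite !mxE.
Qed.

Let pair i w := (yobs i w, covar m i w).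

Lemma prob_noise_covar (C : 'I_n -> set R) (B : 'I_n -> set (p.-tuple R)) :
  (forall i, measurable (C i)) -> (forall i, measurable (B i)) ->
  prob m (\bigcap_(i in setT) (noise m i @^-1` C i `&` covar m i @^-1` B i)) =
  (\prod_i (prob m (noise m i @^-1` C i) * prob m (covar m i @^-1` B i)))%E.
Proof.
move=> mC mB; case: Hm => _ [_ [_ [_ [ind [_ [indn _]]]]]].
pose D i := residual @^-1` C i `&` snd @^-1` B i.
have mD i : measurable (D i).
  apply: measurableI.
    by rewrite -[_ @^-1` _]setTI; apply: measurable_residual.
  by rewrite -[_ @^-1` _]setTI; apply: measurable_snd.
have DE i : pair i @^-1` D i = noise m i @^-1` C i `&` covar m i @^-1` B i.
  by apply/seteqP; split => w; rewrite /D /= /preimage /= -/(pair i w) residualE.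
have := ind [set: 'I_n]%SET D mD.
have -> : \bigcap_(i in [set i | i \in [set: 'I_n]%SET]) (fun w => (yobs i w, covar m i w))
  @^-1` D i =
    \bigcap_(i in setT) (noise m i @^-1` C i `&` covar m i @^-1` B i).
  apply/seteqP; split=> w H i _; first by rewrite -DE; apply: H; rewrite /= inE.
  by have := H i I; rewrite -DE.
move=> ->; rewrite (eq_bigl xpredT); last by move=> i; rewrite inE.
by apply: eq_bigr => i _; rewrite DE indn.
Qed.

(** Two uses of [independent_tuple], one for each tuple, reduce the claim to rectangles, where
    [prob_noise_covar] factorises both sides. *)
Lemma independent_covar_noise (A : set S) (C : set (n.-tuple R)) :
  measurable A -> measurable C ->
  prob m (@Xtuple R n m @^-1` A `&` noise_tuple @^-1` C) =
  (prob m (@Xtuple R n m @^-1` A) * prob m (noise_tuple @^-1` C))%E.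
Proof.
move=> mA mC.
have mpre A' : measurable A' -> measurable (@Xtuple R n m @^-1` A').
  by move=> ?; rewrite -[_ @^-1` _]setTI; exact: measurable_Xtuple.
apply: independent_tuple => //; [exact: measurable_noise_tuple|exact: mpre|].
move=> {mC} {}C mC.
have mcap : measurable (\bigcap_(i in setT) [set w | C i (tnth (noise_tuple w) i)]).
  apply: fin_bigcap_measurable => // i _.
  rewrite (_ : [set w | _] = noise m i @^-1` C i).
    by rewrite -[_ @^-1` _]setTI; exact: measurable_funP.
  by apply/seteqP; split=> w; rewrite /= tnth_mktuple.
rewrite setIC muleC; apply: independent_tuple => //; first exact: measurable_Xtuple.
move=> {mA} {}A mA.
have T1 : \bigcap_(i in setT) [set w | C i (tnth (noise_tuple w) i)] =
   \bigcap_(i in setT) (noise m i @^-1` C i `&` covar m i @^-1` setT).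
  by apply: eq_bigcapr => i _; apply/seteqP; split=> w; rewrite /= tnth_mktuple; tauto.
have T2 : \bigcap_(i in setT) [set w | A i (tnth (Xtuple w) i)] =
   \bigcap_(i in setT) (noise m i @^-1` setT `&` covar m i @^-1` A i).
  by apply: eq_bigcapr => i _; apply/seteqP; split=> w; rewrite /= tnth_mktuple; tauto.
have T3 : \bigcap_(i in setT) [set w | C i (tnth (noise_tuple w) i)] `&`
          \bigcap_(i in setT) [set w | A i (tnth (Xtuple w) i)] =
   \bigcap_(i in setT) (noise m i @^-1` C i `&` covar m i @^-1` A i).
  rewrite -bigcapI; apply: eq_bigcapr => i _.
  by apply/seteqP; split=> w; rewrite /= !tnth_mktuple; tauto.
rewrite T3 T1 T2 !prob_noise_covar// -big_split/=.
by apply: eq_bigr => i _; rewrite !preimage_setT !probability_setT mule1 mul1e.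
Qed.

Lemma mutually_independent_noise : mutually_independent (prob m) (noise m).
Proof.
have -> : (noise m : 'I_n -> Omega m -> R) = fun i => residual \o pair i.
  by apply/funext => i; apply/funext => w; rewrite /= residualE.
case: Hm => _ [_ [_ [_ [ind _]]]].
apply: (mutually_independent_comp (g := fun=> residual) ind) => i.
exact: measurable_residual.
Qed.

Lemma noise_moments i : (0 < n)%N ->
  [/\ (prob m).-integrable setT (EFin \o noise m i),
      (\int[prob m]_w (noise m i w)%:E = 0)%E &
      (\int[prob m]_w (noise m i w ^+ 2)%:E = (sigma m ^+ 2)%:E)%E].
Proof.
move=> n0; case: Hm => _ [_ [_ [_ [_ [_ [_ [_ [_ [E0 [V0 _]]]]]]]]]].
have Z0 : (\int[prob m]_w (noise m i w)%:E = 0)%E by rewrite -(E0 i) unlock.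
have Z2 : (\int[prob m]_w (noise m i w ^+ 2)%:E = (sigma m ^+ 2)%:E)%E.
  rewrite -(V0 i) /variance covariance.unlock E0 expectation.unlock.
  by apply: eq_integral => w _; rewrite !fctE /= subr0 expr2.
by split=> //; apply: integrable_sqr; rewrite // Z2 ltry.
Qed.

Lemma lam_tnth (j : 'I_(mdim m)) : lam m j.+1 = tnth (lambda m) j.
Proof. by rewrite /lam /= (tnth_nth 0). Qed.

Lemma lam_gt0 (j : 'I_(mdim m)) : 0 < lam m j.+1.
Proof. by rewrite lam_tnth; case: Hm => _ [_ [_ []]]. Qed.

Lemma normM_diag k (D : 'rV[R]_k) (b : 'cV[R]_k) : (forall j, 0 <= D 0 j) ->
  normM (diag_mx D) b ^+ 2 = \sum_j D 0 j * b j 0 ^+ 2.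
Proof.
move=> D0; have E : (b^T *m diag_mx D *m b) 0 0 = \sum_j D 0 j * b j 0 ^+ 2.
  rewrite mxE; apply: eq_bigr => j _; rewrite mul_mx_diag !mxE; ring.
rewrite /normM E sqr_sqrtr// sumr_ge0// => j _.
by rewrite mulr_ge0// sqr_ge0.
Qed.

Definition risk (M : 'M[R]_(mdim m, n)) (X : 'M[R]_(n, mdim m)) : R :=
  \sum_(j < mdim m) lam m j.+1 * (((M *m X) *m theta m - theta m) j 0 ^+ 2 +
    sigma m ^+ 2 * \sum_i M j i ^+ 2).

(** The operator depends on the design alone, so the loss is a function of design and noise tuples;
    [independent_tonelli] freezes the design and the inner integral is the bias-variance identity.
    Integrals over events determined by the design are what [is_cond_expectation] tests. *)
Lemma integral_linear_loss (L : S -> 'M[R]_(mdim m, n)) (B : set S) :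
  (0 < n)%N -> mx_measurable L -> measurable B ->
  (\int[prob m]_(w in @Xtuple R n m @^-1` B)
     (normM (Sigma m) (L (Xtuple w) *m Yvec w - theta m) ^+ 2)%:E =
   \int[prob m]_(w in @Xtuple R n m @^-1` B)
     (risk (L (Xtuple w)) (Xmat w))%:E)%E.
Proof.
move=> n0 mL mB.
pose q (s : S) (e : n.-tuple R) (j : 'I_(mdim m)) : R :=
  ((L s *m Xof s) *m theta m - theta m) j 0 + \sum_i L s j i * tnth e i.
pose f (z : S * n.-tuple R) : R :=
  \1_B z.1 * \sum_(j < mdim m) lam m j.+1 * q z.1 z.2 j ^+ 2.
have mq j : measurable_fun setT (fun z : S * n.-tuple R => q z.1 z.2 j).
  apply: measurable_funD.
    have mb : mx_measurable (fun s : S => (L s *m Xof s) *m theta m - theta m).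
      apply: mx_measurableD; last exact: mx_measurable_cst.
      apply: mx_measurableM; last exact: mx_measurable_cst.
      by apply: mx_measurableM => //; exact: mx_measurable_Xof.
    by apply: (measurableT_comp (mb j 0)); exact: measurable_fst.
  apply: measurable_sum => i; apply: measurable_funM.
    by apply: (measurableT_comp (mL j i)); exact: measurable_fst.
  apply: (measurableT_comp (@measurable_tnth _ R _ i)); exact: measurable_snd.
have mf : measurable_fun setT f.
  apply: measurable_funM.
    by apply: (measurableT_comp (measurable_indic mB)); exact: measurable_fst.
  apply: measurable_sum => j; apply: measurable_funM => //.
  exact: measurable_funX.
have lam0 j : 0 <= lam m (@nat_of_ord (mdim m) j).+1 by rewrite ltW// lam_gt0.
have f0 z : 0 <= f z.
  by rewrite /f mulr_ge0// sumr_ge0// => j _; rewrite mulr_ge0// sqr_ge0.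
rewrite integral_mkcond [RHS]integral_mkcond.
transitivity (\int[prob m]_w (f (Xtuple w, noise_tuple w))%:E)%E.
  apply: eq_integral => w _; rewrite /patch /f /= indicE.
  rewrite (_ : (w \in _) = (Xtuple w \in B))//.
  case: ifP => _; last by rewrite mul0r.
  rewrite mul1r /Sigma normM_diag; last by move=> j; rewrite mxE.
  congr EFin; apply: eq_bigr => j _; rewrite mxE; congr (_ * _ ^+ 2).
  rewrite YvecE XmatE mulmxDr mulmxA /q -addrA [X in _ = X + _]mxE.
  rewrite mxE -addrA; congr (_ + _).
  rewrite [LHS]mxE addrC; congr (_ + _).
  by rewrite mxE; apply: eq_bigr => i _; rewrite !mxE.
rewrite (independent_tonelli (f := EFin \o f) measurable_Xtuple measurable_noise_tuple)//;
  last 2 first.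
- exact: independent_covar_noise.
- exact/measurable_EFinP.
apply: eq_integral => w _; rewrite /patch /f /= indicE.
rewrite (_ : (w \in _) = (Xtuple w \in B))//.
case: ifP => _; last first.
  by under eq_integral do rewrite mul0r; rewrite integral0.
under eq_integral do rewrite mul1r -sumEFin.
have mqj j : measurable_fun setT (fun v => q (Xtuple w) (noise_tuple v) j).
  apply: (@measurableT_comp _ _ _ _ _ _ (fun z : S * n.-tuple R => q z.1 z.2 j)
    _ (fun v => (Xtuple w, noise_tuple v))) => //.
  by apply: measurable_fun_pair => //; exact: measurable_noise_tuple.
rewrite ge0_integral_sum//; last 2 first.
- move=> j; apply/measurable_EFinP; apply: measurable_funM => //.
  exact: measurable_funX.
- by move=> j v _; rewrite lee_fin mulr_ge0// sqr_ge0.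
rewrite /risk -sumEFin; apply: eq_bigr => j _.
under eq_integral do rewrite EFinM.
rewrite ge0_integralZl ?lee_fin//; last 2 first.
- by apply/measurable_EFinP; exact: measurable_funX.
- by move=> v _; rewrite lee_fin sqr_ge0.
rewrite EFinM XmatE; congr (_ * _)%E.
rewrite -(integral_affine_sqr (P := prob m) (Z := noise m)).
- apply: eq_integral => v _; rewrite /q; congr (((_ + _) ^+ 2)%:E).
  by apply: eq_bigr => i _; rewrite tnth_mktuple.
- by [].
- by move=> i; have [] := noise_moments i n0.
- by move=> i; have [] := noise_moments i n0.
- move=> i k ik; have inZ i' := let: And3 a _ _ := noise_moments i' n0 in a.
  have [_ E0 _] := noise_moments k n0.
  by have [] := mutually_independent_uncorrelated mutually_independent_noise inZ ik E0.
Qed.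

End model.

Lemma mulmx_deltaE (R : realType) p n (M : 'M[R]_(p, n)) i j :
  (M *m delta_mx i (0 : 'I_1)) j 0 = M j i.
Proof.
rewrite mxE (bigD1 i)//= mxE !eqxx mulr1 big1 ?addr0// => k ki.
by rewrite mxE (negbTE ki) mulr0.
Qed.

(** * The ridge operator and its ridgeless limit *)

Section ridge_op.
Context (R : realType) (n p : nat).
Implicit Types X : 'M[R]_(n, p).

(* The ridgeless operator is taken as a limit along a sequence, so that it
   depends measurably on [X]. *)
Definition ridge_op (tau : R) X : 'M[R]_(p, n) :=
  if 0 < tau then reg_inv X (n%:R * tau)
  else \matrix_(j, i) limn (fun k => reg_inv X (harmonic k) j i).

Definition reg_inv_limit X (W : 'M[R]_(p, n)) := forall Y : 'cV[R]_n,
  exists2 K : R, 0 <= K & forall s j, 0 < s ->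
    `|(reg_inv X s *m Y) j 0 - (W *m Y) j 0| <= s * K.

Lemma reg_inv_limit_cvg X W j i : reg_inv_limit X W ->
  reg_inv X (harmonic k) j i @[k --> \oo] --> W j i.
Proof.
move=> HW; have [K K0 HK] := HW (delta_mx i (0 : 'I_1)).
apply/cvgrPdist_le => e e0.
have : (harmonic k * K : R) @[k --> \oo] --> (0 * K : R).
  by apply: cvgMl; exact: cvg_harmonic.
rewrite mul0r => /cvgrPdist_le/(_ e e0); apply: filterS => k.
rewrite sub0r normrN (ger0_norm (mulr_ge0 (harmonic_ge0 _) K0)) => H.
rewrite distrC -(mulmx_deltaE (reg_inv X _)) -(mulmx_deltaE W).
exact: le_trans (HK _ _ (harmonic_gt0 _)) H.
Qed.

Lemma ridge_op0_limit X : reg_inv_limit X (ridge_op 0 X).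
Proof.
have [W HW] := ridge_mx_cvg X; suff <- : W = ridge_op 0 X by [].
apply/matrixP => j i; rewrite /ridge_op ltxx mxE; apply/esym/cvg_lim => //.
exact: reg_inv_limit_cvg.
Qed.

Lemma ridgeE X Y tau : (0 < n)%N -> 0 <= tau -> ridge X Y tau = ridge_op tau X *m Y.
Proof.
move=> n0; rewrite le_eqVlt => /predU1P[<-|t0]; last by rewrite /ridge /ridge_op t0.
rewrite /ridge ltxx.
set W := ridge_op 0 X.
have [K K0 HK] := ridge_op0_limit X Y.
have cj j : (ridge_pos X Y t) j 0 @[t --> (0 : R)^'+] --> (W *m Y) j 0.
  apply/cvgrPdist_le => e e0.
  have nK : 0 < (n%:R : R) * (K + 1) by rewrite mulr_gt0 ?ltr0n// ltr_wpDl.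
  near=> t; have t0 : 0 < t by near: t; exact: nbhs_right_gt.
  rewrite distrC (le_trans (HK (n%:R * t) j _)) ?mulr_gt0 ?ltr0n//.
  have : t <= e / (n%:R * (K + 1)).
    near: t; apply: nbhs_right_le; exact: divr_gt0.
  rewrite ler_pdivlMr// => H; apply: le_trans H.
  by have : 0 <= n%:R * t; [rewrite mulr_ge0// ltW|lra].
have cM : ridge_pos X Y t @[t --> (0 : R)^'+] --> W *m Y.
  move=> A [Q HQ QA].
  have : \forall t \near (0 : R)^'+, forall ij : 'I_p * 'I_1, Q ij.1 ij.2 (ridge_pos X Y t ij.1
    ij.2).
    apply: filter_forall => -[j i] /=; rewrite (ord1 i).
    have := HQ j 0; exact: cj.
  by apply: filterS => t Ht; apply: QA => i j; exact: (Ht (i, j)).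
apply/matrixP => j i; rewrite (ord1 i).
have cl : ridge_pos X Y t @[t --> (0 : R)^'+] --> lim (ridge_pos X Y t @[t --> (0 : R)^'+]).
  by apply/cvg_ex; exists (W *m Y).
have cl' : (ridge_pos X Y t) j 0 @[t --> (0 : R)^'+] -->
    (lim (ridge_pos X Y t @[t --> (0 : R)^'+]) : 'cV[R]_p) j 0.
  move=> A nA; apply: (cl [set M : 'cV[R]_p | A (M j 0)]).
  exact: (@coord_continuous R p 1 j 0 _ A nA).
by rewrite -(cvg_lim (@Rhausdorff R) cl') (cvg_lim (@Rhausdorff R) (cj j)).
Unshelve. all: by end_near. Qed.

End ridge_op.

Lemma mx_measurable_ridge_op d (S : measurableType d) (R : realType) n p
    (F : S -> 'M[R]_(n, p)) (tau : R) : (0 < n)%N ->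
  mx_measurable F -> mx_measurable (fun s => ridge_op tau (F s)).
Proof.
move=> n0 mF.
have mreg s0 : 0 < s0 -> mx_measurable (fun s => reg_inv (F s) s0).
  move=> s00; apply: mx_measurableM; first exact: mx_measurable_tr.
  apply: mx_measurable_inv => [s|]; first exact: gram_reg_unit.
  apply: mx_measurableD; last exact: mx_measurable_cst.
  by apply: mx_measurableM => //; exact: mx_measurable_tr.
have [t0|t0] := boolP (0 < tau).
  rewrite /ridge_op t0; apply: mreg; by rewrite mulr_gt0// ltr0n.
move=> j i; have -> : (fun s => ridge_op tau (F s) j i) = (fun s => ridge_op 0 (F s) j i).
  by apply/funext => s; rewrite /ridge_op ltxx (negbTE t0).
apply: (@measurable_fun_cvg _ _ _ _
  (fun k s => reg_inv (F s) (harmonic k) j i)) => [k|s _].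
  by apply: mreg; exact: harmonic_gt0.
exact/reg_inv_limit_cvg/ridge_op0_limit.
Qed.

(** * From a version of the conditional expectation to the explicit risk *)

Section mse.
Context (R : realType) (sigma_x : R) (n : nat) (m : model R n).
Hypothesis Hm : model_axioms sigma_x m.
Hypothesis n0 : (0 < n)%N.
Variables (tau : R) (M : Omega m -> \bar R).
Hypothesis tau0 : 0 <= tau.
Hypothesis HM : is_MSE_out tau M.
Local Notation p := (mhead m + mtail m)%N.
Local Notation S := (n.-tuple (p.-tuple R)).
Local Notation Xt := (@Xtuple R n m).

Definition mse_risk (X : 'M[R]_(n, mdim m)) : R := risk (ridge_op tau X) X.

Lemma measurable_Xtuple_pre (B : set S) : measurable B -> measurable (Xt @^-1` B).
Proof. by move=> mB; rewrite -[_ @^-1` _]setTI; exact: measurable_Xtuple. Qed.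

Lemma sigma_X_pre (A : set (Omega m)) : g_sigma_algebra_preimage Xt A ->
  exists2 B : set S, measurable B & A = Xt @^-1` B.
Proof. by case=> B mB <-; exists B => //; rewrite setTI. Qed.

Lemma integral_mse (A : set (Omega m)) : g_sigma_algebra_preimage Xt A ->
  (\int[prob m]_(w in A) M w = \int[prob m]_(w in A) (mse_risk (Xmat w))%:E)%E.
Proof.
move=> sA; case: HM => _ _ ->//; have [B mB ->] := sigma_X_pre sA.
have E (w : Omega m) : ridge (Xmat w) (Yvec w) tau =
    ridge_op tau (Xof (Xtuple w)) *m Yvec w by rewrite -XmatE (ridgeE _ _ n0 tau0).
have mL := mx_measurable_ridge_op tau n0 (@mx_measurable_Xof R n m).
rewrite (eq_integral (fun w => (normM (Sigma m)
   (ridge_op tau (Xof (Xtuple w)) *m Yvec w - theta m) ^+ 2)%:E)); last first.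
  by move=> w _; rewrite /out_loss E.
rewrite (integral_linear_loss Hm n0 mL mB); apply: eq_integral => w _.
by rewrite /mse_risk XmatE.
Qed.

Let sXI (A B : set (Omega m)) : g_sigma_algebra_preimage Xt A ->
  g_sigma_algebra_preimage Xt B -> g_sigma_algebra_preimage Xt (A `&` B).
Proof.
move=> /sigma_X_pre[A' mA ->] /sigma_X_pre[B' mB ->].
by exists (A' `&` B'); [exact: measurableI|rewrite setTI preimage_setI].
Qed.

Let msX (A : set (Omega m)) : g_sigma_algebra_preimage Xt A -> measurable A.
Proof. by move=> /sigma_X_pre[B mB ->]; exact: measurable_Xtuple_pre. Qed.

Lemma sigma_M (B : set (\bar R)) : measurable B -> g_sigma_algebra_preimage Xt (M @^-1` B).
Proof. by case: HM => _ H _; exact: H. Qed.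

Lemma measurable_M : measurable_fun setT M.
Proof. by move=> _ B mB; rewrite setTI; apply: msX; exact: sigma_M. Qed.

Lemma risk_ge0 (L : 'M[R]_(mdim m, n)) X : 0 <= risk L X.
Proof.
apply: sumr_ge0 => j _; apply: mulr_ge0; first exact: ltW (lam_gt0 Hm j).
by rewrite addr_ge0 ?sqr_ge0// mulr_ge0 ?sqr_ge0// sumr_ge0// => i _; rewrite sqr_ge0.
Qed.

Lemma measurable_mse_risk :
  measurable_fun setT (fun w : Omega m => mse_risk (Xmat w)).
Proof.
have mX : mx_measurable (@Xof R n m) := @mx_measurable_Xof R n m.
have mL := mx_measurable_ridge_op tau n0 mX.
have H : measurable_fun setT (fun s : S => mse_risk (Xof s)).
  apply: measurable_sum => j; apply: measurable_funM => //.
  apply: measurable_funD.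
    apply: measurable_funX.
    apply: (_ : mx_measurable (fun s : S =>
      ridge_op tau (Xof s) *m Xof s *m theta m - theta m)).
    apply: mx_measurableD; last exact: mx_measurable_cst.
    apply: mx_measurableM; last exact: mx_measurable_cst.
    exact: mx_measurableM.
  apply: measurable_funM => //; apply: measurable_sum => i.
  by apply: measurable_funX; exact: mL.
rewrite (_ : (fun w => _) = (fun s : S => mse_risk (Xof s)) \o Xt).
  by apply: measurableT_comp => //; exact: measurable_Xtuple.
by apply/funext => w; rewrite /= XmatE.
Qed.

Lemma null_of_le (a b : R) (x : \bar R) : (0 <= x)%E -> x \is a fin_num ->
  a < b -> (b%:E * x <= a%:E * x)%E -> x = 0%E.
Proof.
case: x => // x; rewrite lee_fin => x0 _ ab; rewrite -!EFinM lee_fin => H.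
congr EFin; apply/eqP; rewrite eq_le x0 andbT leNgt; apply/negP => xp.
by move: H; rewrite ler_pM2r// leNgt ab.
Qed.

(** On A, the part of the event where M exceeds C', integration gives C' P(A) <= int_A M = int_A
    risk <= C P(A). As C < C', the event A is null. Working with integrals avoids uniqueness of
    conditional expectations. *)
Lemma mse_le_prob (B : set S) (C C' : R) : measurable B -> 0 <= C -> C < C' ->
  (forall s, B s -> mse_risk (Xof s) <= C) ->
  (prob m (Xt @^-1` B) <= prob m [set w | (M w <= C'%:E)%E])%E.
Proof.
move=> mB C0 CC' HB.
have sB : g_sigma_algebra_preimage Xt (Xt @^-1` B) by exists B; rewrite ?setTI.
have sM2 : g_sigma_algebra_preimage Xt (M @^-1` `]C'%:E, +oo%E]).
  by apply: sigma_M; exact: emeasurable_itv.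
have sM1 : g_sigma_algebra_preimage Xt (M @^-1` `]-oo, C'%:E]).
  by apply: sigma_M; exact: emeasurable_itv.
pose A := Xt @^-1` B `&` M @^-1` `]C'%:E, +oo%E].
have sA : g_sigma_algebra_preimage Xt A by exact: sXI.
have mA := msX sA.
have M0 w : (0 <= M w)%E by case: HM.
have PA0 : prob m A = 0%E.
  apply: (null_of_le _ _ CC') => //; first exact: fin_num_measure.
  rewrite -integral_cst// -integral_cst//.
  apply: (@le_trans _ _ (\int[prob m]_(w in A) M w)%E).
    apply: ge0_le_integral => //.
    - by move=> w _; rewrite lee_fin (le_trans C0)// ltW.
    - exact/measurable_funTS/measurable_M.
    - by move=> w [_]; rewrite /= in_itv/= => /andP[/ltW].
  rewrite integral_mse//; apply: ge0_le_integral => //.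
  - by move=> w _; rewrite lee_fin risk_ge0.
  - by apply/measurable_EFinP/measurable_funTS; exact: measurable_mse_risk.
  - by move=> w [wB _]; rewrite lee_fin XmatE HB.
have mM1 := msX sM1.
rewrite (_ : [set w | _] = M @^-1` `]-oo, C'%:E]); last first.
  by apply/seteqP; split => w; rewrite /= in_itv.
apply: (@le_trans _ _ (prob m (M @^-1` `]-oo, C'%:E] `|` A))).
  apply: le_measure; rewrite ?inE//; [exact: msX|exact: measurableU|].
  move=> w wB; have [wC|wC] := leP (M w) C'%:E.
    by left; rewrite /= in_itv.
  by right; split => //=; rewrite in_itv /= wC leey.
by rewrite measureU0.
Qed.

(** The argument of [mse_le_prob] with reversed inequalities, on the part of the event where M is at
    most C'. *)
Lemma mse_ge_prob (B : set S) (C C' : R) : measurable B -> 0 <= C' -> C' < C ->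
  (forall s, B s -> C <= mse_risk (Xof s)) ->
  (prob m [set w | (M w <= C'%:E)%E] <= prob m (~` (Xt @^-1` B)))%E.
Proof.
move=> mB C0 CC' HB.
have sB : g_sigma_algebra_preimage Xt (Xt @^-1` B) by exists B; rewrite ?setTI.
have sM1 : g_sigma_algebra_preimage Xt (M @^-1` `]-oo, C'%:E]).
  by apply: sigma_M; exact: emeasurable_itv.
pose A := Xt @^-1` B `&` M @^-1` `]-oo, C'%:E].
have sA : g_sigma_algebra_preimage Xt A by exact: sXI.
have mA := msX sA.
have M0 w : (0 <= M w)%E by case: HM.
have PA0 : prob m A = 0%E.
  apply: (null_of_le _ _ CC') => //; first exact: fin_num_measure.
  rewrite -integral_cst// -integral_cst//.
  apply: (@le_trans _ _ (\int[prob m]_(w in A) M w)%E).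
    rewrite integral_mse//; apply: ge0_le_integral => //.
    - by move=> w _; rewrite lee_fin (le_trans C0)// ltW.
    - by apply/measurable_EFinP/measurable_funTS; exact: measurable_mse_risk.
    - by move=> w [wB _]; rewrite lee_fin XmatE HB.
  apply: ge0_le_integral => //.
  - exact/measurable_funTS/measurable_M.
  - by move=> w [_]; rewrite /= in_itv/=.
have mM1 := msX sM1.
rewrite (_ : [set w | _] = M @^-1` `]-oo, C'%:E]); last first.
  by apply/seteqP; split => w; rewrite /= in_itv.
have mBc : measurable (~` (Xt @^-1` B)) by apply: measurableC; exact: msX.
apply: (@le_trans _ _ (prob m (~` (Xt @^-1` B) `|` A))).
  apply: le_measure; rewrite ?inE//; first exact: measurableU.
  move=> w wM; have [wC|wC] := pselect ((Xt @^-1` B) w); last by left.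
  by right; split.
by rewrite measureU0.
Qed.

End mse.

(** * Sub-gaussian concentration *)

Section nonneg_integral.
Context d (T : measurableType d) (R : realType) (P : probability T R).
Implicit Types f g : T -> R.

Lemma integralT_le f g : measurable_fun setT f -> measurable_fun setT g ->
  (forall w, 0 <= f w) -> (forall w, f w <= g w) ->
  (\int[P]_w (f w)%:E <= \int[P]_w (g w)%:E)%E.
Proof.
move=> mf mg f0 fg; apply: ge0_le_integral => //.
- by move=> w _; rewrite lee_fin.
- exact/measurable_EFinP.
- exact/measurable_EFinP.
- by move=> w _; rewrite lee_fin.
Qed.

Lemma integralT_D f g : measurable_fun setT f -> measurable_fun setT g ->
  (forall w, 0 <= f w) -> (forall w, 0 <= g w) ->
  (\int[P]_w (f w + g w)%:E = \int[P]_w (f w)%:E + \int[P]_w (g w)%:E)%E.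
Proof.
move=> mf mg f0 g0; under eq_integral do rewrite EFinD.
apply: ge0_integralD => //.
- by move=> w _; rewrite lee_fin.
- exact/measurable_EFinP.
- by move=> w _; rewrite lee_fin.
- exact/measurable_EFinP.
Qed.

Lemma integralT_Z c f : measurable_fun setT f -> (forall w, 0 <= f w) -> 0 <= c ->
  (\int[P]_w (c * f w)%:E = c%:E * \int[P]_w (f w)%:E)%E.
Proof.
move=> mf f0 c0; under eq_integral do rewrite EFinM.
apply: ge0_integralZl => //.
- exact/measurable_EFinP.
- by move=> w _; rewrite lee_fin.
Qed.

Lemma integralT_cst (c : R) : (\int[P]_w c%:E = c%:E)%E.
Proof. by rewrite integral_cst//= probability_setT mule1. Qed.

Lemma integralT_sum (I : Type) (s : seq I) (F : I -> T -> R) :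
  (forall i, measurable_fun setT (F i)) -> (forall i w, 0 <= F i w) ->
  (\int[P]_w (\sum_(i <- s) F i w)%:E = \sum_(i <- s) \int[P]_w (F i w)%:E)%E.
Proof.
move=> mF F0; under eq_integral do rewrite -sumEFin.
rewrite ge0_integral_sum//; first by move=> i; exact/measurable_EFinP.
by move=> i w _; rewrite lee_fin.
Qed.

Lemma integralT_ge0 f : (forall w, 0 <= f w) -> (0 <= \int[P]_w (f w)%:E)%E.
Proof. by move=> f0; apply: integral_ge0 => w _; rewrite lee_fin. Qed.

End nonneg_integral.

Section exp_facts.
Variable R : realType.
Implicit Types x q s : R.

(** The inequality e^x <= 1 + x e^x, a form of e^(-x) >= 1 - x, is used once more inside its own
    right-hand side when x >= 0. *)
Lemma expR_le_quadratic x : expR x <= 1 + x + x ^+ 2 * expR `|x|.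
Proof.
have H : expR x <= 1 + x * expR x.
  have := expR_ge1Dx (- x); rewrite -(ler_pM2r (expR_gt0 x)) -expRD addNr expR0.
  lra.
have e1 := expR_ge1Dx x.
have [x0|x0] := leP 0 x.
  rewrite ger0_norm//; have : x * (expR x - 1) <= x * (x * expR x).
    by rewrite ler_wpM2l//; lra.
  by move: H; rewrite expr2; lra.
have e2 : 1 <= expR `|x| by rewrite -expR0 ler_expR.
have : x * expR x <= x * (1 + x) by rewrite ler_wnM2l// ltW.
have : x ^+ 2 * 1 <= x ^+ 2 * expR `|x| by rewrite ler_wpM2l ?sqr_ge0.
by rewrite expr2 in H *; lra.
Qed.

Lemma sqr_le_expR q : 0 <= q -> q ^+ 2 <= 16 * expR (q / 2).
Proof.
move=> q0; have h : q / 4 <= expR (q / 4).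
  by apply: le_trans (expR_ge1Dx _); lra.
have -> : q / 2 = q / 4 + q / 4 by lra.
rewrite expRD; have q4 : 0 <= q / 4 by lra.
have := ler_pM q4 q4 h h; lra.
Qed.

Lemma expR_jensen (I : finType) (pi x : I -> R) : (forall i, 0 <= pi i) ->
  \sum_i pi i = 1 -> expR (\sum_i pi i * x i) <= \sum_i pi i * expR (x i).
Proof.
move=> pi0 pi1; set c := \sum_i _.
have H i : pi i * (expR c * (1 + (x i - c))) <= pi i * expR (x i).
  apply: ler_wpM2l => //.
  have -> : expR (x i) = expR c * expR (x i - c) by rewrite -expRD addrC subrK.
  by rewrite ler_wpM2l ?expR_ge0// expR_ge1Dx.
apply: le_trans (ler_sum _ (fun i _ => H i)).
rewrite (eq_bigr (fun i => expR c * (pi i * (1 - c) + pi i * x i))); last first.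
  by move=> i _; ring.
rewrite -mulr_sumr big_split /= -mulr_suml pi1 -/c mul1r subrK mulr1 lexx//.
Qed.

Lemma expR2_ge2 : 2 <= expR 1 :> R.
Proof. by have := expR_ge1Dx (1 : R); lra. Qed.

Lemma pow2_le_expR k : (2 : R) ^+ k <= expR k%:R.
Proof.
rewrite -[k%:R]mulr1 mulrC expRM_natr.
by apply: lerXn2r; rewrite ?nnegrE ?expR_ge0// expR2_ge2.
Qed.

Lemma expR_midpoint (x y : R) :
  expR ((x + y) / 2) <= 2^-1 * (expR x + expR y).
Proof.
have h (u : R) : expR ((x + y) / 2) * (1 + (u - (x + y) / 2)) <= expR u.
  have -> : expR u = expR ((x + y) / 2) * expR (u - (x + y) / 2).
    by rewrite -expRD; congr expR; lra.
  by rewrite ler_wpM2l ?expR_ge0// expR_ge1Dx.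
have := h x; have := h y; lra.
Qed.

(** The right-hand side is 4 (e^(x/2) - e^(-x/2))^2, and that difference is at least x/2 for x >= 0.
    This turns exponential moments at s and -s into a second moment. *)
Lemma sqr_le_cosh x : x ^+ 2 <= 4 * (expR x + expR (- x) - 2).
Proof.
wlog x0 : x / 0 <= x.
  move=> H; have [/H//|x0] := leP 0 x.
  by have := H (- x) ltac:(lra); rewrite sqrrN opprK; lra.
have e0 := expR_ge0 (x / 2); have e0' := expR_ge0 (- (x / 2)).
have ee : expR (x / 2) * expR (- (x / 2)) = 1 by rewrite -expRD subrr expR0.
have -> : expR x = expR (x / 2) ^+ 2 by rewrite expr2 -expRD; congr expR; lra.
have -> : expR (- x) = expR (- (x / 2)) ^+ 2 by rewrite expr2 -expRD; congr expR; lra.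
have h : x / 2 <= expR (x / 2) - expR (- (x / 2)).
  have := expR_ge1Dx (x / 2).
  have : expR (- (x / 2)) <= 1 by rewrite -[leRHS]expR0 ler_expR; lra.
  lra.
have x2 : 0 <= x / 2 by lra.
have := ler_pM x2 x2 h h; nra.
Qed.

End exp_facts.

Section scalar.
Context d (T : measurableType d) (R : realType) (P : probability T R).
Variables (X : T -> R) (v r : R).
Hypotheses (mX : measurable_fun setT X) (X0 : forall w, 0 <= X w) (v0 : 0 < v).
Hypothesis EX : (\int[P]_w (X w)%:E = r%:E)%E.
Hypothesis EeX : (\int[P]_w (expR (X w / v))%:E <= 2%:E)%E.

Let r0 : 0 <= r.
Proof. by rewrite -lee_fin -EX integral_ge0// => w _; rewrite lee_fin. Qed.

(** With q = X / v, the condition |s| v <= 1/2 bounds the exponential in the Taylor remainder by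
    e^(q/2), and q^2 costs a further 16 e^(q/2); together they form the integrable e^q. *)
Lemma subexp_pointwise s w : `|s| * v <= 2^-1 ->
  expR (s * X w) <= 1 + s * X w + 16 * (s * v) ^+ 2 * expR (X w / v).
Proof.
move=> sv; set q := X w / v.
have q0 : 0 <= q by rewrite divr_ge0// ltW.
have sX : s * X w = s * v * q by rewrite /q; field; rewrite gt_eqF.
rewrite sX; apply: (le_trans (expR_le_quadratic _)); rewrite lerD2l.
have nq : `|s * v * q| <= q / 2.
  by rewrite (normrM _ q) (normrM s) (ger0_norm q0) (gtr0_norm v0) [q / 2]mulrC ler_wpM2r.
have e1 : expR `|s * v * q| <= expR (q / 2) by rewrite ler_expR.
have e2 := ler_pM (sqr_ge0 q) (expR_ge0 _) (sqr_le_expR q0) e1.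
have e3 : expR q = expR (q / 2) * expR (q / 2).
  by rewrite -expRD; congr expR; lra.
have e4 := ler_wpM2l (sqr_ge0 (s * v)) e2.
rewrite [leRHS](_ : _ = (s * v) ^+ 2 * (16 * expR (q / 2) * expR (q / 2))).
  by apply: le_trans e4; rewrite mulrA -exprMn.
by rewrite e3; ring.
Qed.

Lemma subexp_mgf s : `|s| * v <= 2^-1 ->
  (\int[P]_w (expR (s * (X w - r)))%:E <= (expR (32 * (s * v) ^+ 2))%:E)%E.
Proof.
move=> sv; set c := 16 * (s * v) ^+ 2.
have c0 : 0 <= c by rewrite mulr_ge0 ?sqr_ge0.
have mE : measurable_fun setT (fun w => expR (s * X w)).
  by apply: measurableT_comp => //; exact: measurable_funM.
have mEv : measurable_fun setT (fun w => expR (X w / v)).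
  by apply: measurableT_comp => //; exact: measurable_funM.
have mEc : measurable_fun setT (fun w => 1 + c * expR (X w / v)).
  by apply: measurable_funD => //; exact: measurable_funM.
have e0 w : 0 <= 1 + c * expR (X w / v) by rewrite addr_ge0// mulr_ge0// expR_ge0.
have I1 : (\int[P]_w (1 + c * expR (X w / v))%:E <= (1 + c * 2)%:E)%E.
  rewrite integralT_D//; last 2 first.
  - exact: measurable_funM.
  - by move=> w; rewrite mulr_ge0// expR_ge0.
  rewrite integralT_cst EFinD leeD2l// integralT_Z//.
    by rewrite (EFinM c 2); apply: lee_wpmul2l; rewrite ?lee_fin.
have H : (\int[P]_w (expR (s * X w))%:E <= (1 + s * r + c * 2)%:E)%E.
  have [s0|s0] := leP 0 s.
    apply: (@le_trans _ _ (\int[P]_w (s * X w + (1 + c * expR (X w / v)))%:E)%E).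
      apply: integralT_le => //.
      - by apply: measurable_funD => //; exact: measurable_funM.
      - by move=> w; have := subexp_pointwise w sv; rewrite -/c; lra.
    rewrite integralT_D//; [|exact: measurable_funM|by move=> w; exact: mulr_ge0].
    rewrite integralT_Z// EX -EFinM [(1 + s * r)%R]addrC -addrA EFinD.
    exact: leeD2l.
  (* For negative s the linear term is moved to the other side, so that only nonnegative functions
     are integrated. *)
  have s0' : 0 <= - s by lra.
  have : (\int[P]_w (expR (s * X w) + - s * X w)%:E <= (1 + c * 2)%:E)%E.
    apply: le_trans I1; apply: integralT_le => //.
    - by apply: measurable_funD => //; exact: measurable_funM.
    - by move=> w; rewrite addr_ge0 ?expR_ge0// mulr_ge0.
    - by move=> w; have := subexp_pointwise w sv; rewrite -/c; lra.
  rewrite integralT_D//; last 2 first.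
  - exact: measurable_funM.
  - by move=> w; exact: mulr_ge0.
  rewrite integralT_Z// EX -EFinM -leeBrDr// -EFinB => h; apply: le_trans h _.
  by rewrite lee_fin; lra.
have E w : expR (s * (X w - r)) = expR (- (s * r)) * expR (s * X w).
  by rewrite -expRD; congr expR; ring.
under eq_integral do rewrite E.
rewrite integralT_Z ?expR_ge0//.
apply: (@le_trans _ _ ((expR (- (s * r)))%:E * (expR (s * r + 32 * (s * v) ^+ 2))%:E)%E).
  apply: lee_wpmul2l; first by rewrite lee_fin expR_ge0.
  apply: le_trans H _.
  rewrite lee_fin; apply: le_trans (expR_ge1Dx _); rewrite /c; lra.
by rewrite -EFinM -expRD addKr.
Qed.

End scalar.

(** * Moments of one standardised row *)

Section row_moments.
Context (R : realType) (sigma_x : R) (n : nat) (m : model R n).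
Hypothesis Hm : model_axioms sigma_x m.
Local Notation p := (mhead m + mtail m)%N.
Local Notation P := (prob m).

Definition zcoord (x : p.-tuple R) (j : 'I_(mdim m)) : R :=
  tnth x j / Num.sqrt (lam m j.+1).

Definition rowdot (a : 'cV[R]_(mdim m)) (x : p.-tuple R) : R :=
  \sum_j a j 0 * zcoord x j.

Lemma measurable_zcoord j : measurable_fun setT (fun x => zcoord x j).
Proof. by apply: measurable_funM => //; exact: (@measurable_tnth _ R _ j). Qed.

Lemma measurable_rowdot a : measurable_fun setT (rowdot a).
Proof.
by apply: measurable_sum => j; apply: measurable_funM => //; exact: measurable_zcoord.
Qed.

Let mcomp (f : p.-tuple R -> R) i : measurable_fun setT f ->
  measurable_fun setT (fun w => f (covar m i w)).
Proof. by move=> mf; apply: (measurableT_comp mf). Qed.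

Let mz i j : measurable_fun setT (fun w => zcoord (covar m i w) j) :=
  mcomp i (measurable_zcoord j).

Let mrow i a : measurable_fun setT (fun w => rowdot a (covar m i w)) :=
  mcomp i (measurable_rowdot a).

Let mx i j : measurable_fun setT (@xcoord R n m i j).
Proof. exact: (mcomp i (@measurable_tnth _ R _ j)). Qed.

Let Ex i j : (\int[P]_w (xcoord i j w)%:E = 0)%E.
Proof.
case: Hm => _ [_ [_ [_ [_ [_ [_ [E0 _]]]]]]].
by rewrite -(E0 i j) unlock.
Qed.

Let Exx i j k : (\int[P]_w (xcoord i j w * xcoord i k w)%:E = (Sigma m j k)%:E)%E.
Proof.
case: Hm => _ [_ [_ [_ [_ [_ [_ [E0 [cv _]]]]]]]].
rewrite -(cv i j k) covariance.unlock !E0 expectation.unlock.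
by apply: eq_integral => w _; rewrite !fctE /= !subr0.
Qed.

Let sl (j : 'I_(mdim m)) : 0 < Num.sqrt (lam m j.+1).
Proof. by rewrite sqrtr_gt0 (lam_gt0 Hm). Qed.

Let int_xx i j k : P.-integrable setT (fun w => (xcoord i j w * xcoord i k w)%:E).
Proof.
apply: integrable_mul_sqr => //.
  under eq_integral do rewrite expr2; by rewrite Exx ltry.
under eq_integral do rewrite expr2; by rewrite Exx ltry.
Qed.

Let int_x i j : P.-integrable setT (fun w => (xcoord i j w)%:E).
Proof.
apply: integrable_sqr => //.
by under eq_integral do rewrite expr2; rewrite Exx ltry.
Qed.

Lemma integral_zz i j k :
  (\int[P]_w (zcoord (covar m i w) j * zcoord (covar m i w) k)%:E = (j == k)%:R%:E)%E.
Proof.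
pose c := ((Num.sqrt (lam m j.+1))^-1 / Num.sqrt (lam m k.+1)).
transitivity (\int[P]_w (c%:E * (xcoord i j w * xcoord i k w)%:E))%E.
  apply: eq_integral => w _; rewrite -EFinM; congr EFin.
  by rewrite /zcoord /xcoord /c; ring.
rewrite integralZl// Exx -EFinM; congr EFin; rewrite /Sigma !mxE /c.
have [->|jk] := eqVneq j k; last by rewrite mulr0n mulr0.
rewrite mulr1n -invfM -expr2 sqr_sqrtr ?mulVf// ?gt_eqF ?(lam_gt0 Hm)//.
exact: ltW (lam_gt0 Hm _).
Qed.

Lemma integral_rowdot_sqr i a :
  (\int[P]_w (rowdot a (covar m i w) ^+ 2)%:E = (sqn a)%:E)%E.
Proof.
have := @integral_affine_sqr _ _ _ P _ (fun j w => zcoord (covar m i w) j) 1 0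
  (fun j => a j 0).
rewrite expr0n mul1r add0r -sqnE => <-.
- by apply: eq_integral => w _; rewrite add0r.
- by move=> j; exact: mz.
- move=> j; pose c := (Num.sqrt (lam m j.+1))^-1.
  transitivity (\int[P]_w (c%:E * (xcoord i j w)%:E))%E.
    by apply: eq_integral => w _; rewrite -EFinM mulrC.
  by rewrite integralZl// Ex mule0.
- by move=> j; under eq_integral do rewrite expr2; rewrite integral_zz eqxx.
- by move=> j k jk; rewrite integral_zz (negbTE jk).
Qed.

Let rowdotE i (s : 'cV[R]_(mdim m)) w :
  (s^T *m (Sigma_isqrt m *m xvec i w)) 0 0 = rowdot s (covar m i w).
Proof.
rewrite -dotpE; apply: eq_bigr => j _; congr (_ * _).
by rewrite /Sigma_isqrt mul_diag_mx !mxE mulrC.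
Qed.

Let normM1 (s : 'cV[R]_(mdim m)) : normM 1%:M s ^+ 2 = sqn s.
Proof. by rewrite /normM mulmx1 -dotpE sqr_sqrtr ?sqn_ge0. Qed.

Let psi2_lt i (s : 'cV[R]_(mdim m)) (t0 : R) : s != 0 -> sigma_x < t0 ->
  exists t, [/\ 0 < t, t < t0 &
    (\int[P]_w (expR (rowdot s (covar m i w) ^+ 2 / (sqn s * t ^+ 2)))%:E <= 2%:E)%E].
Proof.
move=> s0 st0; case: Hm => _ [_ [_ [_ [_ [_ [_ [_ [_ [_ [_ psi]]]]]]]]]].
have : (psi2_norm P (fun w => (s^T *m (Sigma_isqrt m *m xvec i w)) 0 0 / normM 1%:M s)%R <
  t0%:E)%E.
  apply: (@le_lt_trans _ _ sigma_x%:E); last by rewrite lte_fin.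
  by rewrite -(psi i); apply: ereal_sup_ubound; exists s.
move=> /ereal_inf_lt[_ [t [t00 Et] <-]]; rewrite lte_fin => tt0.
exists t; split => //; apply: le_trans Et; rewrite unlock.
apply: eq_ler; apply: eq_integral => w _.
congr (expR _)%:E; by rewrite rowdotE exprMn exprVn normM1 -[in RHS]mulrA -invfM.
Qed.

(** For a coordinate of unit variance and t admissible in the psi2 norm, 2 >= E exp(z^2 / t^2) >= 1
    + 1 / t^2, which is impossible for t < 1. *)
Lemma sigma_x_ge1 : (0 < n)%N -> 1 <= sigma_x.
Proof.
move=> n0; rewrite leNgt; apply/negP => sx1.
have hd0 : (0 < mhead m)%N by case: Hm.
have p0 : (0 < mdim m)%N by rewrite /mdim addn_gt0 hd0.
pose s : 'cV[R]_(mdim m) := delta_mx (Ordinal p0) 0.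
have s1 : sqn s = 1 by exact: sqn_delta.
have s0 : s != 0.
  by apply/eqP => s0; move: s1; rewrite s0 /sqn dotp0l => /eqP; rewrite eq_sym oner_eq0.
have [t [t0 t1 Et]] := psi2_lt (Ordinal n0) s0 sx1.
have : (1%:E + (t ^- 2)%:E * 1%:E <= 2%:E :> \bar R)%E.
  apply: le_trans Et.
  have mr : measurable_fun setT (fun w => rowdot s (covar m (Ordinal n0) w) ^+ 2).
    by apply: measurable_funX; exact: mrow.
  apply: (@le_trans _ _ (\int[P]_w (1 + t ^- 2 * rowdot s (covar m (Ordinal n0) w) ^+ 2)%:E)%E).
    rewrite integralT_D//.
    - rewrite integralT_cst integralT_Z//.
      + by rewrite integral_rowdot_sqr s1.
      + by move=> w; exact: sqr_ge0.
      + by rewrite invr_ge0 exprn_ge0// ltW.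
    - exact: measurable_funM.
    - by move=> w; rewrite mulr_ge0 ?sqr_ge0// invr_ge0 exprn_ge0// ltW.
  apply: integralT_le.
  - by apply: measurable_funD => //; exact: measurable_funM.
  - by apply: measurableT_comp => //; exact: measurable_funM.
  - by move=> w; rewrite addr_ge0// mulr_ge0 ?sqr_ge0// invr_ge0 exprn_ge0// ltW.
  - move=> w; rewrite s1 mul1r [X in 1 + X]mulrC; exact: expR_ge1Dx.
rewrite -EFinM -EFinD lee_fin mulr1 => H.
have : 1 < t ^- 2.
  rewrite -[ltLHS]invr1 ltf_pV2 ?posrE ?exprn_gt0//.
  by rewrite expr_lt1// ltW.
lra.
Qed.

(** The infimum in the psi2 norm need not be attained, so sigma_x is doubled to have an admissible t
    below it; this explains 4 sigma_x^2. The supremum omits the zero vector, which is treated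
    apart. *)
Lemma rowdot_psi2 i a : (0 < n)%N -> sqn a <= 1 ->
  (\int[P]_w (expR (rowdot a (covar m i w) ^+ 2 / (4 * sigma_x ^+ 2)))%:E <= 2%:E)%E.
Proof.
move=> n0 a1; have sx1 := sigma_x_ge1 n0.
have mr b : measurable_fun setT (fun w => expR (rowdot a (covar m i w) ^+ 2 * b)).
  apply: measurableT_comp => //; apply: measurable_funM => //.
  by apply: measurable_funX; exact: mrow.
have [a0|a0] := eqVneq a 0.
  apply: (@le_trans _ _ (\int[P]_w 1%:E)%E); last by rewrite integralT_cst lee_fin ler1n.
  apply: eq_ler; apply: eq_integral => w _.
  rewrite /rowdot big1 ?expr0n ?mul0r ?expR0// => j _.
  by rewrite a0 mxE mul0r.
have sx2 : sigma_x < 2 * sigma_x by lra.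
have [t [t0 t1 Et]] := psi2_lt i a0 sx2.
apply: le_trans Et; apply: integralT_le => //.
move=> w; rewrite ler_expR ler_wpM2l ?sqr_ge0//.
have ap : 0 < sqn a.
  rewrite lt_neqAle sqn_ge0 andbT eq_sym; apply/eqP => /sqn_eq0 a00.
  by rewrite a00 eqxx in a0.
have pos1 : 0 < 4 * sigma_x ^+ 2 by rewrite mulr_gt0// exprn_gt0//; lra.
have pos2 : 0 < sqn a * t ^+ 2 by rewrite mulr_gt0// exprn_gt0.
rewrite lef_pV2 ?posrE//.
apply: (@le_trans _ _ (1 * t ^+ 2)); first by rewrite ler_wpM2r// exprn_ge0// ltW.
rewrite mul1r (_ : 4 * sigma_x ^+ 2 = (2 * sigma_x) ^+ 2); last by ring.
by apply: lerXn2r; [rewrite nnegrE ltW|rewrite nnegrE; lra|exact: ltW].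
Qed.

(** An instance of [subexp_mgf] with v = 4 sigma_x^2: the constant is 32 * 16 = 512, and |s| v <=
    1/2 is the stated range of s. *)
Lemma rowdot_mgf i a s : (0 < n)%N -> sqn a <= 1 -> `|s| <= (8 * sigma_x ^+ 2)^-1 ->
  (\int[P]_w (expR (s * (rowdot a (covar m i w) ^+ 2 - sqn a)))%:E <=
   (expR (512 * (sigma_x ^+ 2 * s) ^+ 2))%:E)%E.
Proof.
move=> n0 a1 hs; have sx1 := sigma_x_ge1 n0.
have sx2 : 0 < sigma_x ^+ 2 by rewrite exprn_gt0//; lra.
have -> : 512 * (sigma_x ^+ 2 * s) ^+ 2 = 32 * (s * (4 * sigma_x ^+ 2)) ^+ 2 by ring.
apply: (@subexp_mgf _ _ _ P (fun w => rowdot a (covar m i w) ^+ 2)).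
- by apply: measurable_funX; exact: mrow.
- by move=> w; exact: sqr_ge0.
- by rewrite mulr_gt0.
- exact: integral_rowdot_sqr.
- exact: rowdot_psi2.
- have : `|s| * (8 * sigma_x ^+ 2) <= 1.
    have p8 : 0 < 8 * sigma_x ^+ 2 by rewrite mulr_gt0.
    by have := ler_wpM2r (ltW p8) hs; rewrite mulVf ?gt_eqF.
  lra.
Qed.

(* z_j z_k is the difference of the squares of (z_j + z_k)/2 and (z_j - z_k)/2. *)
Lemma zz_mgf i j k s : (0 < n)%N -> j != k -> `|s| <= (16 * sigma_x ^+ 2)^-1 ->
  (\int[P]_w (expR (s * (zcoord (covar m i w) j * zcoord (covar m i w) k)))%:E <=
   (expR (2048 * (sigma_x ^+ 2 * s) ^+ 2))%:E)%E.
Proof.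
move=> n0 jk hs; have sx1 := sigma_x_ge1 n0.
have sx2 : 0 < sigma_x ^+ 2 by rewrite exprn_gt0//; lra.
pose a e : 'cV[R]_(mdim m) := 2^-1 *: (delta_mx j 0 + (-1) ^+ e *: delta_mx k 0).
have dd : dotp (delta_mx j 0 : 'cV[R]_(mdim m)) (delta_mx k 0) = 0.
  rewrite /dotp big1// => l _; rewrite !mxE.
  by have [->|] := eqVneq l j; rewrite ?mul0r// (negbTE jk) mulr0.
have a1 e : sqn (a e) = 2^-1.
  rewrite sqnZ sqnD dotpZr dd sqnZ !sqn_delta sqrr_sign; lra.
have ra e w : rowdot (a e) (covar m i w) =
    2^-1 * (zcoord (covar m i w) j + (-1) ^+ e * zcoord (covar m i w) k).
  rewrite /rowdot.
  rewrite (eq_bigr (fun l => 2^-1 * ((l == j)%:R * zcoord (covar m i w) l +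
     (-1) ^+ e * ((l == k)%:R * zcoord (covar m i w) l)))); last first.
    by move=> l _; rewrite !mxE !andbT; ring.
  rewrite -mulr_sumr big_split /= -mulr_sumr; congr (_ * (_ + _ * _)).
    by rewrite (bigD1 j)//= eqxx mul1r big1 ?addr0// => l /negbTE->; rewrite mul0r.
  by rewrite (bigD1 k)//= eqxx mul1r big1 ?addr0// => l /negbTE->; rewrite mul0r.
have hs2 e : `|(-1) ^+ e * (2 * s)| <= (8 * sigma_x ^+ 2)^-1.
  rewrite normrM normr_sign mul1r normrM ger0_norm//.
  have -> : (8 * sigma_x ^+ 2)^-1 = 2 * (16 * sigma_x ^+ 2)^-1.
    by field; rewrite gt_eqF//; lra.
  by rewrite ler_pM2l.
have a1' e : sqn (a e) <= 1 by rewrite a1; lra.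
have H e := rowdot_mgf i n0 (a1' e) (hs2 e).
have {}H e : (\int[P]_w (expR ((-1) ^+ e * (2 * s) *
    (rowdot (a e) (covar m i w) ^+ 2 - sqn (a e))))%:E <=
   (expR (2048 * (sigma_x ^+ 2 * s) ^+ 2))%:E)%E.
  apply: le_trans (H e) _.
  rewrite lee_fin ler_expR exprMn [((-1) ^+ e * _) ^+ 2]exprMn sqrr_sign exprMn; lra.
have mr e : measurable_fun setT (fun w => expR ((-1) ^+ e * (2 * s) *
    (rowdot (a e) (covar m i w) ^+ 2 - sqn (a e)))).
  apply: measurableT_comp => //; apply: measurable_funM => //.
  apply: measurable_funB => //.
  by apply: measurable_funX; exact: mrow.
apply: (@le_trans _ _ (\int[P]_w (2^-1 * (expR ((-1) ^+ false * (2 * s) *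
    (rowdot (a false) (covar m i w) ^+ 2 - sqn (a false))) +
  expR ((-1) ^+ true * (2 * s) *
    (rowdot (a true) (covar m i w) ^+ 2 - sqn (a true)))))%:E)%E).
  apply: integralT_le.
  - apply: measurableT_comp => //; apply: measurable_funM => //.
    by apply: measurable_funM; exact: mz.
  - by apply: measurable_funM => //; exact: measurable_funD.
  - by move=> w; exact: expR_ge0.
  - move=> w; set x := _ * (rowdot (a false) _ ^+ 2 - _).
    set y := _ * (rowdot (a true) _ ^+ 2 - _).
    have -> : s * (zcoord (covar m i w) j * zcoord (covar m i w) k) = (x + y) / 2.
      by rewrite /x /y !ra !a1 expr0 expr1; field.
    exact: expR_midpoint.
rewrite integralT_Z ?invr_ge0//; last by exact: measurable_funD.
rewrite integralT_D//; have h1 := H false; have h2 := H true.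
apply: (@le_trans _ _ (2^-1%:E * ((expR (2048 * (sigma_x ^+ 2 * s) ^+ 2))%:E +
  (expR (2048 * (sigma_x ^+ 2 * s) ^+ 2))%:E))%E).
  apply: lee_wpmul2l; first by rewrite lee_fin invr_ge0 ler0n.
  apply: leeD; [exact: h1|exact: h2].
rewrite -EFinD -EFinM lee_fin; lra.
Qed.

End row_moments.

(** * Exponential moments of sums over independent rows *)

Section rows.
Context (R : realType) (sigma_x : R) (n : nat) (m : model R n).
Hypothesis Hm : model_axioms sigma_x m.
Hypothesis n0 : (0 < n)%N.
Local Notation p := (mhead m + mtail m)%N.
Local Notation S := (n.-tuple (p.-tuple R)).
Local Notation P := (prob m).
Local Notation Xt := (@Xtuple R n m).

Definition Zof (s : S) : 'M[R]_(n, mdim m) := \matrix_(i, j) zcoord (tnth s i) j.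

Lemma Zof_mulE s a i : (Zof s *m a) i 0 = rowdot a (tnth s i).
Proof. by rewrite mxE; apply: eq_bigr => j _; rewrite mxE mulrC. Qed.

Lemma mx_measurable_Zof : mx_measurable Zof.
Proof.
move=> i j; under eq_fun do rewrite mxE.
apply: (measurableT_comp (measurable_zcoord j)); exact: measurable_tnth.
Qed.

Lemma measurable_Xtuple_comp (F : S -> R) :
  measurable_fun setT F -> measurable_fun setT (fun w => F (Xt w)).
Proof. by move=> mF; apply: (measurableT_comp mF); exact: measurable_Xtuple. Qed.

Lemma mutually_independent_covar : mutually_independent P (covar m).
Proof.
have -> : (covar m : 'I_n -> Omega m -> p.-tuple R) =
    fun i => snd \o (fun w => (yobs i w, covar m i w)).
  by apply/funext => i; apply/funext.
case: Hm => _ [_ [_ [_ [ind _]]]].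
exact: (mutually_independent_comp (g := fun=> snd) ind).
Qed.

Lemma integral_rows_le (f : p.-tuple R -> R) (c : R) :
  measurable_fun setT f -> (forall x, 0 <= f x) ->
  (forall i, \int[P]_w (f (covar m i w))%:E <= c%:E)%E ->
  (\int[P]_w (\prod_i f (tnth (Xt w) i))%:E <= (c ^+ n)%:E)%E.
Proof.
move=> mf f0 fc.
rewrite (eq_integral (fun w => (\prod_i f (covar m i w))%:E)); last first.
  by move=> w _; congr EFin; apply: eq_bigr => i _; rewrite tnth_mktuple.
rewrite (@mutually_independent_prod _ _ _ P _ _ _ _ (fun=> f) mutually_independent_covar)//;
  last by move=> i; apply: le_lt_trans (fc i) _; rewrite ltry.
rewrite -[X in (c ^+ X)%R](card_ord n) -prodr_const.
suff [] : (0 <= \prod_(i < n) \int[P]_w (f (covar m i w))%:E)%E /\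
  (\prod_(i < n) \int[P]_w (f (covar m i w))%:E <= (\prod_(i < n) c)%:E)%E by [].
elim/big_rec2: _ => [|i y x _ [x0 xy]]; first by rewrite lee_fin.
have fi0 := integralT_ge0 P (f := fun w => f (covar m i w)) (fun w => f0 _).
split; first exact: mule_ge0.
by rewrite EFinM; apply: lee_pmul => //; exact: fc.
Qed.

Lemma sqn_ZofE s a : sqn (Zof s *m a) = \sum_i rowdot a (tnth s i) ^+ 2.
Proof. by rewrite sqnE; apply: eq_bigr => i _; rewrite Zof_mulE. Qed.

Lemma measurable_sqn_Zof a : measurable_fun setT (fun s => sqn (Zof s *m a)).
Proof.
apply: measurable_sum => i.
have h : measurable_fun setT (fun s => (Zof s *m a) i 0).
  exact: (mx_measurableM mx_measurable_Zof (mx_measurable_cst _)).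
exact: measurable_funM.
Qed.

Lemma integral_exp_rows_le (g : p.-tuple R -> R) (c s : R) :
  measurable_fun setT g ->
  (forall i, \int[P]_w (expR (s * g (covar m i w)))%:E <= c%:E)%E ->
  (\int[P]_w (expR (s * \sum_i g (tnth (Xt w) i)))%:E <= (c ^+ n)%:E)%E.
Proof.
move=> mg gc.
rewrite (eq_integral (fun w => (\prod_i expR (s * g (tnth (Xt w) i)))%:E)); last first.
  by move=> w _; rewrite mulr_sumr expR_sum.
apply: (@integral_rows_le (fun x => expR (s * g x))) => //.
apply: measurableT_comp => //; exact: measurable_funM.
Qed.

Lemma Zof_psi2 a : sqn a <= 1 ->
  (\int[P]_w (expR (sqn (Zof (Xt w) *m a) / (4 * sigma_x ^+ 2)))%:E <= (2 ^+ n)%:E)%E.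
Proof.
move=> a1.
rewrite (eq_integral (fun w => (expR ((4 * sigma_x ^+ 2)^-1 *
   \sum_i rowdot a (tnth (Xt w) i) ^+ 2))%:E)); last first.
  by move=> w _; rewrite sqn_ZofE mulrC.
apply: (@integral_exp_rows_le (fun x => rowdot a x ^+ 2)).
  by apply: measurable_funX; exact: measurable_rowdot.
move=> i; under eq_integral do rewrite mulrC.
exact: rowdot_psi2.
Qed.

Lemma expR_pow (x : R) k : expR x ^+ k = expR (k%:R * x).
Proof. by rewrite expRM_natl. Qed.

Lemma Zof_mgf a s : sqn a <= 1 -> `|s| <= (8 * sigma_x ^+ 2)^-1 ->
  (\int[P]_w (expR (s * (sqn (Zof (Xt w) *m a) - n%:R * sqn a)))%:E <=
   (expR (n%:R * (512 * (sigma_x ^+ 2 * s) ^+ 2)))%:E)%E.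
Proof.
move=> a1 hs.
rewrite (eq_integral (fun w => (expR (s * \sum_i
   (rowdot a (tnth (Xt w) i) ^+ 2 - sqn a)))%:E)); last first.
  by move=> w _; rewrite sqn_ZofE sumrB sumr_const card_ord mulr_natl.
rewrite -expR_pow; apply: (@integral_exp_rows_le (fun x => rowdot a x ^+ 2 - sqn a)).
  apply: measurable_funB => //.
  by apply: measurable_funX; exact: measurable_rowdot.
by move=> i; exact: rowdot_mgf.
Qed.

Section weighted.
Variable pi : 'I_(mdim m) -> R.
Hypotheses (pi0 : forall j, 0 <= pi j) (pi1 : \sum_j pi j = 1).

Definition wrow (x : p.-tuple R) : R := \sum_j pi j * zcoord x j ^+ 2.

Lemma measurable_wrow : measurable_fun setT wrow.
Proof.
apply: measurable_sum => j; apply: measurable_funM => //.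
by apply: measurable_funX; exact: measurable_zcoord.
Qed.

Let rowdot_delta (j : 'I_(mdim m)) (x : p.-tuple R) : rowdot (delta_mx j 0) x = zcoord x j.
Proof.
rewrite /rowdot (bigD1 j)//= mxE !eqxx mul1r big1 ?addr0// => k /negbTE kj.
by rewrite mxE kj mul0r.
Qed.

(** Coordinates within a row are uncorrelated but may be dependent, so the exponential of their
    weighted average cannot be factorised; convexity reduces it to single coordinates. *)
Let jensen_le (c s b : R) i :
  (forall j, \int[P]_w (expR (s * (zcoord (covar m i w) j ^+ 2 - b)))%:E <= c%:E)%E ->
  (\int[P]_w (expR (s * (wrow (covar m i w) - b)))%:E <= c%:E)%E.
Proof.
move=> H.
have mz j : measurable_fun setT (fun w => expR (s * (zcoord (covar m i w) j ^+ 2 - b))).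
  apply: measurableT_comp => //; apply: measurable_funM => //.
  apply: measurable_funB => //; apply: measurable_funX.
  by apply: (measurableT_comp (measurable_zcoord j)).
apply: (@le_trans _ _ (\int[P]_w (\sum_j pi j * expR (s * (zcoord (covar m i w) j ^+ 2 -
  b)))%:E)%E).
  apply: integralT_le.
  - apply: measurableT_comp => //; apply: measurable_funM => //.
    apply: measurable_funB => //.
    by apply: (measurableT_comp measurable_wrow).
  - by apply: measurable_sum => j; exact: measurable_funM.
  - by move=> w; exact: expR_ge0.
  - move=> w; have := expR_jensen (fun j => s * (zcoord (covar m i w) j ^+ 2 - b)) pi0 pi1.
    apply: le_trans; rewrite ler_expR; apply: eq_ler.
    rewrite /wrow -[X in _ - X]mul1r -{1}pi1 mulr_suml -sumrB mulr_sumr.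
    by apply: eq_bigr => j _; ring.
rewrite integralT_sum; last 2 first.
- by move=> j; exact: measurable_funM.
- by move=> j w; rewrite mulr_ge0// expR_ge0.
rewrite -[c]mul1r -pi1 mulr_suml -sumEFin; apply: lee_sum => j _.
rewrite integralT_Z//.
by rewrite EFinM; apply: lee_wpmul2l; rewrite ?lee_fin.
Qed.

Lemma wrow_psi2 :
  (\int[P]_w (expR ((\sum_i wrow (tnth (Xt w) i)) / (4 * sigma_x ^+ 2)))%:E <= (2 ^+ n)%:E)%E.
Proof.
under eq_integral do rewrite mulrC.
apply: (@integral_exp_rows_le wrow); first exact: measurable_wrow.
move=> i; have := @jensen_le 2 (4 * sigma_x ^+ 2)^-1 0 i.
under eq_integral do rewrite subr0.
apply => j; under eq_integral do rewrite subr0 mulrC -rowdot_delta.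
by apply: rowdot_psi2 => //; rewrite sqn_delta.
Qed.

Lemma wrow_mgf s : `|s| <= (8 * sigma_x ^+ 2)^-1 ->
  (\int[P]_w (expR (s * (\sum_i wrow (tnth (Xt w) i) - n%:R)))%:E <=
   (expR (n%:R * (512 * (sigma_x ^+ 2 * s) ^+ 2)))%:E)%E.
Proof.
move=> hs.
rewrite (eq_integral (fun w => (expR (s * \sum_i (wrow (tnth (Xt w) i) - 1)))%:E)); last first.
  by move=> w _; rewrite sumrB sumr_const card_ord.
rewrite -expR_pow; apply: (@integral_exp_rows_le (fun x => wrow x - 1)).
  by apply: measurable_funB => //; exact: measurable_wrow.
move=> i; apply: jensen_le => j.
have := rowdot_mgf Hm i (a := delta_mx j 0) n0 _ hs.
rewrite sqn_delta => /(_ (lexx _)); apply: le_trans.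
by apply: eq_ler; apply: eq_integral => w _; rewrite rowdot_delta.
Qed.

End weighted.

(** The second moment is extracted from the exponential moments at s and -s by [sqr_le_cosh]. The
    choice s = 1 / (64 sigma_x^2 sqrt n) makes the total exponent 2048 / 4096 = 1/2, and e^(1/2) <=
    2 gives a mean square of at most 8 / s^2. *)
Lemma integral_cross_sqr j k : j != k ->
  (\int[P]_w ((\sum_i Zof (Xt w) i j * Zof (Xt w) i k) ^+ 2)%:E <=
   (8 * (4096 * sigma_x ^+ 4 * n%:R))%:E)%E.
Proof.
move=> jk; have sx1 := sigma_x_ge1 Hm n0.
have sx2 : 0 < sigma_x ^+ 2 by rewrite exprn_gt0//; lra.
have nR : (1 : R) <= n%:R by rewrite ler1n.
pose s := (64 * sigma_x ^+ 2 * Num.sqrt n%:R)^-1.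
have sn1 : 1 <= Num.sqrt n%:R :> R by rewrite -[leLHS]sqrtr1 ler_wsqrtr.
have s64 : 0 < 64 * sigma_x ^+ 2 * Num.sqrt n%:R by rewrite !mulr_gt0//; lra.
have s0 : 0 < s by rewrite invr_gt0.
have ssq : s ^+ 2 = (4096 * sigma_x ^+ 4 * n%:R)^-1.
  rewrite /s exprVn !exprMn sqr_sqrtr ?ler0n//; congr (_^-1); congr (_ * _); ring.
have hs (b : nat) : `|(-1) ^+ b * s| <= (16 * sigma_x ^+ 2)^-1.
  have p16 : 0 < 16 * sigma_x ^+ 2 by rewrite mulr_gt0.
  rewrite normrM normr_sign mul1r gtr0_norm// /s lef_pV2 ?posrE//.
  have h64 : 0 <= 64 * sigma_x ^+ 2 by lra.
  have := ler_wpM2l h64 sn1; lra.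
pose y w := \sum_i Zof (Xt w) i j * Zof (Xt w) i k.
have my : measurable_fun setT y.
  apply: (measurable_Xtuple_comp (F := fun s => \sum_i Zof s i j * Zof s i k)).
  apply: measurable_sum => i; apply: measurable_funM; exact: mx_measurable_Zof.
have me : forall e : nat, measurable_fun setT (fun w => expR ((-1) ^+ e * s * y w)).
  move=> e.
  by apply: measurableT_comp => //; exact: measurable_funM.
have H : forall b : nat, (\int[P]_w (expR ((-1) ^+ b * s * y w))%:E <= 2%:E)%E.
  move=> b.
  have h := @integral_exp_rows_le (fun x => zcoord x j * zcoord x k)
    (expR (2048 * (sigma_x ^+ 2 * ((-1) ^+ b * s)) ^+ 2)) ((-1) ^+ b * s).
  apply: le_trans (_ : _ <= (expR (2048 * (sigma_x ^+ 2 * ((-1) ^+ b * s)) ^+ 2) ^+ n)%:E)%E _.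
    rewrite (eq_integral (fun w => (expR ((-1) ^+ b * s *
     \sum_i zcoord (tnth (Xt w) i) j * zcoord (tnth (Xt w) i) k))%:E)).
      apply: h => [|i]; first by apply: measurable_funM; exact: measurable_zcoord.
      exact: zz_mgf.
    by move=> w _; congr (expR (_ * _))%:E; apply: eq_bigr => i _; rewrite !mxE.
  rewrite expR_pow lee_fin exprMn [((-1) ^+ b * s) ^+ 2]exprMn sqrr_sign mul1r ssq.
  have -> : n%:R * (2048 * ((sigma_x ^+ 2) ^+ 2 * (4096 * sigma_x ^+ 4 * n%:R)^-1)) = 2^-1 :> R.
    have s4 : sigma_x != 0 by rewrite gt_eqF//; lra.
    have N0 : (n%:R : R) != 0 by rewrite pnatr_eq0 -lt0n.
    by move: (n%:R : R) N0 => N N0; field; rewrite s4 N0.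
  have e1 := expR_ge1Dx (- (2^-1) : R).
  have e2 : expR (2^-1 : R) * expR (- 2^-1) = 1 by rewrite -expRD subrr expR0.
  move: (expR_ge0 (2^-1 : R)) e1 e2; move: (expR (2^-1 : R)) (expR (- 2^-1)) => x z; nra.
have key : (\int[P]_w (s ^+ 2 * y w ^+ 2 + 8)%:E <= 16%:E)%E.
  apply: (@le_trans _ _ (\int[P]_w (4 * (expR ((-1) ^+ false * s * y w) +
     expR ((-1) ^+ true * s * y w)))%:E)%E).
    apply: integralT_le.
    - apply: measurable_funD => //; apply: measurable_funM => //; exact: measurable_funX.
    - by apply: measurable_funM => //; exact: measurable_funD.
    - by move=> w; rewrite addr_ge0// mulr_ge0 ?sqr_ge0.
    - move=> w; have := sqr_le_cosh (s * y w).
      rewrite expr0 expr1 mul1r mulN1r mulNr exprMn; lra.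
  rewrite integralT_Z//; last by exact: measurable_funD.
  rewrite integralT_D//.
  apply: (@le_trans _ _ (4%:E * (2%:E + 2%:E))%E).
    by apply: lee_wpmul2l; [rewrite lee_fin|apply: leeD; [exact: (H false)|exact: (H true)]].
  by rewrite -EFinD -EFinM lee_fin; lra.
move: key; rewrite integralT_D//; last 2 first.
- by apply: measurable_funM => //; exact: measurable_funX.
- by move=> w; rewrite mulr_ge0 ?sqr_ge0.
rewrite integralT_cst integralT_Z ?sqr_ge0//; last first.
- by move=> w; exact: sqr_ge0.
- exact: measurable_funX.
have : (0 <= \int[P]_w (y w ^+ 2)%:E)%E by apply: integralT_ge0 => w; exact: sqr_ge0.
case: (\int[P]_w (y w ^+ 2)%:E)%E => [r| |] //; last first.
  by rewrite gt0_muley ?lte_fin ?exprn_gt0.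
rewrite -EFinM -EFinD !lee_fin => r0 h.
have : s ^+ 2 * r <= 8 by lra.
have K0 : 0 < 4096 * sigma_x ^+ 4 * n%:R by rewrite -invr_gt0 -ssq exprn_gt0.
by rewrite ssq mulrC ler_pdivrMr.
Qed.

End rows.

Lemma integralT_sum_le d (T : measurableType d) (R : realType) (P : probability T R)
    (I : finType) (Q : pred I) (F : I -> T -> R) (B : R) :
  (forall i, measurable_fun setT (F i)) -> (forall i w, 0 <= F i w) ->
  (forall i, Q i -> \int[P]_w (F i w)%:E <= B%:E)%E ->
  (\int[P]_w (\sum_(i | Q i) F i w)%:E <= ((\sum_(i | Q i) 1) * B)%:E)%E.
Proof.
move=> mF F0 FB; under eq_integral do rewrite -big_filter.
rewrite integralT_sum// big_filter mulr_suml -sumEFin; apply: lee_sum => i Qi.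
by rewrite mul1r FB.
Qed.

Lemma measurable_sum_cond d (T : measurableType d) (R : realType) (I : finType)
    (Q : pred I) (F : I -> T -> R) : (forall i, measurable_fun setT (F i)) ->
  measurable_fun setT (fun w => \sum_(i | Q i) F i w).
Proof.
by move=> mF; under eq_fun do rewrite -big_filter; exact: measurable_sum.
Qed.

Lemma expR_sum_le1 (R : realType) (I : finType) (Q : pred I) (x : I -> R) :
  \sum_(i | Q i) expR (x i) <= 1 -> forall i, Q i -> x i <= 0.
Proof.
move=> H i Qi; rewrite -ler_expR expR0; apply: le_trans H.
by rewrite (bigD1 i)//= lerDl sumr_ge0// => j _; exact: expR_ge0.
Qed.

(** * The event controlling the head block *)

Section events.
Context (R : realType) (sigma_x : R) (n : nat) (m : model R n).
Hypothesis Hm : model_axioms sigma_x m.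
Hypothesis n0 : (0 < n)%N.
Local Notation d := (mhead m).
Local Notation q := (mtail m).
Local Notation p := (mhead m + mtail m)%N.
Local Notation S := (n.-tuple (p.-tuple R)).
Local Notation P := (prob m).
Local Notation Xt := (@Xtuple R n m).
Local Notation Z := (@Zof R n m).
Local Notation N := (n%:R : R).

Definition eig (j : 'I_(d + q)) : R := lam m j.+1.
Definition head_eig (i : 'I_d) : R := eig (lshift q i).
Definition tail_eig (t : nat) : R := lam m (d + t).+1.

Let sx1 : 1 <= sigma_x := sigma_x_ge1 Hm n0.
Let sx2 : 0 < sigma_x ^+ 2. Proof. by rewrite exprn_gt0// (lt_le_trans ltr01). Qed.
Let N0 : 0 < N. Proof. by rewrite ltr0n. Qed.
Let d0 : (0 < d)%N. Proof. by case: Hm. Qed.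
Let q0 : (0 < q)%N. Proof. by case: Hm => _ []. Qed.

Lemma eig_gt0 j : 0 < eig j. Proof. exact: (lam_gt0 Hm j). Qed.

Lemma eig_anti (i j : 'I_(d + q)) : (i <= j)%N -> eig j <= eig i.
Proof.
have so : sorted >=%R (lambda m) by case: Hm => _ [_ []].
have tr : transitive (>=%R : rel R) by move=> x y z xy yz; exact: le_trans yz xy.
have rf : reflexive (>=%R : rel R) by move=> x; exact: lexx.
by move=> ij; apply: (sorted_leq_nth tr rf 0 so); rewrite // inE size_tuple ltn_ord.
Qed.

Lemma tail_eig_rshift (k : 'I_q) : eig (rshift d k) = tail_eig k. Proof. by []. Qed.

Lemma Xof_mulE s (v : 'cV[R]_(d + q)) :
  Xof s *m v = Z s *m (\col_j (Num.sqrt (eig j) * v j 0)).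
Proof.
apply/matrixP => i k; rewrite ord1 !mxE; apply: eq_bigr => j _; rewrite !mxE.
rewrite mulrA /zcoord mulfVK// gt_eqF// sqrtr_gt0; exact: eig_gt0.
Qed.

Lemma Xof_headE s (v : 'cV[R]_d) : lsubmx (Xof s : 'M[R]_(n, d + q)) *m v =
  Z s *m (col_mx (\col_i (Num.sqrt (head_eig i) * v i 0)) 0 : 'cV[R]_(d + q)).
Proof.
have -> : lsubmx (Xof s : 'M[R]_(n, d + q)) *m v = Xof s *m (col_mx v 0 : 'cV[R]_(d + q)).
  by rewrite mulmx_split col_mxKu col_mxKd mulmx0 addr0.
rewrite Xof_mulE; congr (_ *m _); apply/colP => j; rewrite !mxE.
by case: split_ordP => k ->; rewrite !mxE ?mulr0.
Qed.

Lemma Xof_tailE s (v : 'cV[R]_q) : rsubmx (Xof s : 'M[R]_(n, d + q)) *m v =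
  Z s *m (col_mx 0 (\col_k (Num.sqrt (tail_eig k) * v k 0)) : 'cV[R]_(d + q)).
Proof.
have -> : rsubmx (Xof s : 'M[R]_(n, d + q)) *m v = Xof s *m (col_mx 0 v : 'cV[R]_(d + q)).
  by rewrite mulmx_split col_mxKu col_mxKd mulmx0 add0r.
rewrite Xof_mulE; congr (_ *m _); apply/colP => j; rewrite !mxE.
by case: split_ordP => k ->; rewrite !mxE ?mulr0.
Qed.

(* The bad events are all of the form [F > 1]: summing the exponentials of a
   Chernoff argument over a net turns its union bound into Markov's inequality. *)
Lemma markov_event (F : S -> R) (rho : R) : measurable_fun setT F ->
  (forall s, 0 <= F s) -> (\int[P]_w (F (Xt w))%:E <= rho%:E)%E ->
  measurable [set s | F s <= 1] /\
  (P (~` (Xt @^-1` [set s | (F s <= 1)%R])) <= rho%:E)%E.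
Proof.
move=> mF F0 EF.
have mB : measurable [set s | F s <= 1].
  rewrite (_ : [set s | _] = setT `&` F @^-1` `]-oo, 1]); first exact: mF.
  by rewrite setTI; apply/seteqP; split => s; rewrite /= in_itv.
split=> //; apply: le_trans EF.
have mB' : measurable (~` (Xt @^-1` [set s | F s <= 1])).
  by apply: measurableC; exact: measurable_Xtuple_pre.
set A := ~` _ in mB' *.
have -> : P A = (\int[P]_w (\1_A w)%:E)%E by rewrite integral_indic// setIT.
apply: integralT_le.
- exact: measurable_indic.
- exact: measurable_Xtuple_comp.
- by move=> w; rewrite indicE.
- move=> w; rewrite indicE; have [|_] := boolP (w \in _); last exact: F0.
  by rewrite inE /= => /negP; rewrite -ltNge => /ltW.
Qed.

(** Chosen so that 512 (sigma_x^2 s0)^2 = s0 / 8: for deviations of N / 4 the Chernoff exponent is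
    then - s0 N / 4 + s0 N / 8 = - s0 N / 8. *)
Definition chernoff_rate : R := ((64 * sigma_x ^+ 2) ^+ 2)^-1.
Local Notation s0 := chernoff_rate.

Lemma chernoff_rate_gt0 : 0 < s0.
Proof. by rewrite invr_gt0 exprn_gt0// mulr_gt0. Qed.

Lemma chernoff_rate_le e : `|(-1) ^+ e * s0| <= (8 * sigma_x ^+ 2)^-1.
Proof.
have p8 : 0 < 8 * sigma_x ^+ 2 by rewrite mulr_gt0.
have p64 : 0 < (64 * sigma_x ^+ 2) ^+ 2 by rewrite exprn_gt0// mulr_gt0.
rewrite normrM normr_sign mul1r (gtr0_norm chernoff_rate_gt0) lef_pV2 ?posrE//.
have s21 : 1 <= sigma_x ^+ 2 by rewrite exprn_ege1.
have := ler_wpM2r (ltW sx2) s21; nra.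
Qed.

Lemma chernoff_exponent e : 512 * (sigma_x ^+ 2 * ((-1) ^+ e * s0)) ^+ 2 = s0 / 8.
Proof.
rewrite exprMn [((-1) ^+ e * _) ^+ 2]exprMn sqrr_sign /s0; field.
by rewrite gt_eqF// (lt_le_trans ltr01).
Qed.

(** The index e treats both signs of the deviation. The threshold N / 4 on the net is doubled by
    [quad_net] to N / 2 on the whole space, whence the factors 1/2 and 3/2 in
    [head_event_bounds]. *)
Definition head_event (s : S) : R :=
  \sum_(f : {ffun 'I_d -> bool * 'I_(4 * d).+1} | net_code f) \sum_(e : bool)
    expR ((-1) ^+ e * s0 * (sqn (Z s *m (col_mx (net_point R f) 0 : 'cV[R]_(d + q)))
       - N * sqn (net_point R f)) - s0 * N / 4).

Lemma head_event_ge0 s : 0 <= head_event s.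
Proof. by rewrite sumr_ge0// => f _; rewrite sumr_ge0// => e _; exact: expR_ge0. Qed.

Let mterm (a : 'cV[R]_(d + q)) c b e : measurable_fun setT
  (fun s => expR (c * (sqn (Z s *m a) - b) + e)).
Proof.
apply: measurableT_comp => //; apply: measurable_funD => //.
apply: measurable_funM => //; apply: measurable_funB => //.
exact: measurable_sqn_Zof.
Qed.

Let mterm0 (a : 'cV[R]_(d + q)) c b : measurable_fun setT
  (fun s => expR (c * (sqn (Z s *m a) - b))).
Proof.
apply: measurableT_comp => //; apply: measurable_funM => //.
apply: measurable_funB => //; exact: measurable_sqn_Zof.
Qed.

Lemma measurable_head_event : measurable_fun setT head_event.
Proof. by apply: measurable_sum_cond => f; apply: measurable_sum. Qed.

Lemma integral_head_event :
  (\int[P]_w (head_event (Xt w))%:E <= (2 ^+ (18 * d) * (2 * expR (- (s0 * N / 8))))%:E)%E.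
Proof.
apply: le_trans (integralT_sum_le (B := 2 * expR (- (s0 * N / 8))) _ _ _) _.
- move=> f; apply: measurable_sum => e.
  exact: (measurable_Xtuple_comp (mterm _ _ _ _)).
- by move=> f w; rewrite sumr_ge0// => e _; exact: expR_ge0.
- move=> f Hf.
  have H e : (\int[P]_w (expR ((-1) ^+ e * s0 *
     (sqn (Z (Xt w) *m (col_mx (net_point R f) 0 : 'cV[R]_(d + q)))
       - N * sqn (net_point R f)) - s0 * N / 4))%:E <= (expR (- (s0 * N / 8)))%:E)%E.
    have s1 : sqn (col_mx (net_point R f) 0 : 'cV[R]_(d + q)) = sqn (net_point R f).
      by rewrite sqn_col_mx /sqn dotp0l addr0.
    have := @Zof_mgf _ _ _ _ Hm n0 (col_mx (net_point R f) 0 : 'cV[R]_(d + q)) _ _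
      (chernoff_rate_le e).
    rewrite s1 => /(_ (net_point_le1 R d0 Hf)) h.
    under eq_integral do rewrite expRD mulrC.
    rewrite integralT_Z ?expR_ge0//; last first.
      exact: (measurable_Xtuple_comp (mterm0 _ _ _)).
    apply: (@le_trans _ _ ((expR (- (s0 * N / 4)))%:E *
      (expR (N * (512 * (sigma_x ^+ 2 * ((-1) ^+ e * s0)) ^+ 2)))%:E)%E).
      by apply: lee_wpmul2l; rewrite ?lee_fin ?expR_ge0.
    rewrite -EFinM -expRD lee_fin ler_expR chernoff_exponent; lra.
  rewrite integralT_sum; last 2 first.
  - by move=> e; exact: (measurable_Xtuple_comp (mterm _ _ _ _)).
  - by move=> e w; exact: expR_ge0.
  rewrite big_bool /= [(2 * _)%R]mulr_natl mulr2n EFinD.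
  by apply: leeD; exact: H.
- rewrite lee_fin ler_wpM2r ?mulr_ge0 ?expR_ge0//; exact: card_net_code.
Qed.

Lemma head_event_bounds s : head_event s <= 1 -> forall v : 'cV[R]_d,
  2^-1 * N * wsq head_eig v <= sqn (lsubmx (Xof s : 'M[R]_(n, d + q)) *m v) /\
  sqn (lsubmx (Xof s : 'M[R]_(n, d + q)) *m v) <= N * (3 / 2) * wsq head_eig v.
Proof.
move=> HF v.
pose Z1 := lsubmx (Z s : 'M[R]_(n, d + q)).
have Z1E (u : 'cV_d) : Z s *m (col_mx u 0 : 'cV[R]_(d + q)) = Z1 *m u.
  by rewrite mulmx_split col_mxKu col_mxKd mulmx0 addr0.
pose Q : 'M[R]_d := Z1^T *m Z1 - N%:M.
have QT : Q^T = Q by rewrite /Q linearB /= trmx_mul trmxK tr_scalar_mx.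
have QE u : dotp u (Q *m u) = sqn (Z1 *m u) - N * sqn u.
  by rewrite mulmxBl dotpDr dotpNr mul_scalar_mx dotpZr sqn_mulmx.
have net f : net_code f -> `|dotp (net_point R f) (Q *m net_point R f)| <= N / 4.
  move=> Hf; rewrite QE -Z1E.
  have H (e : bool) : (-1) ^+ e * s0 * (sqn (Z s *m (col_mx (net_point R f) 0 : 'cV[R]_(d + q)))
       - N * sqn (net_point R f)) - s0 * N / 4 <= 0.
    move: HF; rewrite /head_event pair_big_dep /= => HF.
    by have := @expR_sum_le1 _ _ _ _ HF (f, e); rewrite /= Hf => /(_ isT).
  have := H true; have := H false; rewrite expr0 expr1.
  set x := sqn _ - _; have s00 := chernoff_rate_gt0 => h1 h2.
  rewrite ler_norml; apply/andP; split; rewrite -(ler_pM2l s00); lra.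
have := quad_net d0 QT net; move=> /(_ (\col_i (Num.sqrt (head_eig i) * v i 0))).
rewrite QE -Z1E -Xof_headE.
have -> : sqn (\col_i (Num.sqrt (head_eig i) * v i 0)) = wsq head_eig v.
  rewrite sqnE; apply: eq_bigr => i _.
  by rewrite mxE exprMn sqr_sqrtr// ltW// eig_gt0.
by rewrite ler_norml => /andP[h1 h2]; split; lra.
Qed.

End events.

(** * The operator bound for the tail block *)

Section tail_events.
Context (R : realType) (sigma_x : R) (n : nat) (m : model R n).
Hypothesis Hm : model_axioms sigma_x m.
Hypothesis n0 : (0 < n)%N.
Local Notation d := (mhead m).
Local Notation q := (mtail m).
Local Notation p := (mhead m + mtail m)%N.
Local Notation S := (n.-tuple (p.-tuple R)).
Local Notation P := (prob m).
Local Notation Xt := (@Xtuple R n m).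
Local Notation Z := (@Zof R n m).
Local Notation N := (n%:R : R).
Local Notation lamt := (tail_eig m).
Local Notation lamh := (@head_eig R n m).

Let sx1 : 1 <= sigma_x := sigma_x_ge1 Hm n0.
Let sx2 : 0 < sigma_x ^+ 2. Proof. by rewrite exprn_gt0// (lt_le_trans ltr01). Qed.
Let N0 : 0 < N. Proof. by rewrite ltr0n. Qed.
Let d0 : (0 < d)%N. Proof. by case: Hm. Qed.
Let q0 : (0 < q)%N. Proof. by case: Hm => _ []. Qed.

(** The default value of [nth] extends the tail eigenvalues by 0, so that they form a nonincreasing
    sequence on all naturals and block heads beyond q contribute nothing. *)
Lemma tail_eig_eq0 t : (q <= t)%N -> lamt t = 0.
Proof. by move=> qt; rewrite /tail_eig /lam nth_default// size_tuple leq_add2l. Qed.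

Lemma tail_eig_gt0 t : (t < q)%N -> 0 < lamt t.
Proof. by move=> tq; have := eig_gt0 Hm (rshift d (Ordinal tq)). Qed.

Lemma tail_eig_ge0 t : 0 <= lamt t.
Proof. by have [tq|/tail_eig_eq0->//] := ltnP t q; exact: ltW (tail_eig_gt0 tq). Qed.

Lemma tail_eig_anti : {homo lamt : s t / (s <= t)%N >-> t <= s}.
Proof.
move=> s t st; have [tq|/tail_eig_eq0->] := ltnP t q; last exact: tail_eig_ge0.
have sq : (s < q)%N := leq_ltn_trans st tq.
by apply: (eig_anti Hm (i := rshift d (Ordinal sq)) (j := rshift d (Ordinal tq)));
  rewrite /= leq_add2l.
Qed.

Definition block_total : R := \sum_(b < q) lamt (b * n)%N.

Lemma block_total_gt0 : 0 < block_total.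
Proof.
rewrite /block_total (bigD1 (Ordinal q0))//= ltr_pwDl ?tail_eig_gt0//.
by rewrite sumr_ge0// => b _; exact: tail_eig_ge0.
Qed.

Lemma eff_rankE k : eff_rank m k = (\sum_(t < q) lamt t ^+ k) / lamt 0 ^+ k.
Proof.
rewrite /eff_rank /tail_eig addn0; congr (_ / _).
rewrite -(add0n d.+1) big_addn -(big_mkord xpredT (fun t => lam m (d + t).+1 ^+ k)).
by rewrite /mdim subSS addKn; apply: eq_bigr => i _; rewrite addnS addnC.
Qed.

Lemma block_total_le C1 : eff_rank m 1 / N <= C1 ->
  block_total <= (1 + C1) * lamt 0.
Proof.
rewrite eff_rankE expr1 ler_pdivrMr// ler_pdivrMr ?tail_eig_gt0// => H.
rewrite -(ler_pM2l N0) /block_total;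
  apply: le_trans (sum_block_heads n tail_eig_ge0 tail_eig_anti tail_eig_eq0) _.
rewrite (eq_bigr (fun t : 'I_q => lamt t ^+ 1)); last by move=> t _; rewrite expr1.
by apply: le_trans (lerD (lexx _) H) _; apply: eq_ler; ring.
Qed.

Let blockv (b : nat) (y : 'cV[R]_n) : 'cV[R]_(d + q) := col_mx 0 (window_mx R n q b *m y).

Definition block_sum (b : nat) (s : S) : R :=
  \sum_(f : {ffun 'I_n -> bool * 'I_(4 * n).+1} | net_code f)
    expR (sqn (Z s *m blockv b (net_point R f)) / (4 * sigma_x ^+ 2)).

(* A union bound over the blocks would cost a factor [q].  The weighted average
   suffices because only [\sum_b lamt (b * n) * ln (block_sum b s)] is needed,
   and [ln x <= x / T + ln T - 1]. *)
Definition tail_event (s : S) : R :=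
  \sum_(b < q) lamt (b * n)%N / (block_total * expR (20 * N)) * block_sum b s.

Let mblock (a : 'cV[R]_(d + q)) c : measurable_fun setT (fun s => expR (sqn (Z s *m a) / c)).
Proof.
apply: measurableT_comp => //; apply: measurable_funM => //.
exact: measurable_sqn_Zof.
Qed.

Let mbs b : measurable_fun setT (block_sum b).
Proof. by apply: measurable_sum_cond => f. Qed.

Let bs0 b s : 0 <= block_sum b s.
Proof. by rewrite sumr_ge0// => f _; exact: expR_ge0. Qed.

Let wt0 (b : 'I_q) : 0 <= lamt (b * n)%N / (block_total * expR (20 * N)).
Proof. by rewrite divr_ge0 ?tail_eig_ge0// mulr_ge0 ?expR_ge0// ltW// block_total_gt0. Qed.

Lemma tail_event_ge0 s : 0 <= tail_event s.
Proof. by rewrite sumr_ge0// => b _; rewrite mulr_ge0. Qed.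

Lemma measurable_tail_event : measurable_fun setT tail_event.
Proof. by apply: measurable_sum => b; exact: measurable_funM. Qed.

(** A block contributes 2^(18 n) net points with exponential moment at most 2^n each, hence at most
    e^(19 N). The normalisation by e^(20 N) leaves e^(-N), and the weights sum to 1 before it. *)
Lemma integral_tail_event :
  (\int[P]_w (tail_event (Xt w))%:E <= (expR (- N))%:E)%E.
Proof.
have Hb b : (\int[P]_w (block_sum b (Xt w))%:E <= (2 ^+ (19 * n))%:E)%E.
  apply: le_trans (integralT_sum_le (B := 2 ^+ n) _ _ _) _.
  - by move=> f; exact: (measurable_Xtuple_comp (mblock _ _)).
  - by move=> f w; exact: expR_ge0.
  - move=> f Hf; apply: Zof_psi2 => //.
    rewrite sqn_col_mx /sqn dotp0l add0r; apply: le_trans (net_point_le1 R n0 Hf).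
    exact: sqn_window_mx.
  - rewrite lee_fin (_ : 19 * n = 18 * n + n)%N; last by rewrite -mulSnr.
    by rewrite exprD ler_wpM2r ?exprn_ge0//; exact: card_net_code.
rewrite integralT_sum; last 2 first.
- move=> b; apply: measurable_funM => //.
  exact: (measurable_Xtuple_comp (mbs b)).
- by move=> b w; rewrite mulr_ge0.
apply: (@le_trans _ _ (\sum_(b < q) (lamt (b * n)%N / (block_total * expR (20 * N)) *
   2 ^+ (19 * n))%:E)%E).
  apply: lee_sum => b _; rewrite integralT_Z//.
    rewrite [X in (_ <= X)%E]EFinM; apply: lee_wpmul2l; last exact: Hb.
    by rewrite lee_fin.
  exact: (measurable_Xtuple_comp (mbs b)).
rewrite sumEFin lee_fin -mulr_suml -mulr_suml -/block_total.
have B0 := block_total_gt0.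
have -> : block_total / (block_total * expR (20 * N)) = expR (- (20 * N)).
  by rewrite expRN; field; rewrite !gt_eqF ?expR_gt0.
apply: le_trans (ler_wpM2l (expR_ge0 _) (pow2_le_expR R (19 * n))) _.
by rewrite -expRD ler_expR natrM; lra.
Qed.

Lemma tail_event_bound s : tail_event s <= 1 -> forall w : 'cV[R]_q,
  sqn (rsubmx (Xof s : 'M[R]_(n, d + q)) *m w) <=
  160 * sigma_x ^+ 2 * N * block_total * sqn w.
Proof.
move=> HF.
set X2 := rsubmx _; pose Z2 := rsubmx (Z s : 'M[R]_(n, d + q)).
have Z2E (u : 'cV_q) : Z s *m (col_mx 0 u : 'cV[R]_(d + q)) = Z2 *m u.
  by rewrite mulmx_split col_mxKu col_mxKd mulmx0 add0r.
(* Each exponent in [block_sum] is at most its logarithm, which bounds the form on the net; the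
   leading 2 is the loss of [quad_net]. Averaging these logarithms to 20 N produces 8 * 20 = 160. *)
pose a b := 2 * (4 * sigma_x ^+ 2 * ln (block_sum b s)).
have p4 : 0 < 4 * sigma_x ^+ 2 by rewrite mulr_gt0.
have bs1 b : 1 <= block_sum b s.
  have [f Hf _] := @net_approx R n n0 0 ltac:(by rewrite /sqn dotp0l).
  rewrite /block_sum (bigD1 f)//= -[leLHS]addr0 lerD ?sumr_ge0//.
    by rewrite -[leLHS]expR0 ler_expR divr_ge0 ?sqn_ge0// ltW.
have bsp b : 0 < block_sum b s by rewrite (lt_le_trans ltr01).
have a0 b : 0 <= a b by rewrite mulr_ge0// mulr_ge0 ?ln_ge0// ltW.
have Hblock b v : sqn (Z2 *m window_mx R n q b *m v) <= a b * sqn v.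
  pose Q : 'M[R]_n := (Z2 *m window_mx R n q b)^T *m (Z2 *m window_mx R n q b).
  have QT : Q^T = Q by rewrite /Q trmx_mul trmxK.
  have QE u : dotp u (Q *m u) = sqn (Z2 *m window_mx R n q b *m u) by rewrite sqn_mulmx.
  have net f : net_code f -> `|dotp (net_point R f) (Q *m net_point R f)| <=
      4 * sigma_x ^+ 2 * ln (block_sum b s).
    move=> Hf; rewrite QE ger0_norm ?sqn_ge0// mulrC -ler_pdivrMr//.
    rewrite -ler_expR lnK ?posrE//.
    rewrite /block_sum (bigD1 f)//= /blockv Z2E mulmxA lerDl sumr_ge0//.
  have := quad_net n0 QT net v; rewrite QE ger0_norm ?sqn_ge0//.
have Hu u : sqn (X2^T *m u) <= 160 * sigma_x ^+ 2 * N * block_total * sqn u.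
  have := weighted_block_bound n0 tail_eig_ge0 tail_eig_anti (fun b _ => a0 b) (fun b v _ =>
    Hblock b v) u.
  have -> : \sum_(t < q) lamt t * (Z2^T *m u) t 0 ^+ 2 = sqn (X2^T *m u).
    rewrite sqnE; apply: eq_bigr => t _.
    have -> : (X2^T *m u) t 0 = Num.sqrt (lamt t) * (Z2^T *m u) t 0.
      rewrite !mxE mulr_sumr; apply: eq_bigr => i _; rewrite !mxE mulrA; congr (_ * _).
      rewrite /zcoord mulrCA mulfV ?mulr1//.
      by rewrite gt_eqF// sqrtr_gt0 tail_eig_gt0.
    by rewrite exprMn sqr_sqrtr ?tail_eig_ge0.
  move=> h; apply: (le_trans h); rewrite ler_wpM2r ?sqn_ge0//.
  have T0 : 0 < expR (20 * N) by exact: expR_gt0.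
  have B0 := block_total_gt0.
  have lnb b : ln (block_sum b s) <= block_sum b s / expR (20 * N) + (20 * N - 1).
    have := @le_ln1Dx R (block_sum b s / expR (20 * N) - 1).
    rewrite addrCA subrr addr0 ltrBDl addrN divr_gt0// => /(_ isT).
    by rewrite lnM ?posrE ?invr_gt0// lnV ?posrE// expRK; lra.
  have key : \sum_(b < q) lamt (b * n)%N * ln (block_sum b s) <= block_total * (20 * N).
    apply: (@le_trans _ _ (\sum_(b < q) lamt (b * n)%N *
      (block_sum b s / expR (20 * N) + (20 * N - 1)))).
      by apply: ler_sum => b _; rewrite ler_wpM2l ?tail_eig_ge0.
    have -> : \sum_(b < q) lamt (b * n)%N * (block_sum b s / expR (20 * N) + (20 * N - 1)) =
       block_total * tail_event s + block_total * (20 * N - 1).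
      rewrite (eq_bigr (fun b : 'I_q => block_total * (lamt (b * n)%N / (block_total *
        expR (20 * N)) * block_sum b s) + lamt (b * n)%N * (20 * N - 1))); last first.
        by move=> b _; field; rewrite !gt_eqF.
      by rewrite big_split /= -mulr_sumr -mulr_suml.
    have := ler_wpM2l (ltW B0) HF; lra.
  rewrite (eq_bigr (fun b : 'I_q => 8 * sigma_x ^+ 2 * (lamt (b * n)%N * ln (block_sum b s))));
    last first.
    by move=> b _; rewrite /a; ring.
  rewrite -mulr_sumr; have p8 : 0 <= 8 * sigma_x ^+ 2 by rewrite mulr_ge0// ltW.
  have := ler_wpM2l p8 key; lra.
rewrite -[X2]trmxK; apply: sqn_mulmx_tr; last exact: Hu.
apply: mulr_ge0; last exact: ltW block_total_gt0.
by apply: mulr_ge0 (ltW N0); exact: mulr_ge0 _ (ltW sx2).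
Qed.

End tail_events.

(** * Events for the tail signal, the tail energy and the cross energy *)

Section moment_events.
Context (R : realType) (sigma_x : R) (n : nat) (m : model R n).
Hypothesis Hm : model_axioms sigma_x m.
Hypothesis n0 : (0 < n)%N.
Local Notation d := (mhead m).
Local Notation q := (mtail m).
Local Notation p := (mhead m + mtail m)%N.
Local Notation S := (n.-tuple (p.-tuple R)).
Local Notation P := (prob m).
Local Notation Xt := (@Xtuple R n m).
Local Notation Z := (@Zof R n m).
Local Notation N := (n%:R : R).
Local Notation lamt := (tail_eig m).
Local Notation lamh := (@head_eig R n m).
Local Notation lamv := (@eig R n m).
Local Notation s0 := (chernoff_rate sigma_x).
Local Notation th2 := (dsubmx (theta m)).

Let sx1 : 1 <= sigma_x := sigma_x_ge1 Hm n0.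
Let sx2 : 0 < sigma_x ^+ 2. Proof. by rewrite exprn_gt0// (lt_le_trans ltr01). Qed.
Let N0 : 0 < N. Proof. by rewrite ltr0n. Qed.
Let d0 : (0 < d)%N. Proof. by case: Hm. Qed.
Let q0 : (0 < q)%N. Proof. by case: Hm => _ []. Qed.
Let p4 : 0 < 4 * sigma_x ^+ 2. Proof. by rewrite mulr_gt0. Qed.

Let Zexp0 : 2 ^+ n * expR (- (2 * N)) <= expR (- N) :> R.
Proof.
apply: le_trans (ler_wpM2r (expR_ge0 _) (pow2_le_expR R n)) _.
by rewrite -expRD ler_expR; lra.
Qed.

Definition tail_signal : R := wsq (fun k : 'I_q => lamt k) th2.

Lemma tail_signal_ge0 : 0 <= tail_signal.
Proof. by apply: wsq_ge0 => k; exact: (tail_eig_ge0 Hm). Qed.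

(** The direction of Sigma^(1/2) applied to the tail signal. As the inverse of 0 is 0, it is the
    zero vector when the signal vanishes, so its norm is at most 1 in all cases. *)
Definition signal_dir : 'cV[R]_(d + q) := (Num.sqrt tail_signal)^-1 *:
  col_mx 0 (\col_k (Num.sqrt (lamt k) * th2 k 0)).

Let sqn_tail_dir : sqn (col_mx 0 (\col_k (Num.sqrt (lamt k) * th2 k 0)) : 'cV[R]_(d + q))
  = tail_signal.
Proof.
rewrite sqn_col_mx [sqn 0]/sqn dotp0l add0r sqnE; apply: eq_bigr => k _.
by rewrite mxE exprMn sqr_sqrtr// (tail_eig_ge0 Hm).
Qed.

Lemma sqn_signal_dir : sqn signal_dir <= 1.
Proof.
rewrite /signal_dir sqnZ sqn_tail_dir exprVn sqr_sqrtr ?tail_signal_ge0//.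
by have [->|W0] := eqVneq tail_signal 0; rewrite ?mulr0// mulVf.
Qed.

(** The offset 2 N beats the exponential moment 2^n and leaves e^(-N); it makes the bound 2 * 4 = 8
    times sigma_x^2 N. *)
Definition signal_event (s : S) : R :=
  expR (sqn (Z s *m signal_dir) / (4 * sigma_x ^+ 2) - 2 * N).

Let mZ (a : 'cV[R]_(d + q)) c : measurable_fun setT (fun s => expR (sqn (Z s *m a) / c)).
Proof.
apply: measurableT_comp => //; apply: measurable_funM => //.
exact: measurable_sqn_Zof.
Qed.

Lemma measurable_signal_event : measurable_fun setT signal_event.
Proof.
rewrite /signal_event; under eq_fun do rewrite expRD.
by apply: measurable_funM => //; exact: mZ.
Qed.

Lemma integral_signal_event : (\int[P]_w (signal_event (Xt w))%:E <= (expR (- N))%:E)%E.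
Proof.
rewrite /signal_event; under eq_integral do rewrite expRD mulrC.
rewrite integralT_Z ?expR_ge0//; last exact: (measurable_Xtuple_comp (mZ _ _)).
apply: (@le_trans _ _ ((expR (- (2 * N)))%:E * (2 ^+ n)%:E)%E).
  apply: lee_wpmul2l; first by rewrite lee_fin expR_ge0.
  exact: (Zof_psi2 Hm n0 sqn_signal_dir).
by rewrite -EFinM lee_fin mulrC; exact: Zexp0.
Qed.

Lemma signal_event_bound s : signal_event s <= 1 ->
  sqn (rsubmx (Xof s : 'M[R]_(n, d + q)) *m th2) <= 8 * sigma_x ^+ 2 * N * tail_signal.
Proof.
rewrite -[X in _ <= X]expR0 ler_expR subr_le0 ler_pdivrMr// => H.
rewrite (Xof_tailE Hm).
set a := col_mx _ _.
have [W0|W0] := eqVneq tail_signal 0.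
  have a0 : a = 0 by apply: sqn_eq0; rewrite sqn_tail_dir.
  by rewrite a0 mulmx0 W0 mulr0 /sqn dotp0l.
have Wp : 0 < tail_signal by rewrite lt_neqAle eq_sym W0 tail_signal_ge0.
have -> : a = Num.sqrt tail_signal *: signal_dir.
  by rewrite scalerA mulfV ?scale1r// gt_eqF// sqrtr_gt0.
rewrite -scalemxAr sqnZ sqr_sqrtr ?tail_signal_ge0//.
by have := ler_wpM2l (ltW Wp) H; lra.
Qed.

Definition tail_sqsum : R := \sum_(k < q) lamt k ^+ 2.
Local Notation mu := tail_sqsum.

Lemma tail_sqsum_gt0 : 0 < mu.
Proof.
rewrite /tail_sqsum (bigD1 (Ordinal q0))//= ltr_pwDl ?exprn_gt0 ?(tail_eig_gt0 Hm)//.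
by rewrite sumr_ge0// => b _; exact: sqr_ge0.
Qed.

(** Since lambda_k |X2 e_k|^2 = lambda_k^2 sum_i z_ik^2, the tail energy is [tail_sqsum] times a sum
    over the rows of convex combinations of squared coordinates, with these weights. *)
Definition tail_weight (j : 'I_(mdim m)) : R :=
  if fintype.split (j : 'I_(d + q)) is inr k then lamt k ^+ 2 / mu else 0.

Lemma tail_weight_ge0 j : 0 <= tail_weight j.
Proof.
rewrite /tail_weight; case: fintype.split => // k.
by rewrite divr_ge0 ?sqr_ge0// ltW// tail_sqsum_gt0.
Qed.

Let sum_tail_weight (f : 'I_(mdim m) -> R) :
  \sum_j tail_weight j * f j = \sum_(k < q) lamt k ^+ 2 / mu * f (rshift d k).
Proof.
rewrite (@big_split_ord _ _ _ d q) /= [X in X + _]big1 ?add0r.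
  by apply: eq_bigr => k _; rewrite /tail_weight (unsplitK (inr k)).
by move=> i _; rewrite /tail_weight (unsplitK (inl i)) mul0r.
Qed.

Lemma tail_weight_sum : \sum_j tail_weight j = 1.
Proof.
under eq_bigr do rewrite -[tail_weight _]mulr1.
rewrite (sum_tail_weight (fun=> 1)); under eq_bigr do rewrite mulr1.
by rewrite -mulr_suml mulfV// gt_eqF// tail_sqsum_gt0.
Qed.

Lemma XofE s i (j : 'I_(d + q)) : Xof s i j = Num.sqrt (lamv j) * Z s i j.
Proof.
rewrite !mxE /zcoord mulrC divfK// gt_eqF// sqrtr_gt0; exact: (eig_gt0 Hm).
Qed.

Lemma tail_energyE s : tail_energy (Xof s : 'M[R]_(n, d + q)) lamv =
  mu * \sum_i wrow tail_weight (tnth s i).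
Proof.
have m0 := tail_sqsum_gt0.
under [in RHS]eq_bigr do rewrite /wrow (sum_tail_weight (fun j => zcoord _ j ^+ 2)).
rewrite exchange_big /= mulr_sumr /tail_energy; apply: eq_bigr => k _.
rewrite -mulr_sumr sqnE mulrA [mu * _]mulrC divfK ?gt_eqF// expr2 -mulrA.
congr (_ * _); rewrite mulr_sumr; apply: eq_bigr => i _.
by rewrite [col _ _ _ _]mxE [rsubmx _ _ _]mxE XofE exprMn sqr_sqrtr ?(tail_eig_ge0 Hm)// mxE.
Qed.

Let mwsum : measurable_fun setT (fun s : S => \sum_i wrow tail_weight (tnth s i)).
Proof.
apply: measurable_sum => i; apply: (measurableT_comp (measurable_wrow _)).
exact: measurable_tnth.
Qed.

Definition energy_upper_event (s : S) : R :=
  expR ((\sum_i wrow tail_weight (tnth s i)) / (4 * sigma_x ^+ 2) - 2 * N).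

Lemma measurable_energy_upper_event : measurable_fun setT energy_upper_event.
Proof.
apply: measurableT_comp => //; apply: measurable_funB => //; exact: measurable_funM.
Qed.

Lemma integral_energy_upper_event :
  (\int[P]_w (energy_upper_event (Xt w))%:E <= (expR (- N))%:E)%E.
Proof.
rewrite /energy_upper_event; under eq_integral do rewrite expRD mulrC.
rewrite integralT_Z ?expR_ge0//; last first.
  apply: (measurable_Xtuple_comp (F := fun s => expR ((\sum_i wrow tail_weight (tnth s i)) /
    (4 * sigma_x ^+ 2)))).
  by apply: measurableT_comp => //; exact: measurable_funM.
apply: (@le_trans _ _ ((expR (- (2 * N)))%:E * (2 ^+ n)%:E)%E).
  apply: lee_wpmul2l; first by rewrite lee_fin expR_ge0.
  exact: (wrow_psi2 Hm n0 tail_weight_ge0 tail_weight_sum).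
by rewrite -EFinM lee_fin mulrC; exact: Zexp0.
Qed.

Lemma energy_upper_event_bound s : energy_upper_event s <= 1 ->
  tail_energy (Xof s : 'M[R]_(n, d + q)) lamv <= 8 * sigma_x ^+ 2 * N * mu.
Proof.
rewrite -[X in _ <= X]expR0 ler_expR subr_le0 ler_pdivrMr// => H.
by rewrite tail_energyE; have := ler_wpM2l (ltW tail_sqsum_gt0) H; lra.
Qed.

(** Chernoff bound for the lower tail at rate - s0 and deviation N / 2; the exponent - s0 N / 2 + s0
    N / 8 is at most - s0 N / 4. *)
Definition energy_lower_event (s : S) : R :=
  expR (- s0 * (\sum_i wrow tail_weight (tnth s i) - N) - s0 * N / 2).

Lemma measurable_energy_lower_event : measurable_fun setT energy_lower_event.
Proof.
apply: measurableT_comp => //; apply: measurable_funB => //; apply: measurable_funM => //.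
exact: measurable_funB.
Qed.

Lemma integral_energy_lower_event :
  (\int[P]_w (energy_lower_event (Xt w))%:E <= (expR (- (s0 * N / 4)))%:E)%E.
Proof.
have s00 := chernoff_rate_gt0 Hm n0.
rewrite /energy_lower_event; under eq_integral do rewrite expRD mulrC.
rewrite integralT_Z ?expR_ge0//; last first.
  apply: (measurable_Xtuple_comp (F := fun s => expR (- s0 *
    (\sum_i wrow tail_weight (tnth s i) - N)))).
  apply: measurableT_comp => //; apply: measurable_funM => //; exact: measurable_funB.
apply: (@le_trans _ _ ((expR (- (s0 * N / 2)))%:E *
    (expR (N * (512 * (sigma_x ^+ 2 * - s0) ^+ 2)))%:E)%E).
  apply: lee_wpmul2l; first by rewrite lee_fin expR_ge0.
  apply: (wrow_mgf Hm n0 tail_weight_ge0 tail_weight_sum).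
  by have := chernoff_rate_le Hm n0 1; rewrite expr1 mulN1r.
have := chernoff_exponent Hm n0 1; rewrite expr1 mulN1r => ->.
by rewrite -EFinM -expRD lee_fin ler_expR; have := mulr_gt0 s00 N0; lra.
Qed.

Lemma energy_lower_event_bound s : energy_lower_event s <= 1 ->
  N * mu / 2 <= tail_energy (Xof s : 'M[R]_(n, d + q)) lamv.
Proof.
have s00 := chernoff_rate_gt0 Hm n0.
rewrite -[X in _ <= X]expR0 ler_expR => H; rewrite tail_energyE.
set T := \sum_i _ in H *.
have : N / 2 <= T by rewrite -(ler_pM2l s00); lra.
by move/(ler_wpM2l (ltW tail_sqsum_gt0)); lra.
Qed.

Lemma cross_energyE s : cross_energy (Xof s : 'M[R]_(n, d + q)) lamv =
  \sum_(k < q) \sum_(j < d) lamt k ^+ 2 *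
    (\sum_i Z s i (lshift q j) * Z s i (rshift d k)) ^+ 2.
Proof.
apply: eq_bigr => k _; rewrite mulr_sumr; apply: eq_bigr => j _.
have h0 : 0 < lamh j := eig_gt0 Hm _.
have k0 : 0 < lamt k by exact: tail_eig_gt0 Hm _ _.
have -> : ((lsubmx (Xof s : 'M[R]_(n, d + q)))^T *m col k (rsubmx (Xof s : 'M[R]_(n, d + q)))) j 0
  = Num.sqrt (lamh j) * Num.sqrt (lamt k) * \sum_i Z s i (lshift q j) * Z s i (rshift d k).
  rewrite mxE mulr_sumr; apply: eq_bigr => i _.
  rewrite [_^T _ _]mxE [lsubmx _ _ _]mxE [col _ _ _ _]mxE [rsubmx _ _ _]mxE !XofE.
  by rewrite /head_eig tail_eig_rshift; ring.
rewrite !exprMn !sqr_sqrtr ?ltW// tail_eig_rshift -/(head_eig j); field; exact: lt0r_neq0.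
Qed.

(** A first moment is enough here: the mean of the cross energy is of order N d [tail_sqsum], so
    failure has probability O(d / n), which vanishes when n >> d. The factor 8 makes the overlap
    half of the lower bound on the tail energy. *)
Definition cross_event (s : S) : R :=
  8 / (N ^+ 2 * mu) * cross_energy (Xof s : 'M[R]_(n, d + q)) lamv.

Let c0 : 0 <= 8 / (N ^+ 2 * mu).
Proof. by rewrite divr_ge0// mulr_ge0 ?exprn_ge0// ltW// tail_sqsum_gt0. Qed.

Let mcross j (k : 'I_q) : measurable_fun setT (fun s => lamt k ^+ 2 *
    (\sum_i Z s i (lshift q j) * Z s i (rshift d k)) ^+ 2).
Proof.
apply: measurable_funM => //; apply: measurable_funX; apply: measurable_sum => i.
by apply: measurable_funM; exact: mx_measurable_Zof.
Qed.

Let mcross_energy :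
  measurable_fun setT (fun s => cross_energy (Xof s : 'M[R]_(n, d + q)) lamv).
Proof.
under eq_fun do rewrite cross_energyE.
by apply: measurable_sum => k; apply: measurable_sum.
Qed.

Lemma measurable_cross_event : measurable_fun setT cross_event.
Proof. exact: measurable_funM. Qed.

Lemma cross_energy_ge0 s : 0 <= cross_energy (Xof s : 'M[R]_(n, d + q)) lamv.
Proof.
rewrite cross_energyE sumr_ge0// => k _; rewrite sumr_ge0// => j _.
by rewrite mulr_ge0 ?sqr_ge0.
Qed.

Lemma cross_event_ge0 s : 0 <= cross_event s.
Proof. by rewrite mulr_ge0// cross_energy_ge0. Qed.

Lemma integral_cross_event :
  (\int[P]_w (cross_event (Xt w))%:E <= (8 * (8 * (4096 * sigma_x ^+ 4)) * (d%:R / N))%:E)%E.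
Proof.
have m0 := tail_sqsum_gt0.
rewrite integralT_Z//; last 2 first.
- exact: (measurable_Xtuple_comp mcross_energy).
- by move=> w; exact: cross_energy_ge0.
under eq_integral do rewrite cross_energyE.
rewrite integralT_sum; last 2 first.
- by move=> k; apply: measurable_sum => j; exact: (measurable_Xtuple_comp (mcross _ _)).
- by move=> k w; rewrite sumr_ge0// => j _; rewrite mulr_ge0 ?sqr_ge0.
apply: (@le_trans _ _ ((8 / (N ^+ 2 * mu))%:E *
  \sum_(k < q) (lamt k ^+ 2 * (d%:R * (8 * (4096 * sigma_x ^+ 4 * N))))%:E)%E).
  apply: lee_wpmul2l; first by rewrite lee_fin.
  apply: lee_sum => k _.
  rewrite integralT_sum; last 2 first.
  - by move=> j; exact: (measurable_Xtuple_comp (mcross _ _)).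
  - by move=> j w; rewrite mulr_ge0 ?sqr_ge0.
  apply: (@le_trans _ _ (\sum_(j < d) (lamt k ^+ 2 * (8 * (4096 * sigma_x ^+ 4 * N)))%:E)%E).
    apply: lee_sum => j _.
    rewrite integralT_Z ?sqr_ge0//; last 2 first.
    - apply: measurable_funX; apply: measurable_sum => i.
      apply: (measurable_Xtuple_comp (F := fun s => Z s i (lshift q j) * Z s i (rshift d k))).
      by apply: measurable_funM; exact: mx_measurable_Zof.
    - by move=> w; rewrite sqr_ge0.
    rewrite (EFinM (lamt k ^+ 2)); apply: lee_wpmul2l; first by rewrite lee_fin sqr_ge0.
    by apply: (integral_cross_sqr Hm n0); rewrite eq_lrshift.
  by rewrite sumEFin lee_fin sumr_const card_ord -mulr_natl; lra.
rewrite sumEFin -mulr_suml -/mu -EFinM lee_fin; apply: eq_ler.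
by field; rewrite !gt_eqF.
Qed.

Lemma cross_event_bound s : cross_event s <= 1 ->
  cross_energy (Xof s : 'M[R]_(n, d + q)) lamv / (2^-1 * N) <= N * mu / 4.
Proof.
have m0 := tail_sqsum_gt0.
rewrite /cross_event mulrAC ler_pdivrMr ?mulr_gt0 ?exprn_gt0// mul1r => H.
by rewrite ler_pdivrMr ?mulr_gt0//; lra.
Qed.

End moment_events.

(** * Risk bounds with high probability *)

Section fixed_sample_size.
Context (R : realType) (sigma_x : R) (n : nat) (m : model R n).
Hypothesis Hm : model_axioms sigma_x m.
Hypothesis n0 : (0 < n)%N.
Local Notation d := (mhead m).
Local Notation q := (mtail m).
Local Notation p := (mhead m + mtail m)%N.
Local Notation S := (n.-tuple (p.-tuple R)).
Local Notation P := (prob m).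
Local Notation Xt := (@Xtuple R n m).
Local Notation N := (n%:R : R).
Local Notation lamt := (tail_eig m).
Local Notation lamh := (@head_eig R n m).
Local Notation lamv := (@eig R n m).
Local Notation s0 := (chernoff_rate sigma_x).

Let sx1 : 1 <= sigma_x := sigma_x_ge1 Hm n0.
Let sx2 : 0 < sigma_x ^+ 2. Proof. by rewrite exprn_gt0// (lt_le_trans ltr01). Qed.
Let N0 : 0 < N. Proof. by rewrite ltr0n. Qed.
Let d0 : (0 < d)%N. Proof. by case: Hm. Qed.
Let q0 : (0 < q)%N. Proof. by case: Hm => _ []. Qed.

Definition likely (B : set S) (rho : R) :=
  measurable B /\ (P (~` (Xt @^-1` B)) <= rho%:E)%E.

Lemma likely_le B r1 r2 : likely B r1 -> r1 <= r2 -> likely B r2.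
Proof. by move=> [mB PB] r12; split=> //; apply: le_trans PB _; rewrite lee_fin. Qed.

Lemma likely_cap B1 B2 r1 r2 : likely B1 r1 -> likely B2 r2 ->
  likely (B1 `&` B2) (r1 + r2).
Proof.
move=> [m1 P1] [m2 P2]; split; first exact: measurableI.
rewrite preimage_setI setCI EFinD.
apply: le_trans (leeD P1 P2).
by apply: measureU2; apply: measurableC; exact: measurable_Xtuple_pre.
Qed.

Let G1 : likely [set s | head_event sigma_x s <= 1]
  (2 ^+ (18 * d) * (2 * expR (- (s0 * N / 8)))).
Proof.
exact: (markov_event (@measurable_head_event _ _ _ _) (@head_event_ge0 _ _ _ _)
  (integral_head_event Hm n0)).
Qed.

Let G2 : likely [set s | tail_event sigma_x s <= 1] (expR (- N)).
Proof.
exact: (markov_event (@measurable_tail_event _ _ _ _) (@tail_event_ge0 _ _ _ _ Hm)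
  (integral_tail_event Hm n0)).
Qed.

Let G3 : likely [set s | signal_event sigma_x s <= 1] (expR (- N)).
Proof.
exact: (markov_event (@measurable_signal_event _ _ _ _) (fun s => expR_ge0 _)
  (integral_signal_event Hm n0)).
Qed.

Let G4 : likely [set s | energy_upper_event sigma_x s <= 1] (expR (- N)).
Proof.
exact: (markov_event (@measurable_energy_upper_event _ _ _ _) (fun s => expR_ge0 _)
  (integral_energy_upper_event Hm n0)).
Qed.

Let G5 : likely [set s | energy_lower_event sigma_x s <= 1] (expR (- (s0 * N / 4))).
Proof.
exact: (markov_event (@measurable_energy_lower_event _ _ _ _) (fun s => expR_ge0 _)
  (integral_energy_lower_event Hm n0)).
Qed.

Let G6 : likely [set s | cross_event s <= 1] (8 * (8 * (4096 * sigma_x ^+ 4)) * (d%:R / N)).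
Proof.
exact: (markov_event (measurable_cross_event Hm) (cross_event_ge0 Hm)
  (integral_cross_event Hm n0)).
Qed.

Definition head_signal : R := wsq (fun i => (lamh i)^-1) (usubmx (theta m)).

Lemma head_signal_ge0 : 0 <= head_signal.
Proof. by apply: wsq_ge0 => i; rewrite invr_ge0; exact: ltW (eig_gt0 Hm _). Qed.

Definition tail_cst (C1 : R) : R := 160 * sigma_x ^+ 2 * (1 + C1).

Lemma tail_cst_gt0 C1 : 0 <= C1 -> 0 < tail_cst C1.
Proof.
move=> C10; apply: mulr_gt0; first exact: mulr_gt0.
exact: ltr_wpDr.
Qed.

Let tail_bound C1 s : eff_rank m 1 / N <= C1 -> tail_event sigma_x s <= 1 ->
  forall w : 'cV[R]_q, sqn (rsubmx (Xof s : 'M[R]_(n, d + q)) *m w) <=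
    N * tail_cst C1 * lamt 0 * sqn w.
Proof.
move=> HC Hs w; apply: le_trans (tail_event_bound Hm n0 Hs w) _.
rewrite ler_wpM2r ?sqn_ge0//.
have c0 : 0 <= 160 * sigma_x ^+ 2 * N by apply: mulr_ge0 (ltW N0); exact: mulr_ge0 _ (ltW sx2).
have := ler_wpM2l c0 (block_total_le Hm n0 HC).
move=> h; apply: (le_trans h).
by rewrite /tail_cst; apply: eq_ler; ring.
Qed.

Let risk_risk_form (M : 'M[R]_(mdim m, n)) X :
  risk M X = risk_form (X : 'M[R]_(n, d + q)) lamv (theta m) (sigma m ^+ 2) M.
Proof. by []. Qed.

Lemma mse_risk_upper (C1 A0 : R) : 0 <= C1 -> eff_rank m 1 / N <= C1 ->
  let K := upper_cst 2^-1 (tail_cst C1) A0 in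
  exists2 B : set S,
    likely B (2 ^+ (18 * d) * (2 * expR (- (s0 * N / 8))) + 3 * expR (- N)) &
    forall s tau, B s -> 0 < tau -> lamt 0 <= A0 * tau ->
    mse_risk tau (Xof s) <=
      (K + 2 * A0) * (2 * (8 * sigma_x ^+ 2 * tail_signal m) +
        2 * K * tau ^+ 2 * head_signal) + 2 * tail_signal m +
      sigma m ^+ 2 * (2 * K * d%:R / N +
        8 * sigma_x ^+ 2 * N * tail_sqsum m / (N * tau) ^+ 2).
Proof.
move=> C10 HC K.
have G := likely_cap (likely_cap (likely_cap G1 G2) G3) G4.
eexists; first by apply: likely_le G _; lra.
move=> s tau [[[/= H1 H2] H3] H4] t0 lA.
have l0 : 0 < lamt 0 by exact: tail_eig_gt0 Hm _ q0.
have L0 : 0 <= tail_cst C1 by exact: ltW (tail_cst_gt0 C10).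
have A00 : 0 < A0 by rewrite -(pmulr_lgt0 _ t0) (lt_le_trans l0).
have K0 : 0 < K.
  by rewrite /K /upper_cst; apply: mulr_gt0; [exact: divr_gt0|apply: ltr_pwDl => //;
    apply: mulr_ge0 => //; exact: ltW].
rewrite /mse_risk risk_risk_form /ridge_op t0.
have HA v := (head_event_bounds Hm n0 H1 v).1.
have := risk_form_upper (lam := lamv) N0 t0 (eig_gt0 Hm) (c := 2^-1) ltac:(lra) L0 l0 lA HA
  (tail_bound HC H2) (fun k => tail_eig_anti Hm (leq0n k)) (theta m) (sqr_ge0 (sigma m)).
rewrite -/K => h; apply: (le_trans h).
apply: lerD; last first.
  rewrite ler_wpM2l ?sqr_ge0// lerD2l ler_wpM2r ?invr_ge0 ?sqr_ge0//.
  exact: energy_upper_event_bound Hm n0 _ H4.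
rewrite lerD2r; apply: ler_wpM2l.
  by apply: addr_ge0; [exact: ltW|apply: mulr_ge0 => //; exact: ltW].
rewrite lerD2r; apply: ler_wpM2l => //; rewrite ler_pdivrMr//.
by have := signal_event_bound Hm n0 H3; lra.
Qed.

(** The risk is a polynomial in the entries of the operator, hence continuous along the sequence
    that defines the ridgeless one. *)
Lemma risk_form_limit (X : 'M[R]_(n, d + q)) (C : R) :
  (\forall k \near \oo, C <= risk_form X lamv (theta m) (sigma m ^+ 2)
     (reg_inv X (harmonic k))) ->
  C <= mse_risk 0 (X : 'M[R]_(n, mdim m)).
Proof.
move=> H; rewrite /mse_risk risk_risk_form.
set W := ridge_op 0 _.
have cM j i : reg_inv X (harmonic k) j i @[k --> \oo] --> (W : 'M[R]_(d + q, n)) j i.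
  exact: reg_inv_limit_cvg (ridge_op0_limit X).
have cv : risk_form X lamv (theta m) (sigma m ^+ 2) (reg_inv X (harmonic k)) @[k --> \oo] -->
    risk_form X lamv (theta m) (sigma m ^+ 2) W.
  apply: cvg_big => [|j _]; first exact: add_continuous.
  have c2 (u : nat -> R) (a : R) : u k @[k --> \oo] --> a -> u k ^+ 2 @[k --> \oo] --> a ^+ 2.
    by move=> cu; rewrite expr2; under eq_fun do rewrite expr2; exact: cvgM.
  apply: cvgM; first exact: cvg_cst.
  apply: cvgD.
    apply: c2; rewrite [X in _ --> X]mxE; under eq_fun do rewrite mxE.
    apply: cvgD; last exact: cvg_cst.
    rewrite -mulmxA [X in _ --> X]mxE; under eq_fun do rewrite -mulmxA mxE.
    apply: cvg_big => [|i _]; first exact: add_continuous.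
    by apply: cvgM; [exact: cM|exact: cvg_cst].
  apply: cvgM; first exact: cvg_cst.
  apply: cvg_big => [|i _]; first exact: add_continuous.
  by apply: c2; exact: cM.
rewrite -(cvg_lim _ cv)//; apply: limr_ge => //.
by apply/cvg_ex; eexists; exact: cv.
Qed.

Lemma mse_risk_lower (C1 : R) : 0 <= C1 -> eff_rank m 1 / N <= C1 ->
  exists2 B : set S,
    likely B (2 ^+ (18 * d) * (2 * expR (- (s0 * N / 8))) + 2 * expR (- N) +
      expR (- (s0 * N / 4)) + 8 * (8 * (4096 * sigma_x ^+ 4)) * (d%:R / N)) &
    forall s tau, B s -> 0 <= tau ->
      sigma m ^+ 2 * (N * tail_sqsum m / 4) /
        (N * (2 * tail_cst C1 * lamt 0 + tau)) ^+ 2 <= mse_risk tau (Xof s) /\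
      (0 < tau -> tau ^+ 2 * head_signal <=
        (2 * (tau / lam m d) ^+ 2 + 9) * mse_risk tau (Xof s) +
        6 * (8 * sigma_x ^+ 2 * tail_signal m)).
Proof.
move=> C10 HC.
have G := likely_cap (likely_cap (likely_cap (likely_cap G1 G2) G3) G5) G6.
eexists; first by apply: likely_le G _; lra.
move=> s tau [[[[/= H1 H2] H3] H4] H5] t0.
have l0 : 0 < lamt 0 by exact: tail_eig_gt0 Hm _ q0.
have L0 : 0 < tail_cst C1 := tail_cst_gt0 C10.
have HA v := (head_event_bounds Hm n0 H1 v).1.
have HU v := (head_event_bounds Hm n0 H1 v).2.
have m0 := tail_sqsum_gt0 Hm.
have B0 : 0 <= tail_cst C1 * lamt 0 by rewrite mulr_ge0// ltW.
have HB (w : 'cV[R]_q) : sqn (rsubmx (Xof s : 'M[R]_(n, d + q)) *m w) <=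
    N * (tail_cst C1 * lamt 0) * sqn w by rewrite [N * _]mulrA; exact: tail_bound.
have var t : 0 < t -> sigma m ^+ 2 * (N * tail_sqsum m / 4) /
    (N * (tail_cst C1 * lamt 0 + t)) ^+ 2 <=
    risk_form (Xof s : 'M[R]_(n, d + q)) lamv (theta m) (sigma m ^+ 2)
      (reg_inv (Xof s : 'M[R]_(n, d + q)) (N * t)).
  move=> tp; have := risk_form_lower_variance N0 tp (eig_gt0 Hm) (c := 2^-1)
    ltac:(lra) B0 HA HB (theta m) (sqr_ge0 (sigma m)).
  apply: le_trans; rewrite ler_wpM2r ?invr_ge0 ?sqr_ge0// ler_wpM2l ?sqr_ge0//.
  have := energy_lower_event_bound Hm n0 H4; have := cross_event_bound Hm n0 H5; lra.
(* Doubling [tail_cst] leaves room for a shift of the parameter: at tau = 0 the bounds for small t >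
   0 share one constant as soon as t <= tail_cst C1 * lamt 0, and pass to the limit. *)
have mono t u : 0 <= t -> 0 <= u -> t <= tail_cst C1 * lamt 0 + u ->
    sigma m ^+ 2 * (N * tail_sqsum m / 4) / (N * (2 * tail_cst C1 * lamt 0 + u)) ^+ 2 <=
    sigma m ^+ 2 * (N * tail_sqsum m / 4) / (N * (tail_cst C1 * lamt 0 + t)) ^+ 2.
  move=> tt uu tle; have lp : 0 < tail_cst C1 * lamt 0 by exact: mulr_gt0.
  apply: ler_wpM2l.
    by apply: mulr_ge0; [exact: sqr_ge0|apply: divr_ge0 => //; apply: mulr_ge0; exact: ltW].
  have p1 : 0 < N * (tail_cst C1 * lamt 0 + t) by apply: mulr_gt0 => //; exact: ltr_wpDr.
  have p2 : N * (tail_cst C1 * lamt 0 + t) <= N * (2 * tail_cst C1 * lamt 0 + u).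
    by rewrite ler_pM2l//; lra.
  have p3 := lt_le_trans p1 p2.
  by rewrite lef_pV2 ?posrE ?exprn_gt0// ler_sqr// nnegrE ltW.
split.
  move: t0; rewrite le_eqVlt => /predU1P[<-|tp].
    apply: risk_form_limit.
    have : 0 < N * (tail_cst C1 * lamt 0) by apply: mulr_gt0 => //; exact: mulr_gt0.
    have /cvgrPdist_le/[apply] := @cvg_harmonic R.
    apply: filterS => k; rewrite sub0r normrN ger0_norm ?harmonic_ge0// => hk.
    have hp : 0 < (harmonic k : R) by exact: harmonic_gt0.
    have hN : 0 < harmonic k / N by rewrite divr_gt0.
    have := var _ hN; rewrite [X in reg_inv _ X]mulrC divfK ?gt_eqF// => h.
    apply: le_trans h.
    by apply: mono; rewrite ?(ltW hN)// addr0 ler_pdivrMr// mulrC.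
  rewrite /mse_risk risk_risk_form /ridge_op tp; apply: le_trans (var _ tp).
  by apply: mono; [exact: ltW|exact: ltW|rewrite lerDr].
move=> tp.
have dd : (d.-1 < d)%N by rewrite ltn_predL.
have ldp : 0 < lam m d.
  exact: (eig_gt0 Hm (lshift q (Ordinal dd))).
have ldl i : lam m d <= lamh i.
  have := eig_anti Hm (i := lshift q i) (j := lshift q (Ordinal dd)); apply => /=.
  by rewrite -ltnS prednK.
(* The value U = 3/2 comes from [head_event_bounds]; it gives 4 U^2 = 9 and 4 U = 6. *)
have := risk_form_lower_bias N0 tp (eig_gt0 Hm) (U := 3 / 2) (theta m) ltac:(lra) ldp
  (sqr_ge0 (sigma m)) ldl HU.
rewrite /mse_risk risk_risk_form /ridge_op tp.
set Rk := risk_form _ _ _ _ _ => h; apply: (le_trans h).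
have h3 : sqn (rsubmx (Xof s : 'M[R]_(n, d + q)) *m dsubmx (theta m)) / N <=
   8 * sigma_x ^+ 2 * tail_signal m.
  by rewrite ler_pdivrMr//; have := signal_event_bound Hm n0 H3; lra.
lra.
Qed.

End fixed_sample_size.

Lemma invmx_diag (R : realType) k (D : 'rV[R]_k) : (forall j, 0 < D 0 j) ->
  invmx (diag_mx D) = diag_mx (\row_j (D 0 j)^-1).
Proof.
move=> D0; set D' := diag_mx (\row_j _).
have DD : diag_mx D *m D' = 1%:M.
  rewrite mulmx_diag; apply/matrixP => i j; rewrite !mxE.
  by case: eqP => // _; rewrite mulfV// gt_eqF.
have /mulmx1_unit[uD _] := DD.
by rewrite -[RHS]mul1mx -(mulVmx uD) -mulmxA DD mulmx1.
Qed.

(** Only convergence to 0 matters, so all exponential failure probabilities are weakened to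
    multiples of 1 / N. *)
Lemma expRN_le_inv (R : realType) (x : R) : 0 < x -> expR (- x) <= x^-1.
Proof.
move=> x0; rewrite expRN lef_pV2 ?posrE ?expR_gt0//.
by have := expR_ge1Dx x; lra.
Qed.

(** * The rate d / n at a fixed sample size *)

Section rates.
Context (R : realType) (sigma_x : R) (n : nat) (m : model R n).
Hypothesis Hm : model_axioms sigma_x m.
Hypothesis n0 : (0 < n)%N.
Local Notation d := (mhead m).
Local Notation N := (n%:R : R).
Local Notation l := (lam m d.+1).
Local Notation L := (lam m d).
Local Notation r := (eff_rank m 2).
Local Notation V := (head_signal m).
Local Notation W := (tail_signal m).
Local Notation s0 := (chernoff_rate sigma_x).
Local Notation rate := (d%:R / N).

Let N0 : 0 < N. Proof. by rewrite ltr0n. Qed.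
Let d0 : (0 < d)%N. Proof. by case: Hm. Qed.
Let dR : 1 <= d%:R :> R. Proof. by rewrite ler1n. Qed.
Let q0 : (0 < mtail m)%N. Proof. by case: Hm => _ []. Qed.
Let sx1 : 1 <= sigma_x := sigma_x_ge1 Hm n0.
Let s00 : 0 < s0 := chernoff_rate_gt0 Hm n0.

Lemma tail_eigE : l = tail_eig m 0. Proof. by rewrite /tail_eig addn0. Qed.

Lemma lam_tail_gt0 : 0 < l. Proof. by rewrite tail_eigE; exact: tail_eig_gt0 Hm _ q0. Qed.

Lemma lam_head_gt0 : 0 < L.
Proof.
have dd : (d.-1 < d)%N by rewrite ltn_predL.
exact: (eig_gt0 Hm (lshift (mtail m) (Ordinal dd))).
Qed.

Lemma tail_signalE : normM (Sigma_tail m) (theta_tail m) ^+ 2 = W.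
Proof.
rewrite normM_diag; first by apply: eq_bigr => k _; rewrite mxE.
by move=> k; rewrite mxE; exact: tail_eig_ge0 Hm _.
Qed.

Lemma head_signalE : normM (invmx (Sigma_head m)) (theta_head m) ^+ 2 = V.
Proof.
have h0 i : 0 < (\row_(j < d) lam m j.+1) 0 i :> R.
  by rewrite mxE; exact: (eig_gt0 Hm (lshift (mtail m) i)).
rewrite /Sigma_head invmx_diag// normM_diag.
  by apply: eq_bigr => k _; rewrite !mxE.
by move=> k; rewrite mxE invr_ge0 ltW.
Qed.

Lemma tail_sqsumE : tail_sqsum m = r * l ^+ 2.
Proof.
by rewrite eff_rankE -tail_eigE mulfVK// gt_eqF// exprn_gt0// lam_tail_gt0.
Qed.

Lemma eff_rank_gt0 : 0 < r.
Proof. by rewrite -(pmulr_lgt0 _ (exprn_gt0 2 lam_tail_gt0)) -tail_sqsumE (tail_sqsum_gt0 Hm).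
  Qed.

Hypothesis small_rate : 1024 * sigma_x ^+ 2 * Num.sqrt rate < 2^-1.

Let head_prob_le : 2 ^+ (18 * d) * (2 * expR (- (s0 * N / 8))) <= 32 / s0 / N.
Proof.
have sx2 : 0 < sigma_x ^+ 2 by rewrite exprn_gt0// (lt_le_trans ltr01).
have key : 18 * d%:R <= s0 * N / 16.
  (* By the choice of [s0], d / N = s0 t^2, and [small_rate] reads 16 t < 1/2. Hence 18 d <= s0 N /
     16, and half of the Chernoff exponent survives the cardinality of the net. *)
  pose t := 64 * sigma_x ^+ 2 * Num.sqrt rate.
  have t0 : 0 <= t by apply: mulr_ge0 (sqrtr_ge0 _); exact: mulr_ge0 (ltW sx2).
  have t1 : 32 * t <= 1 by move: small_rate; rewrite /t; lra.
  have t2 : 288 * t ^+ 2 <= 1 by nra.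
  have dE : d%:R = N * (s0 * t ^+ 2).
    rewrite /t exprMn sqr_sqrtr ?divr_ge0// /chernoff_rate.
    have : (64 * sigma_x ^+ 2) ^+ 2 != 0 by rewrite expf_neq0// mulf_neq0// gt_eqF.
    by move: (_ ^+ 2) => k k0; field; rewrite k0 gt_eqF.
  by have := ler_wpM2l (ltW (mulr_gt0 s00 N0)) t2; rewrite dE; lra.
have sN : 0 < s0 * N / 16 by rewrite divr_gt0// mulr_gt0.
apply: (@le_trans _ _ (2 * expR (- (s0 * N / 16)))).
  rewrite mulrCA; apply: ler_wpM2l => //.
  apply: le_trans (ler_wpM2r (expR_ge0 _) (pow2_le_expR R (18 * d))) _.
  by rewrite -expRD ler_expR natrM; lra.
have := expRN_le_inv sN; have -> : (s0 * N / 16)^-1 = 16 / s0 / N.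
  by field; rewrite !gt_eqF.
lra.
Qed.

Definition risk_cst (C1 A0 c e a a' : R) : R :=
  let K := upper_cst 2^-1 (tail_cst sigma_x C1) A0 in
  (K + 2 * A0) * (16 * sigma_x ^+ 2 * e * c ^+ 2 * a' + 2 * K * (A0 * c) ^+ 2 * a') +
  2 * e * c ^+ 2 * a' + a * (2 * K + 8 * sigma_x ^+ 2 * (A0 * c) ^+ 2).

Variables (C1 : R) (tau : R) (M : Omega m -> \bar R).
Hypotheses (C10 : 0 <= C1) (HC : eff_rank m 1 / N <= C1).
Hypotheses (tau0 : 0 <= tau) (HM : is_MSE_out tau M).

Lemma mse_upper_prob (A0 c e a a' : R) : 1 <= A0 -> 1 <= c ->
  0 <= e -> 0 <= a -> 0 <= a' ->
  eig_ratio m <= c * suff_bound m -> suff_tau_range A0 c m tau ->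
  sigma m ^+ 2 <= a -> V * L ^+ 2 <= a' -> W <= e * l ^+ 2 * V ->
  ((1 - (32 / s0 + 3) / N)%:E <=
    prob m [set w | (M w <= ((risk_cst C1 A0 c e a a' + 1) * rate)%:E)%E])%E.
Proof.
move=> A1 c1 e0 a0 a'0 Hr Ht sa Va We.
set K := upper_cst 2^-1 (tail_cst sigma_x C1) A0; set C := risk_cst _ _ _ _ _ _.
have dp : 0 < d%:R :> R by rewrite (lt_le_trans ltr01).
have [tp lA l2 t2 rt] := tuning_range_bounds lam_tail_gt0 lam_head_gt0 dp N0 eff_rank_gt0
  c1 A1 Hr Ht.
have [B [mB PB] HB] := @mse_risk_upper _ _ _ _ Hm n0 _ A0 C10 HC.
have K0 : 0 < K.
  rewrite /K /upper_cst; apply: mulr_gt0; first exact: divr_gt0.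
  apply: ltr_pwDl => //; apply: mulr_ge0; first exact: ltW (tail_cst_gt0 Hm n0 C10).
  by lra.
have A00 : 0 < A0 by lra.
have rp : 0 < rate by rewrite divr_gt0.
have HCs s : B s -> mse_risk tau (Xof s) <= C * rate.
  move=> Bs; apply: le_trans (HB _ _ Bs tp _) _; first by rewrite -tail_eigE.
  apply: (risk_rate_upper K0 A00 (sqr_ge0 sigma_x) e0 a0 a'0 dp N0 tp lam_head_gt0
    (head_signal_ge0 Hm) (sqr_ge0 _) sa Va We tail_sqsumE l2 t2 rt).
have C0 : 0 <= C * rate.
  rewrite /C /risk_cst -/K.
  apply: mulr_ge0; last exact: ltW.
  have c2 : 0 <= c ^+ 2 := sqr_ge0 c.
  have Ac2 : 0 <= (A0 * c) ^+ 2 := sqr_ge0 _.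
  have sx2 : 0 <= sigma_x ^+ 2 := sqr_ge0 _.
  have p1 : 0 <= sigma_x ^+ 2 * e * c ^+ 2 * a' := mulr_ge0 (mulr_ge0 (mulr_ge0 sx2 e0) c2) a'0.
  have p2 : 0 <= K * (A0 * c) ^+ 2 * a' := mulr_ge0 (mulr_ge0 (ltW K0) Ac2) a'0.
  have p3 : 0 <= e * c ^+ 2 * a' := mulr_ge0 (mulr_ge0 e0 c2) a'0.
  have p4 : 0 <= sigma_x ^+ 2 * (A0 * c) ^+ 2 := mulr_ge0 sx2 Ac2.
  apply: addr_ge0; first apply: addr_ge0; last 2 first.
  - lra.
  - by apply: mulr_ge0 => //; lra.
  by apply: mulr_ge0; lra.
(* The strict gap that [mse_le_prob] requires. *)
have CC : C * rate < (C + 1) * rate by rewrite ltr_pM2r// ltrDl.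
apply: le_trans (mse_le_prob Hm n0 tau0 HM mB C0 CC HCs).
have mX : measurable (@Xtuple R n m @^-1` B) := measurable_Xtuple_pre mB.
rewrite -[X in prob m X]setCK probability_setC; last exact: measurableC.
rewrite EFinB; apply: leeB => //; apply: le_trans PB _; rewrite lee_fin.
have := expRN_le_inv N0; move: head_prob_le; rewrite mulrDl; lra.
Qed.

(** If every design in the good event had risk above 2 C d / n, then M <= C d / n would have at most
    the failure probability, which is below eps. So some design in the event has risk at most 2 C d
    / n, and it yields deterministic inequalities on tau. *)
Lemma mse_lower_sample (C eps : R) : 0 < C ->
  (eps%:E <= prob m [set w | (M w <= (C * rate)%:E)%E])%E ->
  (36 / s0 + 2 + 8 * (8 * (4096 * sigma_x ^+ 4))) * rate < eps ->
  sigma m ^+ 2 * r * l ^+ 2 <=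
    4 * (2 * C) * d%:R * (2 * tail_cst sigma_x C1 * l + tau) ^+ 2 /\
  (0 < tau -> tau ^+ 2 * V <= (2 * (tau / L) ^+ 2 + 9) * (2 * C * rate) +
     6 * (8 * sigma_x ^+ 2 * W)).
Proof.
move=> C0 Heps Hsmall.
have dp : 0 < d%:R :> R by rewrite (lt_le_trans ltr01).
have rp : 0 < rate by rewrite divr_gt0.
have [B [mB PB] HB] := @mse_risk_lower _ _ _ _ Hm n0 _ C10 HC.
have [s Bs Hs] : exists2 s, B s & mse_risk tau (Xof s) <= 2 * C * rate.
  apply: contrapT => Hno.
  have HB' s : B s -> 2 * C * rate <= mse_risk tau (Xof s).
    move=> Bs; rewrite leNgt; apply/negP => lt; apply: Hno; exists s => //; exact: ltW.
  have Cr : 0 < C * rate by rewrite mulr_gt0.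
  have CC : C * rate < 2 * C * rate by lra.
  have := le_trans Heps (le_trans (mse_ge_prob Hm n0 tau0 HM mB (ltW Cr) CC HB') PB).
  rewrite lee_fin leNgt => /negP; apply; apply: le_lt_trans Hsmall.
  have iN : N^-1 <= rate by rewrite ler_peMl ?invr_ge0.
  have sN : 0 < s0 * N / 4 by rewrite divr_gt0// mulr_gt0.
  have := expRN_le_inv sN; have -> : (s0 * N / 4)^-1 = 4 / s0 / N by field; rewrite !gt_eqF.
  have := expRN_le_inv N0; have h36 : 0 <= 36 / s0 by rewrite divr_ge0// ltW.
  have := ler_wpM2l h36 iN; move: head_prob_le; lra.
have [H1 H2] := HB s tau Bs tau0.
have l0 := lam_tail_gt0.
have T0 := tail_cst_gt0 Hm n0 C10.
split=> [|tp].
  have := le_trans H1 Hs; rewrite -tail_eigE tail_sqsumE.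
  have Tl : 0 < 2 * tail_cst sigma_x C1 * l by apply: mulr_gt0 => //; exact: mulr_gt0.
  have Tt : 0 < 2 * tail_cst sigma_x C1 * l + tau by rewrite ltr_wpDr.
  rewrite ler_pdivrMr ?exprn_gt0 ?mulr_gt0// => h.
  have -> : 4 * (2 * C) * d%:R * (2 * tail_cst sigma_x C1 * l + tau) ^+ 2 =
    4 / N * (2 * C * rate * (N * (2 * tail_cst sigma_x C1 * l + tau)) ^+ 2).
    by field; rewrite gt_eqF.
  have p4 : 0 <= 4 / N by rewrite divr_ge0// ltW.
  apply: le_trans (ler_wpM2l p4 h).
  by apply: eq_ler; field; rewrite gt_eqF.
apply: le_trans (H2 tp) _; rewrite lerD2r; apply: ler_wpM2l => //.
by have := sqr_ge0 (tau / L); lra.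
Qed.

End rates.

(** * Asymptotics along the sequence of models *)

Lemma cvg_invn (R : realType) : (n%:R^-1 : R) @[n --> \oo] --> (0 : R).
Proof.
apply/(gtr0_cvgV0 (f := fun n => n%:R)); last exact: cvgr_idn.
by near=> n; rewrite ltr0n; near: n; exact: nbhs_infty_gt.
Unshelve. all: by end_near. Qed.

Lemma much_less_near (R : realType) (a b : nat -> R) (e : R) : much_less a b -> 0 < e ->
  \forall n \near \oo, a n / b n <= e.
Proof.
move=> + e0 => /cvgrPdist_le/(_ e e0); apply: filterS => n; rewrite sub0r normrN.
by apply: le_trans; exact: ler_norm.
Qed.

Lemma cvg_prob_to_1 (R : realType) (A : R) (p : nat -> \bar R) :
  (\forall n \near \oo, (1 - A / n%:R)%:E <= p n)%E ->
  (forall n, p n <= 1)%E -> p n @[n --> \oo] --> (1 : \bar R)%E.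
Proof.
move=> Hp p1; apply: (@squeeze_cvge _ _ _ _ (fun n => (1 - A / n%:R)%:E) _ (fun=> 1%E)).
- by apply: filterS Hp => n ->; rewrite p1.
- apply: cvg_EFin; first by near=> n.
  rewrite -[X in _ --> X]subr0; apply: cvgB; first exact: cvg_cst.
  by rewrite -(mulr0 A); apply: cvgM; [exact: cvg_cst|exact: cvg_invn].
- exact: cvg_cst.
Unshelve. all: by end_near. Qed.

Lemma sublevel_measurable (R : realType) n (m : model R n) (tau : R)
    (M : Omega m -> \bar R) (x : \bar R) : is_MSE_out tau M ->
  measurable [set w | (M w <= x)%E].
Proof.
move=> HM; have := measurable_M HM measurableT (emeasurable_itv `]-oo, x]).
by rewrite setTI; congr measurable; apply/seteqP; split => w; rewrite /= in_itv.
Qed.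

Lemma much_less_mul_near (R : realType) (a b : nat -> R) (A e : R) :
  (forall n, 0 < a n) -> (\forall n \near \oo, 0 < b n) -> much_less a b -> 0 < e ->
  \forall n \near \oo, A * (a n / b n) < e.
Proof.
move=> a0 b0 ab e0; have A1 : 0 < `|A| + 1 by rewrite ltr_wpDl.
apply: (filterS _ (filterI b0 (much_less_near ab (divr_gt0 e0 A1)))) => n [bn h].
have x0 : 0 < a n / b n by rewrite divr_gt0.
move: h; rewrite ler_pdivlMr// => h.
apply: le_lt_trans (ler_wpM2r (ltW x0) (ler_norm A)) _.
apply: lt_le_trans h; rewrite mulrDr mulr1 mulrC ltrDl//.
Qed.

Theorem corollary1 (R : realType) :
  exists2 C0 : R, 0 < C0 &
  forall (sigma_x C1 delta1 A0 : R)
    (m : forall n : nat, model R n) (tau : nat -> R)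
    (MSE_out : forall n : nat, Omega (m n) -> \bar R),
  (forall n, model_axioms sigma_x (m n)) ->
  (forall n, 0 <= tau n) ->
  (forall n, is_MSE_out (tau n) (MSE_out n)) ->
  (\forall n \near \oo, (mhead (m n) <= n)%N /\
     C0 * sigma_x ^+ 2 * Num.sqrt ((mhead (m n))%:R / n%:R) < 2^-1) ->
  0 < C1 ->
  (\forall n \near \oo, eff_rank (m n) 1 / n%:R <= C1) ->
  0 < delta1 < 1 ->
  (\forall n \near \oo,
     normM (Sigma_tail (m n)) (theta_tail (m n)) ^+ 2 /
     normM (invmx (Sigma_head (m n))) (theta_head (m n)) ^+ 2
     <= delta1 / (4 * (1 + sigma_x ^+ 2)) * lam (m n) (mhead (m n)).+1 ^+ 2) ->
  1 <= A0 ->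
  (1 + A0) ^+ 2 < 4 * delta1^-1 ->
  asymp_eq (fun n => sigma (m n) ^+ 2) (fun=> 1) ->
  asymp_eq (fun n =>
      normM (invmx (Sigma_head (m n))) (theta_head (m n)) ^+ 2 *
      lam (m n) (mhead (m n)) ^+ 2) (fun=> 1) ->
  [/\ lesssim (fun n => eig_ratio (m n)) (fun n => suff_bound (m n)) ->
      (forall c : R, 1 <= c ->
        (\forall n \near \oo, eig_ratio (m n) <= c * suff_bound (m n)) ->
        (\forall n \near \oo, suff_tau_range A0 c (m n) (tau n)) ->
        rate_prob_to_1 m MSE_out),
      much_less (fun n => (mhead (m n))%:R : R) (fun n => n%:R) ->
      much_less (fun n => (mhead (m n))%:R) (fun n => eff_rank (m n) 2) ->
      rate_prob_away_0 m MSE_out ->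
      [/\ lesssim (fun n => eig_ratio (m n)) (fun n => nec_bound (m n)),
          lesssim (fun n => Num.sqrt (eff_rank (m n) 2 / (mhead (m n))%:R) *
                            lam (m n) (mhead (m n)).+1) tau
        & lesssim tau (fun n => Num.sqrt ((mhead (m n))%:R / n%:R) *
                                lam (m n) (mhead (m n)))]
    & much_less (fun n => (mhead (m n))%:R : R) (fun n => n%:R) ->
      much_less (fun n => (mhead (m n))%:R) (fun n => eff_rank (m n) 2) ->
      (lesssim (fun n => eig_ratio (m n)) (fun n => suff_bound (m n)) <->
       lesssim (fun n => eig_ratio (m n)) (fun n => nec_bound (m n)))].
Proof.
(* With 1024, the exponent of the Chernoff bound dominates the logarithm of the
   number [2 ^ (18 d)] of net points. *)
exists 1024; first by rewrite ltr0n.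
move=> sigma_x C1 delta1 A0 m tau MSE Hm tau0 HM Hd C10 HC /andP[d10 _] Hth A1 _
  [[a a0 Ha] [b b0 Hb]] [[a' a'0 Ha'] [b' b'0 Hb']].
pose sx2 := sigma_x ^+ 2; have sx20 : 0 <= sx2 := sqr_ge0 _.
pose e := delta1 / (4 * (1 + sx2)).
have e0 : 0 <= e by apply: divr_ge0; lra.
have base : \forall n \near \oo,
    [/\ (0 < n)%N, 1024 * sx2 * Num.sqrt ((mhead (m n))%:R / n%:R) < 2^-1,
       eff_rank (m n) 1 / n%:R <= C1, sigma (m n) ^+ 2 <= a & 1 <= b * sigma (m n) ^+ 2] /\
    [/\ head_signal (m n) * lam (m n) (mhead (m n)) ^+ 2 <= a',
       1 <= b' * (head_signal (m n) * lam (m n) (mhead (m n)) ^+ 2) &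
       tail_signal (m n) <= e * lam (m n) (mhead (m n)).+1 ^+ 2 * head_signal (m n)].
  apply: (filterS _ (filterI Hd (filterI HC (filterI Hth (filterI Ha (filterI Hb (filterI Ha'
    (filterI Hb' (nbhs_infty_gt 0))))))))) => n [[_ hd] [hC [hth [ha [hb [ha' [hb' n0]]]]]]].
  rewrite !(head_signalE (Hm n)) in hth ha' hb'; rewrite (tail_signalE (Hm n)) in hth.
  rewrite !mulr1 in ha ha'; split=> //; split=> //.
  (* The lower half of the assumption that the head signal times lambda_d^2 is of order 1 makes the
     denominator in (c) nonzero, so the quotient can be cleared. *)
  have V0 : 0 < head_signal (m n).
    rewrite lt_neqAle (head_signal_ge0 (Hm n)) andbT.
    by apply/eqP => V0; move: hb'; rewrite -V0 mul0r mulr0 ler10.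
  by move: hth; rewrite ler_pdivrMr.
have dge1 n : 1 <= (mhead (m n))%:R :> R by rewrite ler1n; case: (Hm n).
have dgt0 n : 0 < (mhead (m n))%:R :> R := lt_le_trans ltr01 (dge1 n).
split.
- move=> _ c c1 Hr Ht.
  exists (risk_cst sigma_x C1 A0 c e a a' + 1).
  apply: (@cvg_prob_to_1 _ (32 / chernoff_rate sigma_x + 3)); last first.
    move=> n; apply: probability_le1.
    exact: sublevel_measurable _ (HM n).
  apply: (filterS _ (filterI base (filterI Hr Ht))) => n [[[n0 sm hC ha _] [ha' _ hW]] [hr ht]].
  exact: (mse_upper_prob (Hm n) n0 sm (ltW C10) hC (tau0 n) (HM n) A1 c1 e0 (ltW a0)
    (ltW a'0) hr ht ha ha' hW).
- move=> dn dr [C [eps [C0 eps0 HP]]].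
  pose T := 2 * tail_cst sigma_x C1.
  pose E := 36 / chernoff_rate sigma_x + 2 + 8 * (8 * (4096 * sigma_x ^+ 4)).
  pose k := 16 * b * (2 * C).
  have k0 : 0 < k by apply: mulr_gt0; exact: mulr_gt0.
  pose k' := 18 * b' * (2 * C).
  have k'0 : 0 < k' by apply: mulr_gt0; exact: mulr_gt0.
  have near0 : \forall n \near \oo, 0 < (n%:R : R).
    by apply: (filterS _ (nbhs_infty_gt 0)) => n; rewrite ltr0n.
  have rgt0 : \forall n \near \oo, 0 < eff_rank (m n) 2.
    by apply: (filterS _ (nbhs_infty_gt 0)) => n n0; exact: eff_rank_gt0 (Hm n).
  have dnA A t (t0 : 0 < t) := much_less_mul_near A dgt0 near0 dn t0.
  have drA A t (t0 : 0 < t) := much_less_mul_near A dgt0 rgt0 dr t0.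
  have bounds : \forall n \near \oo, (0 < n)%N /\
      Num.sqrt (eff_rank (m n) 2 / (mhead (m n))%:R) * lam (m n) (mhead (m n)).+1 <=
        Num.sqrt k * tau n /\
      tau n <= Num.sqrt k' *
        (Num.sqrt ((mhead (m n))%:R / n%:R) * lam (m n) (mhead (m n))).
    (* Four consequences of n >> d and r_d(Sigma^2) >> d, in order: the failure probability drops
       below eps; tau dominates T times lambda_(d+1); the tail signal is absorbed; the term with
       (tau / lambda_d)^2 is absorbed. *)
    apply: (filterS _ (filterI (filterI base HP) (filterI (filterI (dnA E _ eps0)
      (drA (16 * b * (2 * C) * T ^+ 2) _ ltr01)) (filterI (drA (192 * sx2 * e * k) _ ltr01)
      (dnA (8 * (2 * C) * b') _ ltr01))))) =>
      n [[[[n0 sm hC _ hb] [_ hb' hW]] hP] [[h1 h2] [h3 h4]]].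
    have [var bias] := mse_lower_sample (Hm n) n0 sm (ltW C10) hC (tau0 n) (HM n) C0 hP h1.
    have l0 := lam_tail_gt0 (Hm n).
    have L0 := lam_head_gt0 (Hm n).
    have r0 := eff_rank_gt0 (Hm n).
    have N0 : 0 < (n%:R : R) by rewrite ltr0n.
    have s20 : 0 < sigma (m n) ^+ 2.
      by rewrite -(pmulr_rgt0 _ b0) (lt_le_trans ltr01).
    have C20 : 0 <= 2 * C by rewrite mulr_ge0// ltW.
    have T0 : 0 <= T by rewrite mulr_ge0// ltW// (tail_cst_gt0 (Hm n) n0 (ltW C10)).
    have h2' : 16 * b * (2 * C) * T ^+ 2 * (mhead (m n))%:R <= eff_rank (m n) 2.
      by move: h2; rewrite mulrA ltr_pdivrMr// mul1r => /ltW.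
    have rl := tuning_lower_necessary b0 C20 (dgt0 n) l0 (tau0 n) T0 s20 hb var h2'.
    (* The lower bound [rl] excludes the ridgeless estimator, as its left-hand side is positive;
       only then is the bias inequality available. *)
    have tp : 0 < tau n.
      rewrite lt_neqAle tau0 andbT; apply/eqP => t0.
      move: rl; rewrite -t0 expr0n mulr0 leNgt => /negP; apply.
      by rewrite mulr_gt0// exprn_gt0.
    have rl2 : lam (m n) (mhead (m n)).+1 ^+ 2 <=
        k * ((mhead (m n))%:R / eff_rank (m n) 2) * tau n ^+ 2.
      by rewrite -(ler_pM2l r0); apply: le_trans rl _; apply: eq_ler; rewrite /k; field;
        rewrite gt_eqF.
    have h3' : 192 * sx2 * e * (k * ((mhead (m n))%:R / eff_rank (m n) 2)) <= 1.
      by rewrite mulrA ltW.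
    have h4' : 8 * (2 * C) * ((mhead (m n))%:R / n%:R) * b' <= 1 by rewrite mulrAC ltW.
    have tL := tuning_upper_necessary b'0 C20 (divr_gt0 (dgt0 n) N0) L0
      (head_signal_ge0 (Hm n)) sx20 e0 hb' hW rl2 h3' h4' (bias tp).
    split=> //; split.
      apply: ler_sqrt_mul => //; first exact: ltW.
      have rd : 0 < eff_rank (m n) 2 / (mhead (m n))%:R by rewrite divr_gt0.
      rewrite exprMn sqr_sqrtr ?(ltW rd)// mulrAC ler_pdivrMr//.
      by apply: le_trans rl _; rewrite mulrAC.
    have D0 : 0 < (mhead (m n))%:R / n%:R :> R by rewrite divr_gt0.
    apply: ler_sqrt_mul; [by rewrite mulr_ge0 ?sqrtr_ge0 ?ltW|exact: ltW|].
    by rewrite exprMn sqr_sqrtr ?(ltW D0)// mulrA.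
  split.
  - exists (Num.sqrt k * Num.sqrt k'); first by rewrite mulr_gt0 ?sqrtr_gt0.
    apply: (filterS _ bounds) => n [n0 [h1 h2]].
    exact: eig_ratio_necessary (lam_head_gt0 (Hm n)) (dgt0 n) (eff_rank_gt0 (Hm n))
      (sqrtr_ge0 _) h1 h2.
  - exists (Num.sqrt k); first by rewrite sqrtr_gt0.
    by apply: (filterS _ bounds) => n [_ []].
  - exists (Num.sqrt k'); first by rewrite sqrtr_gt0.
    by apply: (filterS _ bounds) => n [_ []].
(* The two bounds differ only by the minimum with 1, which is eventually attained by the root
   because d / r_d(Sigma^2) tends to 0. *)
move=> _ dr; split=> -[c c0 Hc]; exists c => //.
  move: Hc; apply: filterS => n h; apply: le_trans h _.
  rewrite ler_pM2l// ler_wpM2l ?sqrtr_ge0//.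
  by rewrite ge_min lexx orbT.
apply: (filterS _ (filterI Hc (much_less_near dr ltr01))) => n [h h1].
apply: (le_trans h); rewrite /nec_bound /suff_bound min_r//.
by rewrite -[leRHS]sqrtr1 ler_wsqrtr.
Qed.
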